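(* Let $\mu \ge 0$ be a finite positive measure on $\partial\mathbb{D}$ that is singular with respect to Lebesgue measure, and let $S_\mu$ be the associated singular inner function. Consider the following conditions: (0) The measure $\mu$ is supported on a Beurling-Carleson set. (1) $S_\mu' \in \mathcal{N}$. (2) $S_\mu$ satisfies the area condition: for every $0<c<1$, $$\int_{\{z\in\mathbb{D}:\ |S_\mu(z)|<c\}} \frac{dA(z)}{1-|z|} < \infty .$$ (3) The measure $\mu$ is concentrated on a countable union of Beurling-Carleson sets. Then $(0)\Rightarrow(1)\Rightarrow(2)\Rightarrow(3)$.
   Context: $\mathbb{D}$ is the open unit disk, $\partial\mathbb{D}$ the unit circle, $dA$ is area measure, $|J|$ is the length of an arc $J$. For a finite positive singular measure $\mu$ on $\partial\mathbb{D}$, the singular inner function is $$S_\mu(z)=\exp\Bigl(-\int_{\partial\mathbb{D}}\frac{\zeta+z}{\zeta-z}\,d\mu(\zeta)\Bigr),\qquad |z|<1.$$ The Nevanlinna class $\mathcal{N}$ consists of the analytic functions $f$ on $\mathbb{D}$ with $\lim_{r\to1}\int_{|z|=r}\log^+|f(z)|\,|dz|<\infty$. A Beurling-Carleson set is a closed subset $E\subset\partial\mathbb{D}$ of zero length whose complementary arcs $\{J\}$ (the connected components of $\partial\mathbb{D}\setminus E$) satisfy $\sum_J |J|\log\frac{1}{|J|}<\infty$. A measure $\mu$ is supported (or concentrated) on a Borel set $A$ if $\mu(\partial\mathbb{D}\setminus A)=0$. *)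

(* Defs.v *)
From HB Require Import structures.
From mathcomp Require Import all_boot all_order all_algebra.
From mathcomp Require Import all_classical all_reals all_analysis.
From mathcomp Require Import complex.

Set Implicit Arguments.
Unset Strict Implicit.
Unset Printing Implicit Defensive.

Import Order.TTheory GRing.Theory Num.Theory.
Import numFieldTopology.Exports numFieldNormedType.Exports.

Local Open Scope classical_set_scope.
Local Open Scope ring_scope.
Local Open Scope complex_scope.

(* Points of the complex plane occur in two forms. Subsets of the plane and
   Borel measures live on R * R, whose product sigma-algebra is the Borel
   sigma-algebra; analytic functions live on R[i], seen as a normed space over
   itself through R[i]^o so that `derivable` and `derive1` are the complex
   notions. The map toC passes from the first form to the second. *)
Notation plane R := (R * R)%type.

Notation cmod := ComplexField.Normc.normc.
Local Notation Re := complex.Re.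
Local Notation Im := complex.Im.

Section Defs.
Context {R : realType}.

Definition toC (p : plane R) : R[i] := p.1 +i* p.2.

Definition expC (z : R[i]) : R[i] :=
  (expR (Re z) * cos (Im z)) +i* (expR (Re z) * sin (Im z)).

Definition circle : set (plane R) := [set p | cmod (toC p) = 1].

Definition disk : set (plane R) := [set p | cmod (toC p) < 1].

Definition arc_length (A : set (plane R)) : \bar R :=
  lebesgue_measure [set t : R | 0 <= t < 2 * pi /\ A (cos t, sin t)].

(* A measure on the circle is a Borel measure on the plane giving no mass to
   the complement of the circle. *)
Definition on_circle (mu : set (plane R) -> \bar R) : Prop :=
  mu (~` circle) = 0%E.

Definition supported_on (mu : set (plane R) -> \bar R) (A : set (plane R)) :
  Prop := mu (circle `\` A) = 0%E.

Definition singular (mu : set (plane R) -> \bar R) : Prop :=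
  exists N : set (plane R),
    [/\ measurable N, N `<=` circle, arc_length N = 0%E & supported_on mu N].

Definition complementary_arcs (E : set (plane R)) : set (set (plane R)) :=
  [set connected_component (circle `\` E) p | p in circle `\` E].

(* `summable` is absolute summability. At most six arcs are longer than 1, so
   only finitely many terms are negative and this says exactly that the sum of
   |J| log (1 / |J|) is finite. *)
Definition Beurling_Carleson (E : set (plane R)) : Prop :=
  [/\ closed E, E `<=` circle, arc_length E = 0%E &
    summable (complementary_arcs E)
      (fun J => let l := fine (arc_length J) in (l * ln l^-1)%:E)].

Definition singular_inner (mu : {finite_measure set (plane R) -> \bar R}) :
    R[i]^o -> R[i]^o :=
  fun z => let H p := (toC p + z) / (toC p - z) in
    expC (- ((\int[mu]_(p in circle) Re (H p)) +i*
             (\int[mu]_(p in circle) Im (H p)))).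

(* Relies on ln 0 = 0, so that logplus 0 = 0. *)
Definition logplus (x : R) : R := Num.max 0 (ln x).

(* The integral of log^+ |f(z)| |dz| over the circle |z| = r, with z = r e^{it}
   and |dz| = r dt. *)
Definition circle_logplus (f : R[i] -> R[i]) (r : R) : \bar R :=
  (\int[lebesgue_measure]_(t in `[0%R, (2 * pi)%R])
    (logplus (cmod (f ((r * cos t) +i* (r * sin t)))) * r)%:E)%E.

Definition Nevanlinna (f : R[i]^o -> R[i]^o) : Prop :=
  (forall z : R[i], cmod z < 1 -> derivable f z 1) /\
  exists l : R, circle_logplus f r @[r --> 1^'-] --> l%:E.

Definition area_condition (f : R[i] -> R[i]) : Prop :=
  forall c : R, 0 < c < 1 ->
  (\int[(lebesgue_measure \x lebesgue_measure)%E]_(p in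
      disk `&` [set p | (cmod (f (toC p)) < c)%R])
    ((1 - cmod (toC p))^-1)%:E < +oo)%E.

End Defs.

(* Main.v *)
Require Import Defs.
From mathcomp Require Import all_boot all_order all_algebra.
From mathcomp Require Import all_classical all_reals all_analysis.
From mathcomp Require Import measurable_realfun complex zify ring lra.
Set Implicit Arguments.
Unset Strict Implicit.
Unset Printing Implicit Defensive.
Import Order.TTheory GRing.Theory Num.Theory.
Import numFieldTopology.Exports numFieldNormedType.Exports.
Local Open Scope classical_set_scope.
Local Open Scope ring_scope.
Local Open Scope complex_scope.
Local Notation Re := complex.Re.
Local Notation Im := complex.Im.

(** Write p for the Herglotz integral of mu, so that S = exp (- p), and
    x = Re p = (1 - |z|^2) q, where q(z) is the integral of |eta - z|^-2.
    Then |S| = exp (- x), S' = - p' S and |p'| <= 2 q. Two discrete quantities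
    replace the geometric ones. The depth of a point with respect to a closed
    set E counts the dyadic neighbourhoods of E containing the point; it is
    comparable to the logarithm of the inverse distance to E. A closed null set
    is a Beurling-Carleson set exactly when its depth is integrable
    [BC_of_depth, depth_of_BC]. The bad sum of level kappa adds 2^-j over the
    Whitney boxes of size 2^-j at whose centre x >= kappa; by Harnack's
    inequality the area condition says that all bad sums are finite
    [badsum_of_area, area_of_badsum].

    From a Beurling-Carleson support to the Nevanlinna class: when mu lives on
    E, a point of the circle of depth k is at distance about 2^-k from E, so q
    is at most a multiple of 4^k along its radius. Hence log^+ |S'| is at most
    a constant plus twice the depth. This is an integrable bound independent of
    the radius of the circle, and radial limits exist off E, so the
    circular means converge by dominated convergence [nevanlinna_of_BC].

    From the Nevanlinna class to the area condition: the factor S of S' costs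
    only x, whose means are constant, so log^+ |p'| has bounded circular means.
    As log (1 + |p'|^2) is subharmonic, it lies below its Poisson integrals,
    and the weak-type inequality of the maximal function makes p' bounded along
    almost every radius [radial_bounded]. Since mu is singular, x also comes
    close to zero along almost every radius [radial_liminf0]; integrating p'
    inwards from there gives x <= M (1 - r), so q is bounded on the radius.
    For each mass point the kernels of q and of the component of p' along the
    radius nearly agree, with an error that tends to zero when q is bounded.
    Thus q is at most |p'| plus a constant
    far out, and x <= C 2^-j (1 + |p'|) at the scale j, with p' taken at any
    point further out. The number of scales at which x >= kappa is then at most
    a constant plus 2 log^+ |p'|, and Fatou's lemma bounds its integral, which
    dominates the bad sums [scount_integral, badsum_scount].

    From the area condition to a countable union: call a dyadic arc of length
    comparable to 2^-k heavy when its mass is at least 81 2^-k. Heavy arcs give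
    bad boxes. The set E_n of the points lying in the closure of a heavy arc of
    every generation k >= n is closed, and the finite bad sum makes its depth
    integrable; so it is a Beurling-Carleson set. A point outside all E_n lies
    in arbitrarily small light arcs. The carrier of mu is a null set, hence
    contained in open sets U of small length; the maximal light arcs in U are
    disjoint, cover these points and have mass at most a multiple of the length
    of U, so the E_n carry mu [singular_carried]. *)

(** * Complex derivatives and the exponential *)

Section CDer.
Context {R : realType}.
Implicit Types z h d c : R[i].

Lemma normcE_cmod z : `|z| = (cmod z)%:C.
Proof. by []. Qed.

Lemma cmod_ge0 z : 0 <= cmod z.
Proof. by rewrite -lecR -normcE_cmod; exact: normr_ge0. Qed.

Lemma cmod0 : cmod (0 : R[i]) = 0.
Proof. exact: ComplexField.Normc.normc0. Qed.

Lemma cmod1 : cmod (1 : R[i]) = 1.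
Proof. exact: ComplexField.Normc.normc1. Qed.

Lemma cmodM z h : cmod (z * h) = cmod z * cmod h.
Proof. exact: ComplexField.Normc.normcM. Qed.

Lemma cmodV z : cmod z^-1 = (cmod z)^-1.
Proof. exact: ComplexField.Normc.normcV. Qed.

Lemma cmodN z : cmod (- z) = cmod z.
Proof. exact: normcN. Qed.

Lemma cmodD z h : cmod (z + h) <= cmod z + cmod h.
Proof. exact: le_normcD. Qed.

Lemma cmodBC z h : cmod (z - h) = cmod (h - z).
Proof. by rewrite -cmodN opprB. Qed.

Lemma cmod_dist z h : cmod z - cmod h <= cmod (z - h).
Proof. by rewrite lerBlDr -{1}(subrK h z) cmodD. Qed.

Lemma cmod_tri c z h : cmod (z - h) <= cmod (z - c) + cmod (c - h).
Proof. by rewrite -{1}(subrKA c z (- h)) cmodD. Qed.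

Lemma cmodX z n : cmod (z ^+ n) = cmod z ^+ n.
Proof.
by elim: n => [|n IH]; rewrite ?expr0 ?cmod1// !exprS cmodM IH.
Qed.

Lemma cmod_eq0 z : (cmod z == 0) = (z == 0).
Proof.
apply/eqP/eqP => [|->]; last exact: cmod0.
exact: ComplexField.Normc.eq0_normc.
Qed.

Lemma cmod_gt0 z : (0 < cmod z) = (z != 0).
Proof. by rewrite lt_def cmod_eq0 cmod_ge0 andbT. Qed.

Lemma cmodR (x : R) : cmod x%:C = `|x|.
Proof. by rewrite /= expr0n/= addr0 sqrtr_sqr. Qed.

Lemma cmod_sqr z : cmod z ^+ 2 = Re z ^+ 2 + Im z ^+ 2.
Proof. by case: z => a b /=; rewrite sqr_sqrtr// addr_ge0// sqr_ge0. Qed.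

Lemma ler_Re_cmod z : `|Re z| <= cmod z.
Proof.
by rewrite -(ler_pXn2r (n:=2)) ?nnegrE ?cmod_ge0// real_normK ?num_real// cmod_sqr lerDl sqr_ge0.
Qed.

Lemma ler_Im_cmod z : `|Im z| <= cmod z.
Proof.
by rewrite -(ler_pXn2r (n:=2)) ?nnegrE ?cmod_ge0// real_normK ?num_real// cmod_sqr lerDr sqr_ge0.
Qed.

Lemma cmod_le_ReIm z : cmod z <= `|Re z| + `|Im z|.
Proof.
rewrite -(ler_pXn2r (n:=2)) ?nnegrE ?cmod_ge0 ?addr_ge0// cmod_sqr sqrrD.
rewrite !real_normK ?num_real// -addrA lerD2l lerDr.
by rewrite mulrn_wge0// mulr_ge0.
Qed.

(** Differentiability at z along the direction 1 of the field over itself is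
    complex differentiability. *)
Definition cder (f : R[i] -> R[i]) z d :=
  is_derive (z : R[i]^o) (1 : R[i]^o) (f : R[i]^o -> R[i]^o) d.

Lemma nbhs0C (P : R[i] -> Prop) :
  (\forall h \near (0 : R[i]^o)^', P h) <->
  exists2 e : R, 0 < e & forall h, h != 0 -> cmod h < e -> P h.
Proof.
split.
  move=> [e /= e0 H].
  exists (Re e).
    by move: e0; rewrite ltcE/= => /andP[].
  move=> h h0 he; apply: H => //=.
  rewrite sub0r normrN normcE_cmod.
  move: e0; rewrite !ltcE/= => /andP[/eqP -> _]; by rewrite eqxx he.
move=> [e e0 H]; exists e%:C => /=.
  by rewrite ltcR.
move=> h /=; rewrite sub0r normrN normcE_cmod ltcR => he h0; exact: H.
Qed.

(** The first-order expansion with an explicit error term is the form in which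
    the chain rule and the Cauchy kernels are handled. *)
Lemma cderP f z d : cder f z d <->
  (forall e : R, 0 < e -> exists2 k : R, 0 < k & forall h, cmod h < k ->
     cmod (f (z + h) - f z - d * h) <= e * cmod h).
Proof.
have cvgE : ((h^-1 *: ((f : R[i]^o -> R[i]^o) (h *: 1 + z : R[i]^o) - (f z : R[i]^o)) : R[i]^o) @[h --> (0:R[i]^o)^'] --> (d : R[i]^o))
   <-> (forall e : R, 0 < e -> exists2 k : R, 0 < k & forall h, cmod h < k ->
     cmod (f (z + h) - f z - d * h) <= e * cmod h).
  split.
    move=> /cvgrPdist_le H e e0.
    have /H : 0 < e%:C by rewrite ltcR.
    move=> /nbhs0C[k k0 K]; exists k => // h hk.
    have [->|h0] := eqVneq h 0.
      by rewrite addr0 subrr mulr0 subr0 cmod0 mulr0.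
    have := K _ h0 hk.
    rewrite normcE_cmod lecR => le1.
    have -> : f (z + h) - f z - d * h = - (h * (d - h^-1 *: (f (h *: 1 + z : R[i]^o) - f z))).
      rewrite /GRing.scale/= mulr1 (addrC h) mulrBr mulrA mulfV// mul1r; ring.
    rewrite cmodN cmodM mulrC; apply: ler_wpM2r => //; exact: cmod_ge0.
  move=> H; apply/cvgrPdist_le => /= e.
  rewrite ltcE/= => /andP[/eqP ei er].
  have [k k0 K] := H _ er.
  apply/nbhs0C; exists k => // h h0 hk.
  have := K h hk.
  rewrite (_ : _ - _ - _ = - (h * (d - h^-1 *: (f (h *: 1 + z : R[i]^o) - f z)))); last first.
    rewrite /GRing.scale/= mulr1 (addrC h) mulrBr mulrA mulfV// mul1r; ring.
  rewrite cmodN cmodM mulrC ler_pM2r.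
    by rewrite normcE_cmod lecE/= ei eqxx.
  by rewrite lt_neqAle cmod_ge0 andbT eq_sym; rewrite cmod_eq0.
split.
  move=> [df eq]; apply/cvgE.
  by rewrite -eq; exact: df.
move/cvgE => H.
apply: DeriveDef; first by apply/cvg_ex; exists d.
by apply: cvg_lim => //; exact: H.
Qed.

Lemma cder_eq f z d d' : cder f z d -> d = d' -> cder f z d'.
Proof. by move=> + <-. Qed.

Lemma cder_cst c z : cder (fun=> c) z 0.
Proof. exact: is_derive_cst. Qed.

Lemma cder_id z : cder id z 1.
Proof. exact: is_derive_id. Qed.

Lemma cderD f g z d c : cder f z d -> cder g z c ->
  cder (fun x => f x + g x) z (d + c).
Proof. by move=> Df Dg; exact: is_deriveD. Qed.

Lemma cderN f z d : cder f z d -> cder (fun x => - f x) z (- d).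
Proof. by move=> Df; exact: is_deriveN. Qed.

Lemma cderM f g z d c : cder f z d -> cder g z c ->
  cder (fun x => f x * g x) z (d * g z + f z * c).
Proof.
move=> Df Dg.
apply: (@cder_eq _ _ (f z *: (c : R[i]^o) + g z *: (d : R[i]^o))).
  exact: is_deriveM.
by rewrite addrC /GRing.scale/= (mulrC d).
Qed.

Lemma cder_comp f g z d c : cder f (g z) d -> cder g z c ->
  cder (fun x => f (g x)) z (d * c).
Proof.
move=> /cderP Df /cderP Dg; apply/cderP => e e0.
have M0 : 0 < cmod c + 1 by rewrite ltr_wpDl ?cmod_ge0.
have N0 : 0 < cmod d + 1 by rewrite ltr_wpDl ?cmod_ge0.
have e1 : 0 < e / 2 / (cmod c + 1) by rewrite !divr_gt0.
have e2 : 0 < e / 2 / (cmod d + 1) by rewrite !divr_gt0.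
have [k1 k10 H1] := Df _ e1.
have [k2 k20 H2] := Dg _ e2.
have [k3 k30 H3] := Dg _ ltr01.
have kk : 0 < Num.min (Num.min k2 k3) (k1 / (cmod c + 1)).
  by rewrite !lt_min k20 k30/= divr_gt0.
exists (Num.min (Num.min k2 k3) (k1 / (cmod c + 1))) => // h.
rewrite !lt_min => /andP[/andP[h2 h3] h1].
set u := g (z + h) - g z.
have uM : cmod u <= (cmod c + 1) * cmod h.
  rewrite -(subrK (c * h) u) (le_trans (cmodD _ _))// cmodM addrC mulrDl lerD2l.
  exact: H3.
have hg : g (z + h) = g z + u by rewrite /u; ring.
have /H1 : cmod u < k1.
  by apply: le_lt_trans uM _; rewrite mulrC -ltr_pdivlMr.
rewrite -hg => K1.
have -> : f (g (z + h)) - f (g z) - d * c * h =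
   (f (g (z + h)) - f (g z) - d * u) + d * (u - c * h) by ring.
apply: (le_trans (cmodD _ _)).
rewrite (splitr e) mulrDl; apply: lerD.
  apply: (le_trans K1); rewrite -ler_pdivlMl ?divr_gt0// invf_div mulrA.
  rewrite [leRHS](_ : _ = (cmod c + 1) * cmod h) //.
  field; rewrite gt_eqF// gt_eqF//; exact: ltr0Sn.
rewrite cmodM; apply: le_trans (_ : (cmod d + 1) * cmod (u - c * h) <= _).
  by rewrite ler_wpM2r ?cmod_ge0// lerDl.
rewrite -ler_pdivlMl// mulrA (mulrC (cmod d + 1)^-1); exact: H2.
Qed.

Lemma cder_continuous f z d : cder f z d -> forall e : R, 0 < e ->
  exists2 k : R, 0 < k & forall h, cmod h < k -> cmod (f (z + h) - f z) < e.
Proof.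
move=> /cderP Df e e0.
have N0 : 0 < cmod d + 1 by rewrite ltr_wpDl ?cmod_ge0.
have [k k0 H] := Df _ ltr01.
exists (Num.min k (e / (cmod d + 1))).
  by rewrite lt_min k0/= divr_gt0.
move=> h; rewrite lt_min => /andP[hk he].
rewrite -(subrK (d * h) (f (z + h) - f z)).
apply: le_lt_trans (cmodD _ _) _; rewrite cmodM.
apply: le_lt_trans (_ : (cmod d + 1) * cmod h < e); last by rewrite mulrC -ltr_pdivlMr.
by rewrite addrC mulrDl lerD2l H.
Qed.

Lemma cder_near f g z d (r : R) : 0 < r -> (forall h, cmod h < r -> f (z + h) = g (z + h)) ->
  cder f z d -> cder g z d.
Proof.
move=> r0 fg /cderP Df; apply/cderP => e /Df[k k0 H].
exists (Num.min k r); first by rewrite lt_min k0.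
move=> h; rewrite lt_min => /andP[hk hr].
have := fg 0; rewrite cmod0 addr0 => <-//.
rewrite -fg//; exact: H.
Qed.

Lemma cderV f z d : f z != 0 -> cder f z d ->
  cder (fun x => (f x)^-1) z (- d / f z ^+ 2).
Proof.
move=> fz0 Df; apply: (@cder_eq _ _ (- (f z) ^- 2 *: (d : R[i]^o))).
  have [H1 H2] := Df.
  apply: DeriveDef; first exact: derivableV.
  by rewrite deriveV// H2.
by rewrite /GRing.scale/= mulrC mulrN mulNr.
Qed.

Lemma rderP (f : R -> R) (t d : R) : is_derive t 1 f d <->
  (forall e : R, 0 < e -> exists2 k : R, 0 < k & forall h : R, `|h| < k ->
     `|f (t + h) - f t - d * h| <= e * `|h|).
Proof.
have cvgE : h^-1 *: (f (h *: 1 + t) - f t) @[h --> 0^'] --> d <->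
  (forall e : R, 0 < e -> exists2 k : R, 0 < k & forall h : R, `|h| < k ->
     `|f (t + h) - f t - d * h| <= e * `|h|).
  split.
    move=> /cvgrPdist_le H e e0.
    have [k /= k0 K] := H _ e0.
    exists k => // h hk.
    have [->|h0] := eqVneq h 0.
      by rewrite addr0 subrr mulr0 subr0 normr0 mulr0.
    have := K h; rewrite /= sub0r normrN => /(_ hk h0) le1.
    have -> : f (t + h) - f t - d * h = - (h * (d - h^-1 *: (f (h *: 1 + t) - f t))).
      rewrite /GRing.scale/= mulr1 (addrC h) mulrBr mulrA mulfV// mul1r; ring.
    by rewrite normrN normrM mulrC; apply: ler_wpM2r.
  move=> H; apply/cvgrPdist_le => /= e e0.
  have [k k0 K] := H _ e0.
  exists k => // h /=; rewrite sub0r normrN => hk h0.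
  have := K h hk.
  rewrite (_ : _ - _ - _ = - (h * (d - h^-1 *: (f (h *: 1 + t) - f t)))); last first.
    rewrite /GRing.scale/= mulr1 (addrC h) mulrBr mulrA mulfV// mul1r; ring.
  by rewrite normrN normrM mulrC ler_pM2r// normr_gt0.
split.
  move=> [df eq]; apply/cvgE.
  by rewrite -eq; exact: df.
move/cvgE => H.
apply: DeriveDef; first by apply/cvg_ex; exists d.
by apply: cvg_lim => //; exact: H.
Qed.

(** Derivative of a curve in the plane, taken componentwise: the circular means
    need real derivatives of analytic functions along circles and radii. *)
Definition vder (g : R -> R[i]) (t : R) v :=
  is_derive t 1 (fun s => Re (g s)) (Re v) /\ is_derive t 1 (fun s => Im (g s)) (Im v).

Lemma ReB z h : Re (z - h) = Re z - Re h. Proof. by case: z; case: h. Qed.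
Lemma ImB z h : Im (z - h) = Im z - Im h. Proof. by case: z; case: h. Qed.
Lemma ReD z h : Re (z + h) = Re z + Re h. Proof. by case: z; case: h. Qed.
Lemma ImD z h : Im (z + h) = Im z + Im h. Proof. by case: z; case: h. Qed.
Lemma ReM z h : Re (z * h) = Re z * Re h - Im z * Im h. Proof. by case: z; case: h. Qed.
Lemma ImM z h : Im (z * h) = Re z * Im h + Im z * Re h. Proof. by case: z; case: h. Qed.
Lemma ReMr z (x : R) : Re (z * x%:C) = Re z * x. Proof. by case: z => a b /=; rewrite mulr0 subr0. Qed.
Lemma ImMr z (x : R) : Im (z * x%:C) = Im z * x. Proof. by case: z => a b /=; rewrite mulr0 add0r. Qed.

Lemma vderP (g : R -> R[i]) t v : vder g t v <->
  (forall e : R, 0 < e -> exists2 k : R, 0 < k & forall h : R, `|h| < k ->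
     cmod (g (t + h) - g t - v * h%:C) <= e * `|h|).
Proof.
split.
  move=> [/rderP A /rderP B] e e0.
  have e20 : 0 < e / 2 by rewrite divr_gt0.
  have [k1 k10 H1] := A _ e20.
  have [k2 k20 H2] := B _ e20.
  exists (Num.min k1 k2); first by rewrite lt_min k10.
  move=> h; rewrite lt_min => /andP[/H1 {}H1 /H2 {}H2].
  apply: le_trans (cmod_le_ReIm _) _.
  by rewrite !ReB !ImB ReMr ImMr (splitr e) mulrDl lerD.
move=> H; split; apply/rderP => e /H[k k0 K]; exists k => // h /K.
  by apply: le_trans; apply: le_trans (ler_Re_cmod _); rewrite !ReB ReMr.
by apply: le_trans; apply: le_trans (ler_Im_cmod _); rewrite !ImB ImMr.
Qed.

Lemma vder_comp f (g : R -> R[i]) t d v : cder f (g t) d -> vder g t v ->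
  vder (fun s => f (g s)) t (d * v).
Proof.
move=> /cderP Df /vderP Dg; apply/vderP => e e0.
have M0 : 0 < cmod v + 1 by rewrite ltr_wpDl ?cmod_ge0.
have N0 : 0 < cmod d + 1 by rewrite ltr_wpDl ?cmod_ge0.
have e1 : 0 < e / 2 / (cmod v + 1) by rewrite !divr_gt0.
have e2 : 0 < e / 2 / (cmod d + 1) by rewrite !divr_gt0.
have [k1 k10 H1] := Df _ e1.
have [k2 k20 H2] := Dg _ e2.
have [k3 k30 H3] := Dg _ ltr01.
have kk : 0 < Num.min (Num.min k2 k3) (k1 / (cmod v + 1)).
  by rewrite !lt_min k20 k30/= divr_gt0.
exists (Num.min (Num.min k2 k3) (k1 / (cmod v + 1))) => // h.
rewrite !lt_min => /andP[/andP[h2 h3] h1].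
set u := g (t + h) - g t.
have uM : cmod u <= (cmod v + 1) * `|h|.
  rewrite -(subrK (v * h%:C) u) (le_trans (cmodD _ _))// cmodM addrC mulrDl cmodR lerD2l.
  exact: H3.
have hg : g (t + h) = g t + u by rewrite /u; ring.
have /H1 : cmod u < k1.
  by apply: le_lt_trans uM _; rewrite mulrC -ltr_pdivlMr.
rewrite -hg => K1.
have -> : f (g (t + h)) - f (g t) - d * v * h%:C =
   (f (g (t + h)) - f (g t) - d * u) + d * (u - v * h%:C) by ring.
apply: (le_trans (cmodD _ _)).
rewrite (splitr e) mulrDl; apply: lerD.
  apply: (le_trans K1); rewrite -ler_pdivlMl ?divr_gt0// invf_div mulrA.
  rewrite [leRHS](_ : _ = (cmod v + 1) * `|h|) //.
  field; rewrite gt_eqF// gt_eqF//; exact: ltr0Sn.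
rewrite cmodM; apply: le_trans (_ : (cmod d + 1) * cmod (u - v * h%:C) <= _).
  by rewrite ler_wpM2r ?cmod_ge0// lerDl.
rewrite -ler_pdivlMl// mulrA (mulrC (cmod d + 1)^-1); exact: H2.
Qed.


Lemma expCD z h : expC (z + h) = expC z * expC h.
Proof.
case: z => a b; case: h => c d; rewrite /expC/= expRD cosD sinD.
by apply/eqP; rewrite eq_complex/=; apply/andP; split; apply/eqP; ring.
Qed.

Lemma cmod_expC z : cmod (expC z) = expR (Re z).
Proof.
rewrite /expC /=; apply/eqP; rewrite -(eqrXn2 (n:=2)) ?sqrtr_ge0 ?expR_ge0//.
rewrite sqr_sqrtr; last by rewrite addr_ge0 ?sqr_ge0.
by rewrite !exprMn -mulrDr cos2Dsin2 mulr1.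
Qed.

Lemma cder_expC z : cder expC z (expC z).
Proof.
apply/cderP => e e0.
set e' := e / expR (Re z).
have e'0 : 0 < e' by rewrite divr_gt0 ?expR_gt0.
have [k Ek] : exists k : R, k = Num.min 1 (e' / 16) by eexists.
have k0 : 0 < k by rewrite Ek lt_min ltr01/= divr_gt0.
have [k1 k10 H1] := (rderP expR 0 _).1 (is_derive_expR 0) k k0.
have [k2 k20 H2] := (rderP (@cos R) 0 _).1 (is_derive_cos 0) k k0.
have [k3 k30 H3] := (rderP (@sin R) 0 _).1 (is_derive_sin 0) k k0.
exists (Num.min (Num.min k1 k) (Num.min k2 k3)).
  by rewrite !lt_min k10 k20 k30 k0.
move=> [a b]; rewrite !lt_min => /andP[/andP[h1 h4] /andP[h2 h3]].
rewrite expCD (_ : _ - _ = expC z * (expC (a +i* b) - 1 - (a +i* b))); last by ring.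
rewrite cmodM cmod_expC.
have -> : e = expR (Re z) * e' by rewrite /e'; field; rewrite gt_eqF ?expR_gt0.
rewrite -mulrA ler_wpM2l ?expR_ge0//.
have ha : `|a| <= cmod (a +i* b) := ler_Re_cmod (a +i* b).
have hb : `|b| <= cmod (a +i* b) := ler_Im_cmod (a +i* b).
have {}H1 := H1 a (le_lt_trans ha h1).
have {}H2 := H2 b (le_lt_trans hb h2).
have {}H3 := H3 b (le_lt_trans hb h3).
rewrite add0r expR0 mul1r in H1.
rewrite add0r cos0 sin0 oppr0 mul0r subr0 in H2.
rewrite add0r cos0 sin0 mul1r subr0 in H3.
have k1' : k <= 1 by rewrite Ek ge_min lexx.
have k8 : k <= e' / 16 by rewrite Ek ge_min lexx orbT.
move: (cmod (a +i* b)) ha hb h4 => m ha hb h4.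
have m0 : 0 <= m by apply: le_trans ha.
have m1 : m <= 1 by apply/ltW/(lt_le_trans h4).
have E3 : expR a <= 3.
  have : `|expR a - 1 - a| <= 1.
    by apply: le_trans H1 _; rewrite mulr_ile1// ?(ltW k0)//; apply: le_trans ha m1.
  rewrite ler_norml => /andP[_].
  move: ha; rewrite ler_norml => /andP[_]; move: m1; lra.
apply: le_trans (cmod_le_ReIm _) _; rewrite /expC /=.
have -> : expR a * cos b - 1 - a = (expR a - 1 - a) + expR a * (cos b - 1) by ring.
have -> : expR a * sin b - 0 - b = expR a * (sin b - b) + (expR a - 1) * b by ring.
have B1 : `|expR a - 1 - a| <= k * m by apply: le_trans H1 _; rewrite ler_wpM2l// ltW.
have B2 : `|expR a * (cos b - 1)| <= 3 * (k * m).
  rewrite normrM ler_pM// ?(ger0_norm (expR_ge0 a))//.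
  by apply: le_trans H2 _; rewrite ler_wpM2l// ltW.
have B3 : `|expR a * (sin b - b)| <= 3 * (k * m).
  rewrite normrM ler_pM// ?(ger0_norm (expR_ge0 a))//.
  by apply: le_trans H3 _; rewrite ler_wpM2l// ltW.
have B4 : `|(expR a - 1) * b| <= 2 * (k * m).
  rewrite normrM mulrA ler_pM//.
  rewrite (_ : expR a - 1 = (expR a - 1 - a) + a); last by ring.
  apply: le_trans (ler_normD _ _) _.
  apply: le_trans (lerD B1 ha) _.
  have : k * m <= 1 * k by rewrite mulrC ler_wpM2r// ltW.
  move: h4; lra.
apply: le_trans (lerD (ler_normD _ _) (ler_normD _ _)) _.
apply: le_trans (lerD (lerD B1 B2) (lerD B3 B4)) _.
have : k * m <= e' / 16 * m by rewrite ler_wpM2r.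
have : 0 <= e' * m by rewrite mulr_ge0 // ltW.
lra.
Qed.

Definition expi (t : R) : R[i] := cos t +i* sin t.

Lemma expiE t : expi t = expC (0 +i* t).
Proof. by rewrite /expC /= expR0 !mul1r. Qed.

Lemma cmod_expi t : cmod (expi t) = 1.
Proof. by rewrite expiE cmod_expC expR0. Qed.

Lemma expiD (s t : R) : expi (s + t) = expi s * expi t.
Proof. by rewrite !expiE -expCD; congr expC; apply/eqP; rewrite eq_complex/= addr0 !eqxx. Qed.

Lemma expi2pi : expi (2 * pi) = 1.
Proof. by rewrite /expi mulr_natl cos2pi sin2pi. Qed.

Lemma expi_neq0 t : expi t != 0.
Proof. by rewrite -cmod_gt0 cmod_expi ltr01. Qed.

(** Logarithmic polar coordinates. This map is conformal, so that it turns the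
    Laplacian into a positive multiple of the second-order operator
    d^2/ds^2 + d^2/dt^2 with constant coefficients. *)
Definition pol (s t : R) : R[i] := expC (s +i* t).

Lemma polE s t : pol s t = (expR s)%:C * expi t.
Proof. by apply/eqP; rewrite eq_complex /expi /= !mul0r subr0 addr0 !eqxx. Qed.

Lemma cmod_pol s t : cmod (pol s t) = expR s.
Proof. by rewrite cmod_expC. Qed.

Lemma vder_pol1 s t : vder (fun x => pol x t) s (pol s t).
Proof.
rewrite -[X in vder _ _ X]mulr1; apply: (@vder_comp expC (fun x => x +i* t)).
  exact: cder_expC.
by split => /=; [exact: is_derive_id|exact: is_derive_cst].
Qed.

Lemma vder_pol2 s t : vder (fun x => pol s x) t (pol s t * 'i).
Proof.
apply: (@vder_comp expC (fun x => s +i* x)).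
  exact: cder_expC.
by split => /=; [exact: is_derive_cst|exact: is_derive_id].
Qed.

Lemma pol_periodic s t : pol s (t + 2 * pi) = pol s t.
Proof. by rewrite !polE expiD expi2pi mulr1. Qed.

End CDer.

(** * Measurability in the plane *)

Section Measurability.
Context {R : realType}.

Lemma measurable_realV : measurable_fun [set: R] (fun x : R => x^-1).
Proof.
have -> : [set: R] = [set 0] `|` ~` [set 0] by rewrite setUv.
apply/measurable_funU => //.
  exact: measurableC.
split.
  exact: measurable_fun_set1.
apply: open_continuous_measurable_fun.
  by apply: closed_openC; apply: accessible_closed_set1; apply: hausdorff_accessible; exact: Rhausdorff.
move=> x; rewrite inE/= => /eqP x0; exact: inv_continuous.
Qed.

(** The product topology has a countable base of rational boxes, so open sets
    belong to the product sigma-algebra. *)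
Lemma open_plane_measurable (U : set (plane R)) : open U -> measurable U.
Proof.
move=> oU.
pose F (q : (rat * rat) * (rat * rat)) : set (plane R) :=
  let B := `]ratr q.1.1, ratr q.1.2[%classic `*` `]ratr q.2.1, ratr q.2.2[%classic in
  if pselect (B `<=` U) then B else set0.
have -> : U = \bigcup_q F q.
  apply/seteqP; split => [[x y] Uxy|p [q _]]; last first.
    by rewrite /F; case: pselect => //= h Bp; exact: h.
  have := oU; rewrite openE => /(_ _ Uxy) [[A B]/= [Ax By] AB].
  have [e e0 eA] := Ax; have [d d0 dB] := By.
  have rat_btw (u v : R) : u < v -> exists q : rat, u < ratr q < v.
    by move=> uv; have [q] := rat_in_itvoo uv; rewrite in_itv/=; exists q.
  have [a /andP[a1 a2]] : exists q : rat, x - e < ratr q < x.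
    by apply: rat_btw; rewrite ltrBlDr ltrDl.
  have [b /andP[b1 b2]] : exists q : rat, x < ratr q < x + e.
    by apply: rat_btw; rewrite ltrDl.
  have [c /andP[c1 c2]] : exists q : rat, y - d < ratr q < y.
    by apply: rat_btw; rewrite ltrBlDr ltrDl.
  have [f /andP[f1 f2]] : exists q : rat, y < ratr q < y + d.
    by apply: rat_btw; rewrite ltrDl.
  exists ((a, b), (c, f)) => //; rewrite /F /=.
  case: pselect => /= [_|[]].
    by split; rewrite /= in_itv/= ?a2 ?b1 ?c2 ?f1.
  move=> [u v] [/=]; rewrite !in_itv/= => /andP[u1 u2] /andP[v1 v2].
  apply: AB; split => /=.
    apply: eA; rewrite /ball_/= distrC ltr_norml; lra.
  apply: dB; rewrite /ball_/= distrC ltr_norml; lra.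
apply: countable_bigcupT_measurable => // q.
rewrite /F; case: pselect => //= _; exact: measurableX.
Qed.

Lemma closed_plane_measurable (U : set (plane R)) : closed U -> measurable U.
Proof.
move=> cU; rewrite -[U]setCK; apply: measurableC.
by apply: open_plane_measurable; exact: closed_openC.
Qed.

Section CMeas.
Context d (T : measurableType d).
Implicit Types (F G : T -> R[i]).

Definition cmeas F := measurable_fun setT (fun p => Re (F p)) /\
  measurable_fun setT (fun p => Im (F p)).

Lemma cmeas_cst c : cmeas (fun=> c).
Proof. by split; exact: measurable_cst. Qed.

Lemma cmeasD F G : cmeas F -> cmeas G -> cmeas (fun p => F p + G p).
Proof.
move=> [F1 F2] [G1 G2]; split.
  under eq_fun do rewrite ReD; exact: measurable_funD.
under eq_fun do rewrite ImD; exact: measurable_funD.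
Qed.

Lemma cmeasM F G : cmeas F -> cmeas G -> cmeas (fun p => F p * G p).
Proof.
move=> [F1 F2] [G1 G2]; split.
  under eq_fun do rewrite ReM; by apply: measurable_funB; exact: measurable_funM.
under eq_fun do rewrite ImM; by apply: measurable_funD; exact: measurable_funM.
Qed.

Lemma cmeasN F : cmeas F -> cmeas (fun p => - F p).
Proof.
move=> HF; have := cmeasM (cmeas_cst (-1)) HF.
by under eq_fun do rewrite mulN1r.
Qed.

Lemma cmeasB F G : cmeas F -> cmeas G -> cmeas (fun p => F p - G p).
Proof. by move=> HF HG; apply: cmeasD => //; exact: cmeasN. Qed.

Lemma measurable_sqr_norm F : cmeas F ->
  measurable_fun setT (fun p => Re (F p) ^+ 2 + Im (F p) ^+ 2).
Proof. by move=> [F1 F2]; apply: measurable_funD; exact: measurable_funX. Qed.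

Lemma cmeasV F : cmeas F -> cmeas (fun p => (F p)^-1).
Proof.
move=> HF; have HN := measurable_sqr_norm HF.
have HV : measurable_fun setT (fun p => (Re (F p) ^+ 2 + Im (F p) ^+ 2)^-1).
  exact: (measurableT_comp measurable_realV HN).
case: HF => F1 F2; split.
  rewrite (_ : (fun p => _) = (fun p => Re (F p) * (Re (F p) ^+ 2 + Im (F p) ^+ 2)^-1)).
    exact: measurable_funM.
  by apply/funext => p; case: (F p).
rewrite (_ : (fun p => _) = (fun p => - Im (F p) * (Re (F p) ^+ 2 + Im (F p) ^+ 2)^-1)).
  by apply: measurable_funM => //; exact: measurableT_comp.
by apply/funext => p; case: (F p) => a b /=; rewrite mulNr.
Qed.

Lemma cmeasX F n : cmeas F -> cmeas (fun p => F p ^+ n).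
Proof.
move=> HF; elim: n => [|n IH].
  exact: cmeas_cst.
by under eq_fun do rewrite exprS; exact: cmeasM.
Qed.

Lemma measurable_cmod F : cmeas F -> measurable_fun setT (fun p => cmod (F p)).
Proof.
move=> /measurable_sqr_norm H.
rewrite (_ : (fun p => _) = Num.sqrt \o (fun p => Re (F p) ^+ 2 + Im (F p) ^+ 2)).
  apply: measurableT_comp => //.
  by apply: continuous_measurable_fun; exact: sqrt_continuous.
by apply/funext => p /=; case: (F p).
Qed.

End CMeas.

Lemma cmeas_toC : cmeas (@toC R).
Proof. by split => /=; [exact: measurable_fst|exact: measurable_snd]. Qed.

Lemma measurable_circle : measurable (@circle R).
Proof.
have := @measurable_cmod _ _ _ cmeas_toC measurableT [set 1] (measurable_set1 _).
by rewrite setTI.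
Qed.

End Measurability.

(** * Integrals over the circle and their Cauchy kernels *)

Section CircleIntegral.
Context {R : realType} (mu : {finite_measure set (plane R) -> \bar R}).
Implicit Types (F G : plane R -> R[i]) (z h c : R[i]).

Definition bfun F := cmeas F /\ exists M : R, forall p, circle p -> cmod (F p) <= M.

Definition Cint F : R[i] :=
  (\int[mu]_(p in circle) Re (F p)) +i* (\int[mu]_(p in circle) Im (F p)).

Definition mass : R := fine (mu circle).

Lemma mass_ge0 : 0 <= mass.
Proof. by rewrite fine_ge0. Qed.

Lemma mu_circle_fin : (mu circle < +oo)%E.
Proof. by rewrite ltey_eq fin_num_measure//; exact: measurable_circle. Qed.

Lemma bounded_circle_integrable (f : plane R -> R) (M : R) : measurable_fun setT f ->
  (forall p, circle p -> `|f p| <= M) -> mu.-integrable circle (EFin \o f).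
Proof.
move=> mf fM; apply: measurable_bounded_integrable.
- exact: measurable_circle.
- exact: mu_circle_fin.
- exact: measurable_funTS.
- by exists M; split; [exact: num_real|move=> x Mx p Cp; exact: le_trans (fM _ Cp) (ltW Mx)].
Qed.

Lemma bfun_integrable_Re F : bfun F -> mu.-integrable circle (EFin \o (fun p => Re (F p))).
Proof.
move=> [[mF _] [M FM]]; apply: (@bounded_circle_integrable _ M) => // p /FM.
exact: le_trans (ler_Re_cmod _).
Qed.

Lemma bfun_integrable_Im F : bfun F -> mu.-integrable circle (EFin \o (fun p => Im (F p))).
Proof.
move=> [[_ mF] [M FM]]; apply: (@bounded_circle_integrable _ M) => // p /FM.
exact: le_trans (ler_Im_cmod _).
Qed.

Lemma bfun_integrable_cmod F : bfun F -> mu.-integrable circle (EFin \o (fun p => cmod (F p))).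
Proof.
move=> [mF [M FM]]; apply: (@bounded_circle_integrable _ M).
  exact: measurable_cmod.
by move=> p /FM; rewrite ger0_norm ?cmod_ge0.
Qed.

Lemma bfun_cst c : bfun (fun=> c).
Proof. by split; [exact: cmeas_cst|exists (cmod c)]. Qed.

Lemma bfunD F G : bfun F -> bfun G -> bfun (fun p => F p + G p).
Proof.
move=> [mF [M FM]] [mG [N GN]]; split; first exact: cmeasD.
exists (M + N) => p Cp; apply: le_trans (cmodD _ _) _; exact: lerD (FM _ Cp) (GN _ Cp).
Qed.

Lemma bfunM F G : bfun F -> bfun G -> bfun (fun p => F p * G p).
Proof.
move=> [mF [M FM]] [mG [N GN]]; split; first exact: cmeasM.
by exists (M * N) => p Cp; rewrite cmodM ler_pM ?cmod_ge0// ?FM// GN.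
Qed.

Lemma bfunB F G : bfun F -> bfun G -> bfun (fun p => F p - G p).
Proof.
move=> bF bG; have := bfunD bF (bfunM (bfun_cst (-1)) bG).
by under eq_fun do rewrite mulN1r.
Qed.

Lemma CintD F G : bfun F -> bfun G -> Cint (fun p => F p + G p) = Cint F + Cint G.
Proof.
move=> bF bG; rewrite /Cint; apply/eqP; rewrite eq_complex/=; apply/andP; split; apply/eqP.
  under eq_Rintegral do rewrite ReD.
  apply: RintegralD; [exact: measurable_circle|exact: bfun_integrable_Re..].
under eq_Rintegral do rewrite ImD.
apply: RintegralD; [exact: measurable_circle|exact: bfun_integrable_Im..].
Qed.

Lemma CintZ c F : bfun F -> Cint (fun p => c * F p) = c * Cint F.
Proof.
move=> bF; have mC := @measurable_circle R.
have HR := bfun_integrable_Re bF; have HI := bfun_integrable_Im bF.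
have HZ (k : R) (f : plane R -> R) : mu.-integrable circle (EFin \o f) ->
    mu.-integrable circle (EFin \o (fun p => k * f p)).
  by move=> hf; have := integrableZl mC k hf; apply: eq_integrable.
case: c => a b; rewrite /Cint; apply/eqP; rewrite eq_complex/=; apply/andP; split; apply/eqP.
  under eq_Rintegral do rewrite ReM/=.
  rewrite RintegralB//; [|exact: HZ|exact: HZ].
  by rewrite !RintegralZl.
under eq_Rintegral do rewrite ImM/=.
rewrite RintegralD//; [|exact: HZ|exact: HZ].
by rewrite !RintegralZl.
Qed.

Lemma CintB F G : bfun F -> bfun G -> Cint (fun p => F p - G p) = Cint F - Cint G.
Proof.
move=> bF bG; have bN := bfunM (bfun_cst (-1)) bG.
rewrite -mulN1r -CintZ// -CintD//; congr Cint; apply/funext => p; by rewrite mulN1r.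
Qed.

Lemma Cint_cst c : Cint (fun=> c) = c * mass%:C.
Proof.
case: c => a b; rewrite /Cint /= !Rintegral_cst; try exact: measurable_circle.
by apply/eqP; rewrite eq_complex/= /mass !mulr0 subr0 add0r !eqxx.
Qed.

Lemma eq_Cint F G : (forall p, circle p -> F p = G p) -> Cint F = Cint G.
Proof.
by move=> FG; rewrite /Cint; congr (_ +i* _); apply: eq_Rintegral => p; rewrite inE => /FG ->.
Qed.

Lemma cmod_Cint F : bfun F -> cmod (Cint F) <= \int[mu]_(p in circle) cmod (F p).
Proof.
move=> bF; have mC := @measurable_circle R.
have iF := bfun_integrable_cmod bF.
have I0 : 0 <= \int[mu]_(p in circle) cmod (F p).
  by apply: Rintegral_ge0 => p _; exact: cmod_ge0.
have [->|N0] := eqVneq (Cint F) 0; first by rewrite cmod0.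
set u := (Cint F)^-1 * (cmod (Cint F))%:C.
have u1 : cmod u = 1.
  by rewrite cmodM cmodV cmodR ger0_norm ?cmod_ge0// mulVf// cmod_eq0.
have uE : u * Cint F = (cmod (Cint F))%:C.
  by rewrite /u mulrAC mulVf// mul1r.
have bu := bfunM (bfun_cst u) bF.
have := CintZ u bF; rewrite uE => /(congr1 (@Re R)) /= <-.
apply: le_Rintegral => //; first exact: bfun_integrable_Re.
move=> p _; apply: le_trans (ler_norm _) _; apply: le_trans (ler_Re_cmod _) _.
by rewrite cmodM u1 mul1r.
Qed.

Lemma Cint_bound F (M : R) : bfun F -> (forall p, circle p -> cmod (F p) <= M) ->
  cmod (Cint F) <= M * mass.
Proof.
move=> bF FM; apply: le_trans (cmod_Cint bF) _.
have mC := @measurable_circle R.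
rewrite -Rintegral_cst//; apply: le_Rintegral => //.
  exact: bfun_integrable_cmod.
exact: finite_measure_integrable_cst.
Qed.

(** The powers are shifted so that the Herglotz kernel is 2 kern 1 - 1 and the
    derivative in z of kern k is k kern (k + 1). *)
Definition kern (k : nat) z (p : plane R) : R[i] := toC p * (toC p - z)^-1 ^+ k.

Lemma cmod_toC p : circle p -> cmod (@toC R p) = 1.
Proof. by []. Qed.

Lemma dist_circle z p : circle p -> 1 - cmod z <= cmod (toC p - z).
Proof. by move=> Cp; rewrite -(cmod_toC Cp) cmod_dist. Qed.

Lemma inv_dist_le z p (M : R) : 0 < M -> M <= cmod (toC p - z) -> cmod (toC p - z)^-1 <= M^-1.
Proof. by move=> M0 Mp; rewrite cmodV lef_pV2// posrE (lt_le_trans M0). Qed.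

Lemma bfun_kern k z : cmod z < 1 -> bfun (kern k z).
Proof.
move=> z1; split.
  apply: cmeasM; first exact: cmeas_toC.
  by apply: cmeasX; apply: cmeasV; apply: cmeasB; [exact: cmeas_toC|exact: cmeas_cst].
exists ((1 - cmod z)^-1 ^+ k) => p Cp; rewrite cmodM cmod_toC// mul1r cmodX.
rewrite lerXn2r// ?nnegrE ?cmod_ge0 ?invr_ge0 ?subr_ge0 ?(ltW z1)//.
by apply: inv_dist_le; rewrite ?subr_gt0//; exact: dist_circle.
Qed.

Definition K k z := Cint (kern k z).

(** With a and b the inverses of eta - (z + h) and eta - z, the hypothesis
    a - b = h a b is the resolvent identity; the conclusion is the quadratic
    remainder that permits differentiation under the integral. *)
Lemma inv_pow_remainder (a b h : R[i]) (M : R) k : a - b = h * a * b ->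
   cmod a <= M -> cmod b <= M ->
   cmod (a ^+ k - b ^+ k - k%:R * h * b ^+ k.+1) <= (k ^ 2)%:R * cmod h ^+ 2 * M ^+ k.+2.
Proof.
move=> ab aM bM; have M0 : 0 <= M := le_trans (cmod_ge0 _) aM.
elim: k => [|k IH].
  by rewrite !expr0 subrr !mul0r subr0 cmod0.
have -> : a ^+ k.+1 - b ^+ k.+1 - k.+1%:R * h * b ^+ k.+2 =
   a * (a ^+ k - b ^+ k - k%:R * h * b ^+ k.+1) + k.+1%:R * (h ^+ 2 * a * b ^+ k.+2).
  have -> : k.+1%:R * (h ^+ 2 * a * b ^+ k.+2) = k.+1%:R * h * b ^+ k.+1 * (h * a * b).
    rewrite !exprS; ring.
  rewrite -ab !exprS -natr1.
  rewrite [LHS](_ : _ = a * (a ^+ k - b ^+ k - k%:R * h * (b * b ^+ k)) +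
    (k%:R + 1) * h * (b * b ^+ k) * (a - b) + (a - b - h * a * b) * b ^+ k); last by ring.
  by rewrite -ab subrr mul0r addr0.
apply: le_trans (cmodD _ _) _.
rewrite (cmodM a) (cmodM k.+1%:R) (cmodM (h ^+ 2 * a)) (cmodM (h ^+ 2)) (cmodX h) (cmodX b).
have -> : cmod (k.+1%:R : R[i]) = k.+1%:R.
  by rewrite (_ : k.+1%:R = (k.+1%:R : R)%:C) ?cmodR ?ger0_norm// raddfMn/=.
apply: le_trans (_ : M * ((k ^ 2)%:R * cmod h ^+ 2 * M ^+ k.+2) +
   k.+1%:R * (cmod h ^+ 2 * M * M ^+ k.+2) <= _).
  apply: lerD; first by rewrite ler_pM// ?cmod_ge0.
  apply: ler_wpM2l => //; apply: ler_pM.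
  - by rewrite mulr_ge0 ?sqr_ge0 ?cmod_ge0.
  - by rewrite exprn_ge0 ?cmod_ge0.
  - by rewrite ler_wpM2l ?sqr_ge0.
  - by rewrite lerXn2r// nnegrE ?cmod_ge0.
have -> : M * ((k ^ 2)%:R * cmod h ^+ 2 * M ^+ k.+2) + k.+1%:R * (cmod h ^+ 2 * M * M ^+ k.+2)
   = (k ^ 2 + k.+1)%:R * cmod h ^+ 2 * M ^+ k.+3.
  rewrite natrD (exprS M k.+2); ring.
rewrite ler_wpM2r ?exprn_ge0// ler_wpM2r ?sqr_ge0// ler_nat.
by rewrite -!mulnn; lia.
Qed.

Lemma cder_K k z : cmod z < 1 -> cder (K k) z (k%:R * K k.+1 z).
Proof.
move=> z1; apply/cderP => e e0.
set M := 2 / (1 - cmod z).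
have M0 : 0 < M by rewrite divr_gt0// subr_gt0.
set B := (k ^ 2)%:R * M ^+ k.+2 * mass.
have B0 : 0 <= B by rewrite mulr_ge0 ?mass_ge0// mulr_ge0 ?exprn_ge0// ltW.
exists (Num.min ((1 - cmod z) / 2) (e / (B + 1))).
  by rewrite lt_min !divr_gt0 ?subr_gt0// ltr_wpDl.
move=> h; rewrite lt_min => /andP[h1 h2].
have zh1 : cmod (z + h) < 1.
  by apply: le_lt_trans (cmodD _ _) _; move: h1; lra.
have bz := bfun_kern k z1; have bzh := bfun_kern k zh1; have bz1 := bfun_kern k.+1 z1.
rewrite mulrAC -CintZ// -CintB// -CintB//; last 2 first.
- exact: bfunB.
- exact: bfunM (bfun_cst _) bz1.
apply: le_trans (_ : B * cmod h ^+ 2 <= _); last first.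
  rewrite expr2 mulrA ler_wpM2r ?cmod_ge0//.
  move: h2; rewrite ltr_pdivlMr ?ltr_wpDl// mulrDr mulr1 => h2.
  by rewrite mulrC; apply: ltW; apply: le_lt_trans h2; rewrite lerDl cmod_ge0.
have -> : B * cmod h ^+ 2 = ((k ^ 2)%:R * cmod h ^+ 2 * M ^+ k.+2) * mass.
  by rewrite /B; ring.
apply: Cint_bound.
  exact: bfunB (bfunB bzh bz) (bfunM (bfun_cst _) bz1).
move=> p Cp; rewrite /kern.
have zM : cmod (toC p - z)^-1 <= M.
  apply: le_trans (inv_dist_le _ (dist_circle z Cp)) _; first by rewrite subr_gt0.
  by rewrite /M -[leLHS]mul1r ler_wpM2r ?invr_ge0 ?subr_ge0 ?(ltW z1)// ler1n.
have dzh : (1 - cmod z) / 2 <= cmod (toC p - (z + h)).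
  apply: le_trans (dist_circle _ Cp); have := cmodD z h; move: h1; lra.
have zhM : cmod (toC p - (z + h))^-1 <= M.
  rewrite /M -invf_div; apply: inv_dist_le => //.
  by rewrite divr_gt0// subr_gt0.
rewrite (_ : _ - _ - _ = toC p * ((toC p - (z + h))^-1 ^+ k - (toC p - z)^-1 ^+ k
   - k%:R * h * (toC p - z)^-1 ^+ k.+1)); last by ring.
rewrite cmodM cmod_toC// mul1r; apply: inv_pow_remainder => //.
have n1 : toC p - z != 0.
  by rewrite -cmod_gt0 (lt_le_trans _ (dist_circle z Cp))// subr_gt0.
have n2 : toC p - (z + h) != 0.
  by rewrite -cmod_gt0 (lt_le_trans _ dzh)// divr_gt0 ?subr_gt0.
field; by rewrite n1 n2.
Qed.

End CircleIntegral.

(** * The Herglotz integral and the singular inner function *)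

Section Herglotz.
Context {R : realType} (mu : {finite_measure set (plane R) -> \bar R}).
Implicit Types (z h c : R[i]).
Local Notation K := (K mu).
Local Notation mass := (mass mu).
Local Notation Cint := (Cint mu).

(** The Herglotz integral p of mu: (eta + z) / (eta - z) = 2 eta / (eta - z) - 1
    on the circle. *)
Definition herg z : R[i] := 2 * K 1 z - mass%:C.

Lemma herglotz_kernel z p : circle p -> cmod z < 1 ->
  (toC p + z) / (toC p - z) = 2 * kern 1 z p - 1.
Proof.
move=> Cp z1; rewrite /kern expr1.
have n1 : toC p - z != 0.
  by rewrite -cmod_gt0 (lt_le_trans _ (dist_circle z Cp))// subr_gt0.
by field.
Qed.

Lemma Cint_herglotz z : cmod z < 1 -> Cint (fun p => 2 * kern 1 z p - 1) = herg z.
Proof.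
move=> z1; have bk := bfun_kern 1 z1.
by rewrite (CintB _ (bfunM (bfun_cst 2) bk) (bfun_cst 1)) (CintZ _ _ bk) Cint_cst mul1r.
Qed.

Lemma singular_innerE z : cmod z < 1 -> singular_inner mu z = expC (- herg z).
Proof.
move=> z1; rewrite /singular_inner; congr (expC (- _)).
have bk := bfun_kern 1 z1.
transitivity (Cint (fun p => 2 * kern 1 z p - 1)).
  by apply: eq_Cint => p Cp; exact: herglotz_kernel.
exact: Cint_herglotz.
Qed.

Lemma cder_herg z : cmod z < 1 -> cder herg z (2 * K 2 z).
Proof.
move=> z1; have H := cderD (cderM (cder_cst 2 z) (cder_K mu 1 z1)) (cder_cst (- mass%:C) z).
by apply: cder_eq H _; rewrite !mul0r add0r mul1r addr0.
Qed.

Lemma cder_S z : cmod z < 1 ->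
  cder (singular_inner mu) z (- (2 * K 2 z) * singular_inner mu z).
Proof.
move=> z1.
apply: (@cder_near _ (fun z => expC (- herg z)) _ _ _ (1 - cmod z)).
- by rewrite subr_gt0.
- move=> h hz; rewrite singular_innerE//; apply: le_lt_trans (cmodD _ _) _; move: hz; lra.
have H := @cder_comp _ expC (fun z => - herg z) z _ _ (cder_expC (- herg z)) (cderN (cder_herg z1)).
by apply: cder_eq H _; rewrite singular_innerE// mulrC.
Qed.

Lemma derive1_S z : cmod z < 1 ->
  derive1 (singular_inner mu) z = - (2 * K 2 z) * singular_inner mu z.
Proof. by move=> /cder_S[_ <-]; rewrite derive1E. Qed.

Lemma cder_dS z : cmod z < 1 -> exists d, cder (derive1 (singular_inner mu)) z d.
Proof.
move=> z1; eexists.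
apply: (@cder_near _ (fun z => - (2 * K 2 z) * singular_inner mu z) _ _ _ (1 - cmod z)).
- by rewrite subr_gt0.
- move=> h hz; rewrite derive1_S//; apply: le_lt_trans (cmodD _ _) _; move: hz; lra.
exact: cderM (cderN (cderM (cder_cst 2 z) (cder_K mu 2 z1))) (cder_S z1).
Qed.

Lemma derivable_dS z : cmod z < 1 ->
  derivable (derive1 (singular_inner mu) : R[i]^o -> R[i]^o) (z : R[i]^o) (1 : R[i]^o).
Proof. by move=> /cder_dS[d []]. Qed.

(** The Poisson integral without its factor 1 - |z|^2. Twice it dominates |p'|;
    multiplied by that factor, it equals Re p. *)
Definition qd z : R := \int[mu]_(p in circle) (cmod (toC p - z))^-1 ^+ 2.

Lemma measurable_inv_dist z n : measurable_fun setT (fun p : plane R => (cmod (toC p - z))^-1 ^+ n).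
Proof.
apply: measurable_funX; apply: (measurableT_comp measurable_realV).
by apply: measurable_cmod; apply: cmeasB; [exact: cmeas_toC|exact: cmeas_cst].
Qed.

Lemma inv_dist_bound z p n : cmod z < 1 -> circle p ->
  (cmod (toC p - z))^-1 ^+ n <= (1 - cmod z)^-1 ^+ n.
Proof.
move=> z1 Cp; rewrite lerXn2r ?nnegrE ?invr_ge0 ?cmod_ge0 ?subr_ge0 ?(ltW z1)//.
rewrite lef_pV2 ?posrE ?subr_gt0//; first exact: dist_circle.
by rewrite (lt_le_trans _ (dist_circle z Cp))// subr_gt0.
Qed.

Lemma inv_dist_integrable z : cmod z < 1 ->
  mu.-integrable circle (EFin \o (fun p => (cmod (toC p - z))^-1 ^+ 2)).
Proof.
move=> z1; apply: (@bounded_circle_integrable _ _ _ ((1 - cmod z)^-1 ^+ 2)).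
  exact: measurable_inv_dist.
move=> p Cp; rewrite ger0_norm ?sqr_ge0//; exact: inv_dist_bound.
Qed.

Lemma qd_ge0 z : 0 <= qd z.
Proof. by apply: Rintegral_ge0 => p _; rewrite sqr_ge0. Qed.

Lemma Re_herglotz (w z : R[i]) : cmod w = 1 -> w - z != 0 ->
  Re (2 * (w * (w - z)^-1) - 1) = (1 - cmod z ^+ 2) * (cmod (w - z))^-1 ^+ 2.
Proof.
move=> w1 wz.
have -> : 2 * (w * (w - z)^-1) - 1 = (w + z) * (w - z)^-1 by field.
have N0 : Re (w - z) ^+ 2 + Im (w - z) ^+ 2 != 0.
  by rewrite -cmod_sqr expf_neq0// cmod_eq0.
rewrite exprVn !cmod_sqr.
have : Re w ^+ 2 + Im w ^+ 2 = 1 by rewrite -cmod_sqr w1 expr1n.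
move: N0; case: w {w1 wz} => a b; case: z => c d /= N0 H1.
rewrite -H1; field; exact: N0.
Qed.

Lemma Re_herg z : cmod z < 1 -> Re (herg z) = (1 - cmod z ^+ 2) * qd z.
Proof.
move=> z1; have bk := bfun_kern 1 z1.
rewrite -(Cint_herglotz z1).
have mC := @measurable_circle R.
rewrite /= /qd -RintegralZl//; last exact: inv_dist_integrable.
apply: eq_Rintegral => p; rewrite inE => Cp; rewrite /kern expr1 Re_herglotz//.
by rewrite -cmod_gt0 (lt_le_trans _ (dist_circle z Cp))// subr_gt0.
Qed.

Lemma cmod_S z : cmod z < 1 -> cmod (singular_inner mu z) = expR (- Re (herg z)).
Proof. by move=> z1; rewrite singular_innerE// cmod_expC; case: (herg z). Qed.

Lemma Re_herg_ge0 z : cmod z < 1 -> 0 <= Re (herg z).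
Proof.
move=> z1; rewrite Re_herg// mulr_ge0 ?qd_ge0// subr_ge0 expr_le1 ?cmod_ge0//.
exact: ltW.
Qed.

(** On the circle |eta| = 1, so that the kernel of p' has modulus
    |eta - z|^-2, up to the factor 2. *)
Lemma cmod_K2 z : cmod z < 1 -> cmod (K 2 z) <= qd z.
Proof.
move=> z1; apply: le_trans (cmod_Cint _ (bfun_kern 2 z1)) _.
rewrite le_eqVlt; apply/orP; left; apply/eqP.
apply: eq_Rintegral => p; rewrite inE => Cp.
by rewrite /kern cmodM cmodX cmodV (cmod_toC Cp) mul1r.
Qed.

Lemma qd_le z z' (A : R) : cmod z < 1 -> cmod z' < 1 -> 0 <= A ->
  (forall p, circle p -> cmod (toC p - z) <= A * cmod (toC p - z')) ->
  qd z' <= A ^+ 2 * qd z.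
Proof.
move=> z1 z'1 A0 H; have mC := @measurable_circle R.
rewrite /qd -RintegralZl//; last exact: inv_dist_integrable.
have iz := inv_dist_integrable z1; have iz' := inv_dist_integrable z'1.
apply: le_Rintegral => //.
  by have := integrableZl mC (A ^+ 2) iz; apply: eq_integrable.
move=> p Cp; rewrite -exprMn lerXn2r ?nnegrE ?mulr_ge0 ?invr_ge0 ?cmod_ge0//.
have n0 : 0 < cmod (toC p - z) by rewrite (lt_le_trans _ (dist_circle z Cp))// subr_gt0.
have n'0 : 0 < cmod (toC p - z') by rewrite (lt_le_trans _ (dist_circle z' Cp))// subr_gt0.
by rewrite -[leLHS]mul1r ler_pdivrMr// mulrAC ler_pdivlMr// mul1r H.
Qed.

(** Harnack's inequality: moving z by a multiple of its distance to the circle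
    changes every |eta - z| by a bounded factor. *)
Lemma qd_harnack z z' (A : R) : cmod z < 1 -> cmod z' < 1 -> 0 <= A ->
  cmod (z' - z) <= A * (1 - cmod z') -> qd z' <= (1 + A) ^+ 2 * qd z.
Proof.
move=> z1 z'1 A0 H; apply: qd_le => //; first by rewrite addr_ge0.
move=> p Cp; apply: le_trans (cmod_tri z' _ _) _.
rewrite mulrDl mul1r lerD2l; apply: le_trans H _.
by rewrite ler_wpM2l// dist_circle.
Qed.

Lemma qd_upper z : cmod z < 1 -> qd z <= (1 - cmod z)^-1 ^+ 2 * mass.
Proof.
move=> z1; have mC := @measurable_circle R.
rewrite -Rintegral_cst//; apply: le_Rintegral => //.
- exact: inv_dist_integrable.
- exact: finite_measure_integrable_cst.
by move=> p Cp; exact: inv_dist_bound.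
Qed.

End Herglotz.

(** * Chords and angles *)

Section CircleGeometry.
Context {R : realType}.
Implicit Types (s t u : R) (E J : set (plane R)).

Definition pt t : plane R := (cos t, sin t).

Lemma toC_pt t : toC (pt t) = expi t.
Proof. by []. Qed.

Lemma circle_pt t : circle (pt t).
Proof. exact: cmod_expi. Qed.

Lemma pt_periodic t : pt (t + 2 * pi) = pt t.
Proof. by rewrite /pt mulr_natl cosD2pi sinD2pi. Qed.

Lemma pt_periodicz t (k : int) : pt (t + k%:~R * (2 * pi)) = pt t.
Proof.
have nat_case (n : nat) u : pt (u + n%:R * (2 * pi)) = pt u.
  elim: n u => [|n IH] u; first by rewrite mul0r addr0.
  by rewrite -natr1 mulrDl mul1r addrA pt_periodic IH.
case: k => n; first exact: nat_case.
rewrite -[LHS](nat_case n.+1); congr pt.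
by rewrite NegzE mulrNz -pmulrn; ring.
Qed.

Lemma pi_lt4 : pi < 4 :> R.
Proof. have := @pihalf_lt2 R; lra. Qed.

Lemma circle_ptP p : circle p -> exists2 t, 0 <= t < 2 * pi & p = pt t.
Proof.
case: p => x y /(congr1 (fun u => u ^+ 2)); rewrite cmod_sqr/= expr1n => xy1.
have xb : -1 <= x <= 1.
  have : x ^+ 2 <= 1 by rewrite -xy1 lerDl sqr_ge0.
  by move=> x2; rewrite -ler_norml -(ler_pXn2r (n:=2)) ?nnegrE// expr1n real_normK ?num_real.
have y2 : y ^+ 2 = 1 - x ^+ 2 by rewrite -xy1; ring.
have := acos_ge0 xb; have := acos_lepi xb; have := @pi_gt0 R => p0 a2 a1.
have [y0|y0] := leP 0 y.
  exists (acos x); first by rewrite a1/=; lra.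
  by rewrite /pt acosK ?in_itv// sin_acos// -y2 sqrtr_sqr ger0_norm.
have ap : 0 < acos x.
  apply: acos_gt0; case/andP: xb => -> xb/=; rewrite lt_neqAle xb andbT.
  apply/eqP => x1; move: y2; rewrite x1 expr1n subrr => /eqP.
  by rewrite sqrf_eq0 lt_eqF.
exists (2 * pi - acos x); first by apply/andP; split; lra.
have -> : 2 * pi - acos x = (- acos x) + 2 * pi by ring.
rewrite pt_periodic /pt cosN sinN acosK ?in_itv// sin_acos// -y2 sqrtr_sqr ltr0_norm//.
by rewrite opprK.
Qed.

Lemma shift_2pi s t : exists k : int, t - pi <= s + k%:~R * (2 * pi) < t + pi.
Proof.
have p2 : 0 < 2 * pi :> R by rewrite mulr_gt0// pi_gt0.
pose k := Num.floor ((s - (t - pi)) / (2 * pi)).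
exists (- k).
have := floor_itv ((s - (t - pi)) / (2 * pi)); rewrite -/k.
rewrite ler_pdivlMr// ltr_pdivrMr// intrD intrN mulrDl mul1r => /andP[k1 k2].
by apply/andP; split; move: k1 k2; rewrite mulNr; lra.
Qed.

Lemma sin_le_id u : `|sin u| <= `|u|.
Proof.
have pos (v : R) : 0 <= v -> `|sin v| <= v.
  rewrite le_eqVlt => /orP[/eqP <-|v0]; first by rewrite sin0 normr0.
  have [c _] := @MVT R sin cos 0 v v0 (fun x _ => is_derive_sin x)
    (continuous_subspaceT (@continuous_sin R)).
  rewrite sin0 !subr0 => ->; rewrite normrM (gtr0_norm v0) ler_piMl// ?(ltW v0)//.
  exact: cos_max.
have [u0|u0] := leP 0 u; first by rewrite (ger0_norm u0) pos.
by rewrite -normrN -sinN (ltr0_norm u0) pos// oppr_ge0 ltW.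
Qed.

Lemma id_le_sin u : `|u| <= pi / 2 -> `|u| <= 2 * `|sin u|.
Proof.
have pos (v : R) : 0 < v -> v <= pi / 2 -> v <= 2 * sin v.
  move=> v0 vpi; have p0 := @pi_gt0 R.
  have h0 : 0 < v / 2 by rewrite divr_gt0.
  have [c] := @MVT R sin cos 0 (v / 2) h0 (fun x _ => is_derive_sin x)
    (continuous_subspaceT (@continuous_sin R)).
  rewrite in_itv/= => /andP[c0 cv]; rewrite sin0 !subr0 => sE.
  have cc : cos (v / 2) <= cos c.
    by apply/ltW; rewrite ltr_cos// in_itv/=; lra.
  have ch : 0 <= cos (v / 2) by apply: cos_ge0_pihalf; apply/andP; split; lra.
  have cv0 : 0 <= cos v by apply: cos_ge0_pihalf; apply/andP; split; lra.
  have -> : sin v = 2 * (sin (v / 2) * cos (v / 2)).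
    by rewrite {1}(splitr v) sinD; ring.
  have cE : cos v = 2 * cos (v / 2) ^+ 2 - 1.
    by rewrite {1}(splitr v) cosD -!expr2 sin2cos2; ring.
  have c2 : 1 / 2 <= cos (v / 2) ^+ 2 by move: cE cv0; lra.
  have : v / 2 * cos (v / 2) <= sin (v / 2).
    by rewrite sE mulrC ler_wpM2r// ltW.
  move=> /(ler_wpM2r ch) H.
  have : v / 2 * (1 / 2) <= v / 2 * cos (v / 2) ^+ 2 by rewrite ler_wpM2l// ltW.
  move: H; lra.
have [u0|u0|->] := ltgtP u 0.
- rewrite -normrN -(normrN (sin u)) -sinN (ger0_norm (_ : 0 <= - u)); last by lra.
  by move=> uh; apply: le_trans (pos (- u) _ uh) _; [lra|rewrite ler_wpM2l// ler_norm].
- rewrite (gtr0_norm u0) => uh; apply: le_trans (pos _ u0 uh) _.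
  by rewrite ler_wpM2l// ler_norm.
- by rewrite sin0 normr0 mulr0.
Qed.

Lemma cmod_expiB s t : cmod (expi s - expi t) = 2 * `|sin ((s - t) / 2)|.
Proof.
set a := (s - t) / 2.
have -> : expi s = expi ((s + t) / 2) * expi a.
  by rewrite -expiD; congr expi; rewrite /a; field.
have -> : expi t = expi ((s + t) / 2) * expi (- a).
  by rewrite -expiD; congr expi; rewrite /a; field.
rewrite -mulrBr cmodM cmod_expi mul1r.
have -> : expi a - expi (- a) = 0 +i* (2 * sin a).
  by rewrite /expi cosN sinN; apply/eqP; rewrite eq_complex/= subrr eqxx/=; apply/eqP; ring.
by rewrite /= expr0n/= add0r sqrtr_sqr normrM ger0_norm.
Qed.

Lemma cmod_expiB_le s t : cmod (expi s - expi t) <= `|s - t|.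
Proof.
rewrite cmod_expiB; apply: le_trans (_ : 2 * `|(s - t) / 2| <= _).
  by rewrite ler_wpM2l// sin_le_id.
by rewrite normrM (ger0_norm (_ : 0 <= 2^-1))// mulrCA divff// mulr1.
Qed.

Lemma le_cmod_expiB s t : `|s - t| <= pi -> `|s - t| <= 2 * cmod (expi s - expi t).
Proof.
move=> st; rewrite cmod_expiB.
have E : `|(s - t) / 2| = `|s - t| / 2 by rewrite normrM (ger0_norm (_ : 0 <= 2^-1)).
have /id_le_sin : `|(s - t) / 2| <= pi / 2 by rewrite E; lra.
by rewrite E; lra.
Qed.

Lemma continuous_pt : continuous pt.
Proof.
move=> t; have := cvg_pair (@continuous_cos R t) (@continuous_sin R t); exact.
Qed.

(** A point r e^it of the radius is no further from the circle than from
    e^is, hence e^it is within twice that distance. *)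
Lemma dist_expi_rad (r : R) s t : 0 <= r <= 1 ->
  cmod (expi s - expi t) <= 2 * cmod (expi s - r%:C * expi t).
Proof.
move=> /andP[r0 r1]; apply: le_trans (cmod_tri (r%:C * expi t) _ _) _.
have -> : cmod (r%:C * expi t - expi t) = 1 - r.
  rewrite (_ : _ - _ = (r - 1)%:C * expi t); last by rewrite rmorphB/=; ring.
  by rewrite cmodM cmod_expi mulr1 cmodR ler0_norm; lra.
have := cmod_dist (expi s) (r%:C * expi t).
rewrite cmodM cmod_expi cmod_expi mulr1 cmodR ger0_norm//; lra.
Qed.

End CircleGeometry.

(** * Depth and complementary arcs *)

Section Components.
Context {R : realType}.
Implicit Types (s t u : R) (E J : set (plane R)).
Local Notation lam := (@lebesgue_measure R).

Definition turn : set R := `[0, 2 * pi[%classic.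

Lemma two_pi_gt0 : 0 < 2 * pi :> R.
Proof. by rewrite mulr_gt0// pi_gt0. Qed.

Lemma measurable_turn : measurable turn.
Proof. exact: measurable_itv. Qed.

Lemma lam_turn : lam turn = (2 * pi)%:E.
Proof. by rewrite lebesgue_measure_itv/= lte_fin two_pi_gt0 sube0. Qed.

Definition near (E : set (plane R)) (k : nat) : set R :=
  [set t | exists2 p, E p & cmod (expi t - toC p) < 2 ^- k].

Lemma open_near E k : open (near E k).
Proof.
rewrite openE => t [p Ep tp]; exists (2 ^- k - cmod (expi t - toC p)) => /=.
  by rewrite subr_gt0.
move=> s; rewrite /ball_/= ltrBrDr => st; exists p => //.
apply: le_lt_trans (cmod_tri (expi t) _ _) _; apply: le_lt_trans st.
by rewrite lerD2r distrC cmod_expiB_le.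
Qed.

Lemma measurable_near E k : measurable (near E k).
Proof. by apply: open_measurable; exact: open_near. Qed.

(** A substitute for the base-two logarithm of the inverse distance to E that
    is integrated term by term. *)
Definition depth E t : \bar R := (\sum_(0 <= k <oo) (\1_(near E k) t)%:E)%E.

Lemma depth_ge0 E t : (0 <= depth E t)%E.
Proof. by apply: nneseries_ge0 => k _ _; rewrite lee_fin. Qed.

Lemma measurable_depth E D : measurable_fun D (depth E).
Proof.
apply: measurable_funTS; apply: ge0_emeasurable_sum => [k t _ _|k _].
  by rewrite lee_fin.
apply/measurable_EFinP; apply: measurable_indic; exact: measurable_near.
Qed.

Lemma integral_depth E D : measurable D ->
  (\int[lam]_(t in D) depth E t = \sum_(0 <= k <oo) lam (near E k `&` D))%E.
Proof.
move=> mD; rewrite integral_nneseries//.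
- by apply: eq_eseriesr => k _; rewrite integral_indic//; exact: measurable_near.
- by move=> k; apply/measurable_EFinP; apply: measurable_indic; exact: measurable_near.
Qed.

(** An arc that avoids E is connected, hence stays in one component. *)
Lemma arc_in_component E (p : plane R) t a b : a <= t <= b ->
  (forall s, a <= s <= b -> ~ E (pt s)) ->
  connected_component (circle `\` E) p (pt t) ->
  forall s, a <= s <= b -> connected_component (circle `\` E) p (pt s).
Proof.
move=> tab nE pJ s sab.
rewrite (same_connected_component pJ).
pose B : set (plane R) := [set pt u | u in `[a, b]%classic].
have HB : B `<=` connected_component (circle `\` E) (pt t).
  apply: connected_component_max.
  - by exists t => //=; rewrite in_itv.
  - move=> _ [u /= uab <-]; split; first exact: circle_pt.
    by apply: nE; move: uab; rewrite in_itv.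
  - apply: connected_continuous_connected.
      by apply/connected_intervalP; exact: interval_is_interval.
    by apply: continuous_subspaceT; exact: continuous_pt.
by apply: HB; exists s => //=; rewrite in_itv.
Qed.

Lemma free_nbhd E t : closed E -> ~ E (pt t) ->
  exists2 e : R, 0 < e & forall s, `|s - t| <= e -> ~ E (pt s).
Proof.
move=> cE nE; have oE := closed_openC cE.
have := oE; rewrite openE => /(_ (pt t) nE) nb.
have [e /= e0 H] := @continuous_pt R t _ nb.
exists (e / 2); first by rewrite divr_gt0.
move=> s st; apply: H; rewrite /ball_/= distrC (le_lt_trans st)//.
by rewrite ltr_pdivrMr// mulr_natr mulr2n ltrDl.
Qed.

Definition angles (J : set (plane R)) : set R := [set t | 0 <= t < 2 * pi /\ J (pt t)].

Lemma angles_turn J : angles J = turn `&` [set t | J (pt t)].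
Proof. by apply/seteqP; split => t /=; rewrite /turn/= in_itv. Qed.

Lemma component_open E p : closed E ->
  open [set t | connected_component (circle `\` E) p (pt t)].
Proof.
move=> cE; rewrite openE => t /= Jt.
have [_ nE] : (circle `\` E) (pt t) := connected_component_sub Jt.
have [e e0 H] := free_nbhd cE nE.
exists e => //= s; rewrite /ball_/= distrC => st.
apply: (@arc_in_component _ _ t (t - e) (t + e)) => //.
- by apply/andP; split; lra.
- by move=> u uab; apply: H; rewrite ler_distl.
- by rewrite -ler_distl ltW.
Qed.

Lemma measurable_component E p : closed E -> measurable (angles (connected_component (circle `\` E) p)).
Proof.
move=> cE; rewrite angles_turn; apply: measurableI; first exact: measurable_turn.
by apply: open_measurable; exact: component_open.
Qed.

End Components.

(** * Integrable depth gives a Beurling-Carleson set *)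

Section BCofDepth.
Context {R : realType}.
Implicit Types (s t u : R) (E J : set (plane R)).
Local Notation lam := (@lebesgue_measure R).

Lemma arc_length_fin J : measurable (angles J) ->
  lam (angles J) = (fine (arc_length J))%:E /\ fine (arc_length J) <= 2 * pi.
Proof.
move=> mJ; rewrite -[arc_length J]/(lam (angles J)).
have le2 : (lam (angles J) <= (2 * pi)%:E)%E.
  rewrite -lam_turn; apply: le_measure; rewrite ?inE//; first exact: measurable_turn.
  by rewrite angles_turn.
have fJ : lam (angles J) \is a fin_num.
  by rewrite ge0_fin_numE// (le_lt_trans le2)// ltry.
by rewrite fineK//; split => //; rewrite -lee_fin fineK.
Qed.

Lemma arc_length_ge0 J : 0 <= fine (arc_length J).
Proof. by rewrite fine_ge0//; exact: measure_ge0. Qed.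

(** Otherwise an arc around e^it longer than the component avoids E, hence lies
    in the component. *)
Lemma component_near E p t : closed E ->
  let J := connected_component (circle `\` E) p in
  fine (arc_length J) < 1 -> angles J t ->
  exists2 e, E e & cmod (expi t - toC e) <= 2 * fine (arc_length J).
Proof.
move=> cE J; set l := fine _ => l1 [/andP[t0 t2] Jt].
have mJ : measurable (angles J) := measurable_component p cE.
have [lE _] := arc_length_fin mJ.
have l0 : 0 <= l := arc_length_ge0 J.
apply/not_exists2P => H.
have [d [d2 ld free]] : exists d : R, [/\ d <= 2, l < d & forall s, `|s - t| <= d -> ~ E (pt s)].
  have [l00|l00] := eqVneq l 0.
    have [_ nE] : (circle `\` E) (pt t) := connected_component_sub Jt.
    have [e e0 He] := free_nbhd cE nE.
    exists (Num.min e 1); split.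
    - by rewrite ge_min; apply/orP; right; lra.
    - by rewrite l00 lt_min e0 ltr01.
    - by move=> s; rewrite le_min => /andP[/He].
  exists (2 * l); split; [lra| |].
    by move: l00; rewrite neq_lt ltNge l0/=; lra.
  move=> s st Es; have [|] := H (pt s); first by [].
  by rewrite toC_pt; apply; apply: le_trans (cmod_expiB_le _ _) _; rewrite distrC.
have pi2 := @pi_ge2 R.
have d0 : 0 < d by lra.
have JJ s : t - d <= s <= t + d -> J (pt s).
  apply: (@arc_in_component _ _ _ t) => //.
  - by apply/andP; split; lra.
  - by move=> u uab; apply: free; rewrite ler_distl.
suff : (d%:E <= lam (angles J))%E by rewrite lE lee_fin leNgt ld.
have [td|td] := ltP (t + d) (2 * pi).
  have -> : d%:E = lam `[t, (t + d)].
    by rewrite lebesgue_measure_itv/= lte_fin ltrDl d0 -EFinB addrAC subrr add0r.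
  apply: le_measure; rewrite ?inE//= => s /=; rewrite in_itv/= => /andP[s1 s2].
  by split; [lra|apply: JJ; lra].
have -> : d%:E = lam `[(t - d), t].
  by rewrite lebesgue_measure_itv/= lte_fin gtrBl d0 -EFinB opprB addrC subrK.
apply: le_measure; rewrite ?inE//= => s /=; rewrite in_itv/= => /andP[s1 s2].
by split; [lra|apply: JJ; lra].
Qed.

Lemma pow2_below (x : R) : 0 < x -> exists n, 2 ^- n <= x.
Proof.
move=> x0; have [n _ /(_ n (leqnn _))] := near_infty_natSinv_expn_lt (PosNum x0).
by move=> /ltW H; exists n; apply: le_trans H; rewrite div1r.
Qed.

Lemma ln2_le1 : ln 2 <= 1 :> R.
Proof. by have := @le_ln1Dx R 1; rewrite (_ : 1 + 1 = 2)//; apply; lra. Qed.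

Lemma depth_ge E t n : (forall k, (k < n)%N -> near E k t) -> (n%:R%:E <= depth E t)%E.
Proof.
move=> H; rewrite /depth.
apply: le_trans (@nneseries_lim_ge R (fun k => (\1_(near E k) t)%:E) xpredT 0%N n _); last first.
  by move=> k _ _; rewrite lee_fin.
rewrite big_mkord (eq_bigr (fun=> 1%:E)).
  by rewrite sumEFin sumr_const card_ord.
by move=> i _; rewrite indicE mem_set//; exact: H.
Qed.

(** Every point of an arc of length l < 1 is within 2 l of E, so its depth is
    at least log_2 (1 / l) minus a constant. The seven absorbs that constant and
    the arcs of length between 1 and 2 pi < 8, whose logarithm is at most 7. *)
Lemma component_entropy E p J : closed E -> J = connected_component (circle `\` E) p ->
  (`| (fine (arc_length J) * ln (fine (arc_length J))^-1)%:E | <=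
     \int[lam]_(t in angles J) (7%:E + depth E t))%E.
Proof.
move=> cE JE; have mJ : measurable (angles J) by rewrite JE; exact: measurable_component.
have [lE l2] := arc_length_fin mJ; set l := fine (arc_length J) in lE l2 *.
have l0 : 0 <= l := arc_length_ge0 J.
have low (n : nat) : (forall t, angles J t -> (n%:R%:E <= depth E t)%E) ->
   (((7 + n%:R) * l)%:E <= \int[lam]_(t in angles J) (7%:E + depth E t))%E.
  move=> H; rewrite EFinM -lE -integral_cst//; apply: ge0_le_integral => //.
  - by move=> t _; rewrite lee_fin addr_ge0.
  - by apply: emeasurable_funD => //; exact: measurable_depth.
  - by move=> t /H; rewrite EFinD => ?; rewrite leeD2l.
have [l00|l00] := eqVneq l 0.
  rewrite l00 mul0r abse0; apply: integral_ge0 => t _.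
  by rewrite adde_ge0 ?depth_ge0.
have lp : 0 < l by rewrite lt_neqAle eq_sym l00.
have [l1|l1] := leP 1 l.
  apply: le_trans (low 0%N _); last by move=> t _; exact: depth_ge0.
  rewrite abse_EFin lee_fin lnV ?posrE// normrM ger0_norm// normrN ger0_norm ?ln_ge0//.
  rewrite addr0 mulrC ler_wpM2r//.
  have := @le_ln1Dx R (l - 1); rewrite addrCA subrr addr0 => /(_ _) h.
  have := @pi_lt4 R; have := h ltac:(lra); lra.
(* The first n with 2^-n <= 2 l: all points of the arc have depth at least n. *)
have := pow2_below (_ : 0 < 2 * l) => /(_ _) /cid; case; first lra.
move=> n0 Hn0.
have exP : exists n, 2 ^- n <= 2 * l by exists n0.
case: (ex_minnP exP) => n nl nmin.
apply: le_trans (low n _).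
  rewrite abse_EFin lee_fin normrM ger0_norm// ger0_norm; last first.
    by rewrite ln_ge0// invf_ge1// ltW.
  rewrite mulrC ler_wpM2r//.
  apply: le_trans (_ : ln (2 ^+ n.+1) <= _).
    rewrite ler_ln ?posrE ?invr_gt0 ?exprn_gt0//.
    rewrite exprS -[leRHS]invrK lef_pV2 ?posrE ?invr_gt0 ?mulr_gt0 ?exprn_gt0//.
    by rewrite invfM mulrC ler_pdivrMr// mulrC.
  by rewrite lnXn//; apply: le_trans (ler_wMn2r n.+1 ln2_le1) _; rewrite -natr1; lra.
move=> t Jt; apply: depth_ge => k kn.
have [e Ee te] : exists2 e, E e & cmod (expi t - toC e) <= 2 * l.
  by move: l1 Jt; rewrite /l JE; exact: component_near.
exists e => //; apply: le_lt_trans te _; rewrite ltNge; apply/negP => /nmin.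
by rewrite leqNgt kn.
Qed.

(** The complementary arcs are disjoint, so their entropies add up to at most
    the integral of 7 + depth over the circle. *)
Lemma BC_of_depth E : closed E -> E `<=` circle -> arc_length E = 0%E ->
  (\int[lam]_(t in turn) depth E t < +oo)%E -> Beurling_Carleson E.
Proof.
move=> cE Ec E0 fin; split => //.
pose phi t : \bar R := (7%:E + depth E t)%E.
have mphi D : measurable_fun D phi.
  by apply: emeasurable_funD => //; exact: measurable_depth.
have phi0 t : (0 <= phi t)%E by rewrite adde_ge0 ?depth_ge0.
apply: le_lt_trans (_ : (\int[lam]_(t in turn) phi t < +oo)%E); last first.
  rewrite ge0_integralD//; [|exact: measurable_turn|by move=> t _; exact: depth_ge0|exact: measurable_depth].
  rewrite integral_cst; last exact: measurable_turn.
  apply: lte_add_pinfty => //.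
  by rewrite -[ltLHS]/(7%:E * lam turn)%E lam_turn -EFinM ltry.
apply: ge_ereal_sup => _ [F [finF FJ] <-].
pose T (J : set (plane R)) := if J \in F then angles J else set0.
have mT J : measurable (T J).
  rewrite /T; case: ifPn => //; rewrite inE => /FJ [p Cp <-].
  exact: measurable_component.
apply: (@le_trans _ _ (\sum_(J \in F) \int[lam]_(t in T J) phi t)%E).
  apply: lee_fsum => // J FJ'; rewrite /T mem_set//.
  have [p Cp <-] := FJ _ FJ'; exact: component_entropy cE _.
rewrite fsbig_finite//= -ge0_integral_bigsetU//.
- apply: ge0_subset_integral => //.
  + by apply: bigsetU_measurable => J _; exact: mT.
  + exact: measurable_turn.
  + exact: mphi.
  + move=> t; rewrite -bigcup_seq => -[J _].
    by rewrite /T; case: ifPn => // _; rewrite angles_turn => -[].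
- exact: finmap.fset_uniq.
- move=> J1 J2 /= _ _ [t []]; rewrite /T; case: ifPn => //; case: ifPn => //.
  rewrite !inE => /FJ[p2 Cp2 <-] /FJ[p1 Cp1 <-] [_ h1] [_ h2].
  by rewrite (same_connected_component h1) (same_connected_component h2).
- exact: mphi.
Qed.

End BCofDepth.

(** * Beurling-Carleson sets have integrable depth *)

Section DepthOfBC.
Context {R : realType}.
Implicit Types (s t u : R) (E J : set (plane R)).
Local Notation lam := (@lebesgue_measure R).

Lemma lam_balls (cs : seq R) (d : R) (A : set R) : 0 <= d -> measurable A ->
  (forall x, A x -> exists2 c, c \in cs & `|x - c| < d) ->
  (lam A <= ((size cs)%:R * (2 * d))%:E)%E.
Proof.
move=> d0 mA H.
pose U (l : seq R) := \big[setU/set0]_(c <- l) ball c d.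
have mU l : measurable (U l) by apply: bigsetU_measurable => c _; exact: measurable_ball.
apply: (@le_trans _ _ (lam (U cs))).
  apply: le_measure; rewrite ?inE//; first exact: mU.
  move=> x /H[c ccs xc]; rewrite /U -bigcup_seq; exists c => //.
  by rewrite /ball/= distrC.
elim: cs {A mA H} => [|c cs IH].
  by rewrite /U big_nil measure0 mul0r.
rewrite /U big_cons; apply: le_trans (measureU2 _ _ _) _; [exact: measurable_ball|exact: mU|].
rewrite (_ : (size (c :: cs))%:R * (2 * d) = 2 * d + (size cs)%:R * (2 * d)); last first.
  by rewrite /= -natr1; ring.
rewrite EFinD; apply: leeD; last exact: IH.
by rewrite (mulr_natl d 2) -(lebesgue_measure_ball c d0).
Qed.

Lemma closed_pt_preimage E : closed E -> closed [set s | E (pt s)].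
Proof. by move=> cE; apply: closed_comp cE => x _; exact: continuous_pt. Qed.

(** The last point of E before t and the first one after t, which exist because
    E is closed and its preimage under the angle map is periodic. *)
Lemma gap_around E t : closed E -> E `<=` circle -> E !=set0 -> ~ E (pt t) ->
  exists a b, [/\ a < t < b, E (pt a), E (pt b), b - a <= 2 * pi &
    forall s, a < s < b -> ~ E (pt s)].
Proof.
move=> cE Ec [p Ep] nE; have cL := closed_pt_preimage cE.
have p0 := @pi_gt0 R.
have [s0 _ ps0] := circle_ptP (Ec _ Ep).
have tE s : E (pt s) -> s != t by move=> h; apply/eqP => st; apply: nE; rewrite -st.
have [a [aE at_ amax]] : exists a, [/\ E (pt a), t - 2 * pi <= a <= t &
    forall s, E (pt s) -> s <= t -> s <= a].
  have [k /andP[k1 k2]] := shift_2pi s0 (t - pi).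
  have Es : E (pt (s0 + k%:~R * (2 * pi))) by rewrite pt_periodicz -ps0.
  have [||//|a] := @compact_EVT_max R R id (`[t - 2 * pi, t]%classic `&` [set s | E (pt s)]).
  - by exists (s0 + k%:~R * (2 * pi)); split => //=; rewrite in_itv/=; apply/andP; split; lra.
  - by apply: subclosed_compact (@segment_compact _ _ _) _ => //; apply: closedI => //; exact: itv_closed.
  - by apply: continuous_subspaceT => x; exact: cvg_id.
  rewrite inE => -[/=]; rewrite in_itv/= => tab Ea amax; exists a; split => // s Es1 st.
  have [ts|ts] := leP (t - 2 * pi) s.
    by apply: amax; rewrite inE/= in_itv/= ts st.
  by apply: le_trans (ltW ts) _; case/andP: tab.
have [b [bE bt_ bmin]] : exists b, [/\ E (pt b), t <= b <= t + 2 * pi &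
    forall s, E (pt s) -> t <= s -> b <= s].
  have [k /andP[k1 k2]] := shift_2pi s0 (t + pi).
  have Es : E (pt (s0 + k%:~R * (2 * pi))) by rewrite pt_periodicz -ps0.
  have [||//|b] := @compact_EVT_min R R id (`[t, t + 2 * pi]%classic `&` [set s | E (pt s)]).
  - by exists (s0 + k%:~R * (2 * pi)); split => //=; rewrite in_itv/=; apply/andP; split; lra.
  - by apply: subclosed_compact (@segment_compact _ _ _) _ => //; apply: closedI => //; exact: itv_closed.
  - by apply: continuous_subspaceT => x; exact: cvg_id.
  rewrite inE => -[/=]; rewrite in_itv/= => tab Eb bmin; exists b; split => // s Es1 st.
  have [ts|ts] := leP s (t + 2 * pi).
    by apply: bmin; rewrite inE/= in_itv/= ts st.
  by apply: le_trans (ltW ts); case/andP: tab.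
have at1 : a < t by rewrite lt_neqAle tE//=; case/andP: at_.
have bt1 : t < b by rewrite lt_neqAle eq_sym tE//=; case/andP: bt_.
exists a, b; split => //.
- by rewrite at1.
- rewrite lerBlDl; apply: bmin; last by case/andP: at_; lra.
  by rewrite pt_periodic.
- move=> s /andP[as_ sb] Es; have [st|st] := leP s t.
    by have := amax _ Es st; rewrite leNgt as_.
  by have := bmin _ Es (ltW st); rewrite leNgt sb.
Qed.

Lemma toC_inj : injective (@toC R).
Proof. by move=> [a b] [c d] [-> ->]. Qed.

Lemma pt_of_cossin s u m : cos (s - m) = cos u -> sin (s - m) = sin u -> pt s = pt (m + u).
Proof.
move=> h1 h2; apply: toC_inj; rewrite !toC_pt expiD.
rewrite -(subrK m s) addrC expiD; congr (_ * _).
by rewrite /expi h1 h2.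
Qed.

Lemma cos_norm u : cos `|u| = cos u.
Proof. by have [u0|u0] := leP 0 u; [rewrite ger0_norm|rewrite ltr0_norm// cosN]. Qed.

(** A component is the image of one gap between consecutive angles of E: leaving
    the gap means crossing one of its ends. *)
Lemma component_gap E p t0 a b : E `<=` circle ->
  a < t0 < b -> E (pt a) -> E (pt b) -> b - a <= 2 * pi ->
  connected_component (circle `\` E) p (pt t0) ->
  forall t, connected_component (circle `\` E) p (pt t) ->
    exists k : int, a < t + k%:~R * (2 * pi) < b.
Proof.
move=> Ec /andP[at0 t0b] Ea Eb ab2 Jt0 t Jt.
set J := connected_component _ _ in Jt0 Jt.
pose m := (a + b) / 2; pose w := (b - a) / 2.
have bE : b = m + w by rewrite /m /w; field.
have aE : a = m - w by rewrite /m /w; field.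
have w0 : 0 <= w by rewrite /w; lra.
have wpi : w <= pi by rewrite /w; lra.
pose f (q : plane R) := q.1 * cos m + q.2 * sin m - cos w.
have fpt s : f (pt s) = cos (s - m) - cos w by rewrite /f /= cosB.
have cf : continuous f.
  move=> q; apply: cvgB; last exact: cvg_cst.
  apply: cvgD; apply: cvgM; try exact: cvg_cst; [exact: cvg_fst|exact: cvg_snd].
have JC q : J q -> circle q /\ ~ E q by move=> /connected_component_sub [].
have f0 q : J q -> f q != 0.
  move=> /JC[Cq nEq]; have [s _ qs] := circle_ptP Cq.
  apply/eqP; rewrite qs fpt => /eqP; rewrite subr_eq0 => /eqP h; apply: nEq; rewrite qs.
  have : sin (s - m) ^+ 2 = sin w ^+ 2 by rewrite !sin2cos2 h.
  move/eqP; rewrite eqf_sqr => /orP[] /eqP h2.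
    by rewrite (pt_of_cossin h h2) -bE.
  by rewrite (@pt_of_cossin s (- w) m) ?cosN ?sinN// -aE.
have cosw u : `|u| <= pi -> (cos w < cos u) = (`|u| < w).
  by move=> upi; rewrite -(cos_norm u) ltr_cos// in_itv/= ?normr_ge0 ?upi ?w0.
have ft0 : 0 < f (pt t0).
  have h : `|t0 - m| < w by rewrite ltr_norml /m /w; apply/andP; split; lra.
  by rewrite fpt subr_gt0 cosw//; apply: le_trans (ltW h) wpi.
have cfJ : connected (f @` J).
  apply: connected_continuous_connected; first exact: component_connected.
  exact: continuous_subspaceT.
have ft : 0 < f (pt t).
  rewrite lt_neqAle eq_sym f0//= leNgt; apply/negP => ftn.
  have /connected_intervalP iJ := cfJ.
  have := iJ (f (pt t)) (f (pt t0)) _ _ 0; case.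
  - by exists (pt t).
  - by exists (pt t0).
  - by apply/andP; split; exact: ltW.
  - by move=> q Jq fq; have := f0 _ Jq; rewrite fq eqxx.
have [k /andP[k1 k2]] := shift_2pi t m.
exists k; set t' := t + _ in k1 k2 *.
have : 0 < f (pt t') by rewrite /t' pt_periodicz.
rewrite fpt subr_gt0 cosw; last by rewrite ler_norml; apply/andP; split; lra.
by rewrite ltr_norml aE bE => /andP[]; lra.
Qed.

(** A point of the component close to E is close to one of the two end points of
    its gap, so the set is covered by few intervals of length comparable
    to 2^-k. *)
Lemma component_near_measure E p k : closed E -> E `<=` circle -> E !=set0 ->
  (lam (near E k `&` angles (connected_component (circle `\` E) p)) <= (24 * 2 ^- k)%:E)%E.
Proof.
move=> cE Ec E0; set J := connected_component _ _.
have mJ : measurable (near E k `&` angles J).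
  by apply: measurableI; [exact: measurable_near|exact: measurable_component].
have [[t0 [/andP[t00 t02] Jt0]]|] := pselect (angles J !=set0); last first.
  move/set0P/negP; rewrite negbK => /eqP ->.
  by rewrite setI0 measure0 lee_fin mulr_ge0.
have [_ nE] : (circle `\` E) (pt t0) := connected_component_sub Jt0.
have [a [b [ab Ea Eb ab2 gap]]] := gap_around cE Ec E0 nE.
have p0 := @pi_gt0 R.
pose d : R := 2 * 2 ^- k.
pose cs := [:: a; b; a - 2 * pi; b - 2 * pi; a + 2 * pi; b + 2 * pi].
have -> : 24 * 2 ^- k = (size cs)%:R * (2 * d) :> R by rewrite /d /=; ring.
apply: lam_balls => //; first by rewrite mulr_ge0.
move=> t [[e Ee te] [/andP[tl tr] Jt]].
have [j /andP[j1 j2]] := component_gap Ec ab Ea Eb ab2 Jt0 Jt.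
set t' := t + _ in j1 j2.
have [s0 _ es0] := circle_ptP (Ec _ Ee).
have [i /andP[i1 i2]] := shift_2pi s0 t'.
set s := s0 + _ in i1 i2.
have Es : E (pt s) by rewrite pt_periodicz -es0.
have expit : expi t' = expi t by rewrite -!toC_pt pt_periodicz.
have expis : expi s = toC e by rewrite -toC_pt pt_periodicz es0.
have ts : `|t' - s| < d.
  apply: le_lt_trans (le_cmod_expiB _) _.
    by rewrite ler_norml; apply/andP; split; lra.
  by rewrite expit expis /d ltr_pM2l.
have near_ab : `|t' - a| < d \/ `|t' - b| < d.
  have [sa|sa] := leP s a.
    left; rewrite ger0_norm; last by lra.
    by apply: le_lt_trans ts; rewrite ger0_norm; lra.
  have [bs|bs] := leP b s.
    right; rewrite distrC ger0_norm; last by lra.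
    by apply: le_lt_trans ts; rewrite distrC ger0_norm; lra.
  by have := gap s; rewrite sa bs => /(_ isT).
have tE : t' = t + j%:~R * (2 * pi) by [].
have jb : (-1 <= j <= 1)%R.
  have h1 : (- 2 : R) < j%:~R.
    by rewrite -(ltr_pM2r p0); move: tE j1 ab => ->; lra.
  have h2 : j%:~R < 2 :> R.
    by rewrite -(ltr_pM2r p0); move: tE j2 ab => ->; lra.
  have h3 : (-2 < j)%R by rewrite -(ltr_int R).
  have h4 : (j < 2)%R by rewrite -(ltr_int R).
  by move: h3 h4; clear; lia.
have [jE|[jE|jE]] : j = -1 \/ j = 0 \/ j = 1 by move: jb; clear; lia.
- case: near_ab => h; [exists (a + 2 * pi)|exists (b + 2 * pi)]; rewrite ?inE ?eqxx ?orbT//;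
    move: h; rewrite tE jE mulN1r; congr (`|_| < _); ring.
- case: near_ab => h; [exists a|exists b]; rewrite ?inE ?eqxx ?orbT//;
    move: h; rewrite tE jE mul0r addr0//.
- case: near_ab => h; [exists (a - 2 * pi)|exists (b - 2 * pi)]; rewrite ?inE ?eqxx ?orbT//;
    move: h; rewrite tE jE mul1r; congr (`|_| < _); ring.
Qed.

Lemma ln2_ge_half : 1 / 2 <= ln 2 :> R.
Proof.
have := @le_ln1Dx R (- (1 / 2)) ltac:(lra).
rewrite (_ : 1 + - (1 / 2) = 2^-1); last by field.
by rewrite lnV ?posrE//; lra.
Qed.

(** The bound l is used for the first n scales and the geometric one for
    the remaining ones. *)
Lemma dyadic_sum_bound (v : nat -> R) (l : R) n : (forall k, 0 <= v k) ->
  (forall k, v k <= l) -> (forall k, v k <= 24 * 2 ^- k) ->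
  forall N, \sum_(0 <= k < N) v k <= l * n%:R + 48 * 2 ^- n.
Proof.
move=> v0 vl vk.
have l0 : 0 <= l := le_trans (v0 0%N) (vl 0%N).
have H M : \sum_(0 <= k < n + M) v k <= l * n%:R + 48 * (2 ^- n - 2 ^- (n + M)).
  elim: M => [|M IH].
    rewrite addn0 subrr mulr0 addr0 big_mkord.
    apply: le_trans (ler_sum _ (fun (k : 'I_n) _ => vl k)) _.
    by rewrite sumr_const card_ord mulr_natr.
  rewrite addnS big_nat_recr//=; apply: le_trans (lerD IH (vk _)) _.
  rewrite exprS invfM; set x := 2 ^- (n + M).
  by rewrite le_eqVlt; apply/orP; left; apply/eqP; field.
move=> N; apply: le_trans (_ : \sum_(0 <= k < n + N) v k <= _).
  rewrite [leRHS](big_cat_nat (leq0n N) (leq_addl n N))/= lerDl.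
  by apply: sumr_ge0.
apply: le_trans (H N) _; rewrite lerD2l ler_wpM2l// gerBl.
by rewrite invr_ge0 exprn_ge0.
Qed.

(** The neighbourhood of order k meets an arc of length l in a set of measure at
    most min (l, 24 2^-k). Summing over k gives l log (1 / l) plus a multiple
    of l, when the two bounds are exchanged at 2^-k comparable to l. *)
Lemma component_depth E p J : closed E -> E `<=` circle -> E !=set0 ->
  J = connected_component (circle `\` E) p ->
  (\int[lam]_(t in angles J) depth E t <= 49%:E * lam (angles J) +
    (`| (fine (arc_length J) * ln (fine (arc_length J))^-1)%:E | +
     `| (fine (arc_length J) * ln (fine (arc_length J))^-1)%:E |))%E.
Proof.
move=> cE Ec E0 JE; have mJ : measurable (angles J) by rewrite JE; exact: measurable_component.
have [lE l2] := arc_length_fin mJ; set l := fine (arc_length J) in lE l2 *.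
have l0 : 0 <= l := arc_length_ge0 J.
have mN k : measurable (near E k `&` angles J).
  by apply: measurableI => //; exact: measurable_near.
have vl k : (lam (near E k `&` angles J) <= l%:E)%E.
  by rewrite -lE; apply: le_measure; [rewrite inE; exact: mN|rewrite inE; exact: mJ|exact: subIsetr].
pose v k := fine (lam (near E k `&` angles J)).
have vE k : lam (near E k `&` angles J) = (v k)%:E.
  by rewrite fineK// ge0_fin_numE// (le_lt_trans (vl k))// ltry.
rewrite integral_depth// lE.
set B := (X in (_ <= X)%E).
have -> : B = (49 * l + 2 * `|l * ln l^-1|)%:E.
  by rewrite /B !abse_EFin -!EFinM -!EFinD; congr EFin; ring.
have v0 k : 0 <= v k by rewrite fine_ge0.
have {}vl k : v k <= l by rewrite -lee_fin -vE.
have vk k : v k <= 24 * 2 ^- k.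
  by rewrite -lee_fin -vE JE; exact: component_near_measure.
have [n Hn] : exists n : nat, l * n%:R + 48 * 2 ^- n <= 49 * l + 2 * `|l * ln l^-1| \/ l = 0.
  have [l00|l00] := eqVneq l 0; first by exists 0%N; right.
  have lp : 0 < l by rewrite lt_neqAle eq_sym l00.
  have exP := pow2_below lp.
  (* At this n the two bounds for the k-th term are comparable. *)
  case: (ex_minnP exP) => n nl nmin; exists n; left.
  case: n nl nmin => [|n] nl nmin.
    by rewrite expr0 invr1 in nl *; have := normr_ge0 (l * ln l^-1); lra.
  have ln1 : l <= 2 ^- n.
    by rewrite leNgt; apply/negP => /ltW /nmin; rewrite ltnn.
  have l1 : l <= 1 by apply: le_trans ln1 _; rewrite invf_le1 ?exprn_gt0// exprn_ege1// ler1n.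
  have : n%:R * (1 / 2) <= ln l^-1.
    apply: le_trans (_ : ln (2 ^+ n) <= _).
      by rewrite lnXn// -[leRHS]mulr_natl ler_wpM2l// ln2_ge_half.
    by rewrite ler_ln ?posrE ?invr_gt0 ?exprn_gt0// -[leLHS]invrK lef_pV2 ?posrE ?invr_gt0 ?exprn_gt0.
  move=> nl1; rewrite normrM (ger0_norm l0) ger0_norm ?ln_ge0 ?invf_ge1//.
  have : l * (n%:R * (1 / 2)) <= l * ln l^-1 by rewrite ler_wpM2l.
  rewrite -(natr1 n); move: nl; set x := 2 ^- n.+1 => nl H.
  by move: (l * ln l^-1) H => y H; lra.
apply: lime_le; first exact: is_cvg_nneseries.
apply: nearW => N.
rewrite (eq_bigr (fun k => (v k)%:E)); last by move=> k _; rewrite vE.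
rewrite sumEFin lee_fin.
case: Hn => [Hn|l00].
  by apply: le_trans Hn; exact: dyadic_sum_bound.
rewrite big1 ?addr_ge0 ?mulr_ge0// => k _.
by apply/eqP; rewrite eq_le v0 -{1}l00 vl.
Qed.

Lemma integral_arcs_le E (F : set (set (plane R))) : closed E -> E `<=` circle -> E !=set0 ->
  finite_set F -> F `<=` complementary_arcs E ->
  (\int[lam]_(t in \bigcup_(J in F) angles J) depth E t <=
   49%:E * lam turn +
   (\esum_(J in complementary_arcs E) `|(fine (arc_length J) * ln (fine (arc_length J))^-1)%:E| +
    \esum_(J in complementary_arcs E) `|(fine (arc_length J) * ln (fine (arc_length J))^-1)%:E|))%E.
Proof.
move=> cE Ec E0 finF FJ.
pose T (J : set (plane R)) := if J \in F then angles J else set0.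
have mT J : measurable (T J).
  rewrite /T; case: ifPn => //; rewrite inE => /FJ [p Cp <-].
  exact: measurable_component.
have tT : trivIset setT T.
  move=> J1 J2 /= _ _ [t []]; rewrite /T; case: ifPn => //; case: ifPn => //.
  rewrite !inE => /FJ[p2 Cp2 <-] /FJ[p1 Cp1 <-] [_ h1] [_ h2].
  by rewrite (same_connected_component h1) (same_connected_component h2).
have -> : \bigcup_(J in F) angles J = \big[setU/set0]_(J <- finmap.enum_fset (fset_set F)) T J.
  rewrite -bigcup_seq; apply/seteqP; split => t [J JF Jt]; exists J => //.
  - by rewrite /= in_fset_set// inE.
  - by rewrite /T mem_set.
  - by move: JF; rewrite /= in_fset_set// inE.
  - by move: JF Jt; rewrite /= in_fset_set// /T => ->.
have tF : trivIset [set` finmap.enum_fset (fset_set F)] T by apply: sub_trivIset tT.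
rewrite ge0_integral_bigsetU//; last 2 first.
- exact: measurable_depth.
- by move=> t _; exact: depth_ge0.
rewrite -fsbig_finite//=.
pose a J := `|(fine (arc_length J) * ln (fine (arc_length J))^-1)%:E|%E : \bar R.
apply: (@le_trans _ _ (\sum_(J \in F) (49%:E * lam (T J) + (a J + a J)))%E).
  apply: lee_fsum => // J FJ'; rewrite /T mem_set//.
  have [p Cp pJ] := FJ _ FJ'; exact: component_depth cE Ec E0 (esym pJ).
rewrite fsbig_finite//= !big_split/=.
have suma : (\sum_(J <- finmap.enum_fset (fset_set F)) a J <= \esum_(J in complementary_arcs E) a J)%E.
  rewrite -fsbig_finite//; apply: ereal_sup_ubound; by exists F.
apply: leeD; last by apply: leeD.
rewrite -ge0_sume_distrr//; apply: lee_wpmul2l => //.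
have mB : measurable (\big[setU/set0]_(J <- finmap.enum_fset (fset_set F)) T J).
  by apply: bigsetU_measurable => J _; exact: mT.
rewrite (eq_bigr (fun J => \int[lam]_(t in T J) cst (1 : R)%:E t)%E); last first.
  by move=> J _; rewrite integral_cst ?mul1e//; exact: mT.
rewrite -ge0_integral_bigsetU//; last exact: finmap.fset_uniq.
rewrite integral_cst ?mul1e//.
apply: le_measure; rewrite ?inE//.
- exact: measurable_turn.
- move=> t; rewrite -bigcup_seq => -[J _].
  by rewrite /T; case: ifPn => // _; rewrite angles_turn => -[].
Qed.

(** The arcs through the rational angles exhaust the complement, so finitely
    many arcs at a time suffice, with a bound that does not depend on their
    number. *)
Lemma depth_of_BC E : Beurling_Carleson E -> E !=set0 ->
  (\int[lam]_(t in turn) depth E t < +oo)%E.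
Proof.
move=> [cE Ec lE sE] E0.
have mE : measurable (angles E).
  rewrite angles_turn; apply: measurableI; first exact: measurable_turn.
  by apply: closed_measurable; exact: closed_pt_preimage.
rewrite (@ge0_negligible_integral _ _ _ lam turn (angles E))//; last 3 first.
- exact: measurable_turn.
- exact: measurable_depth.
- by move=> t _; exact: depth_ge0.
(* An enumeration of the rational numbers. *)
pose q (n : nat) : R := if (unpickle n : option rat) is Some r then ratr r else 0.
pose J n := connected_component (circle `\` E) (pt (q n)).
pose I n := [set m | (m < n)%N /\ (circle `\` E) (pt (q m))].
pose F n := [set J m | m in I n].
pose U n := \bigcup_(K in F n) angles K.
have FJ n : F n `<=` complementary_arcs E.
  by move=> _ [m [_ Cm] <-]; exists (pt (q m)).
have finF n : finite_set (F n).
  apply: finite_image; apply: (@sub_finite_set _ _ `I_n); last exact: finite_II.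
  by move=> m [].
have UB n := integral_arcs_le cE Ec E0 (finF n) (FJ n).
have mU n : measurable (U n).
  apply: fin_bigcup_measurable => // K /FJ [p Cp <-]; exact: measurable_component.
have U_turn : turn `\` angles E = \bigcup_n U n.
  apply/seteqP; split => [t [tt nEt]|t [n _ [K [m [mn Cm] <-] Kt]]]; last first.
    move: Kt => [t02 /connected_component_sub[_ nE]]; split.
      by rewrite /turn/= in_itv.
    by move=> [].
  have t02 : 0 <= t < 2 * pi by move: tt; rewrite /turn/= in_itv.
  have nE : ~ E (pt t) by move=> Et; apply: nEt.
  have Ct : (circle `\` E) (pt t) by split => //; exact: circle_pt.
  have := component_open (p := pt t) cE; set W := [set _ | _] => oW.
  have Wt : W t by exact: connected_component_refl.
  have [r [Wr [r' _ rr]]] := @dense_rat R W (ex_intro _ _ Wt) oW.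
  have qr : q (pickle r') = r by rewrite /q pickleK.
  have Cr : (circle `\` E) (pt r) := connected_component_sub Wr.
  exists (pickle r').+1 => //; exists (J (pickle r')).
    by exists (pickle r') => //; split => //; rewrite qr.
  split => //; rewrite /J qr; exact: connected_component_sym.
rewrite U_turn.
have H : (\int[lam]_(x in U i) depth E x)%E @[i --> \oo] --> (\int[lam]_(x in \bigcup_i U i) depth E x)%E.
  apply: ge0_nondecreasing_set_cvg_integral => //.
  - move=> n m nm; rewrite subsetEset => t [K [i [i1 i2] iK] Kt]; exists K => //.
    by exists i => //; split => //; exact: leq_trans nm.
  - by move=> i; exact: measurable_depth.
  - by move=> i t _; exact: depth_ge0.
rewrite -(cvg_lim _ H)//.
apply: le_lt_trans (lime_le _ (nearW _ UB)) _.
  by apply/cvg_ex; eexists; exact: H.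
apply: lte_add_pinfty; last exact: lte_add_pinfty.
by rewrite -[ltLHS]/(49%:E * lam turn)%E lam_turn -EFinM ltry.
Qed.

End DepthOfBC.

(** * The positive part of the logarithm *)

Section LogPlus.
Context {R : realType}.
Implicit Types x y : R.

Lemma logplus_ge0 x : 0 <= logplus x.
Proof. by rewrite /logplus le_max lexx. Qed.

Lemma logplusE x : 0 <= x -> logplus x = ln (Num.max 1 x).
Proof.
move=> x0; rewrite /logplus; have [x1|x1] := leP x 1.
  rewrite ln1; have [->|xn0] := eqVneq x 0; first by rewrite ln0// maxxx.
  by apply/max_idPl; rewrite ln_le0.
by apply/max_idPr; rewrite ln_ge0// ltW.
Qed.

Lemma max1_gt0 x : 0 < Num.max 1 x.
Proof. by rewrite lt_max ltr01. Qed.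

Lemma ler_logplus x y : 0 <= x -> x <= y -> logplus x <= logplus y.
Proof.
move=> x0 xy; have y0 := le_trans x0 xy; rewrite !logplusE// ler_ln ?posrE ?max1_gt0//.
by rewrite ge_max le_max lexx/= le_max xy orbT.
Qed.

Lemma ln_lipschitz x y : 1 <= x -> x <= y -> ln y - ln x <= y - x.
Proof.
move=> x1 xy; have x0 : 0 < x by lra.
have y0 : 0 < y by lra.
rewrite -ln_div ?posrE//.
have := @le_ln1Dx R (y / x - 1); rewrite addrCA subrr addr0 => h.
apply: le_trans (h _) _; first by have := divr_gt0 y0 x0; lra.
rewrite lerBlDr ler_pdivrMr//; nra.
Qed.

Lemma logplus_lipschitz x y : 0 <= x -> 0 <= y -> `|logplus x - logplus y| <= `|x - y|.
Proof.
wlog xy : x y / x <= y => [H|] x0 y0.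
  have [xy|yx] := leP x y; first exact: H.
  by rewrite distrC (distrC x); apply: H => //; exact: ltW.
rewrite distrC (distrC x) ger0_norm ?subr_ge0 ?ler_logplus//.
rewrite ger0_norm ?subr_ge0// !logplusE//.
apply: le_trans (ln_lipschitz _ _) _.
- by rewrite le_max lexx.
- by rewrite ge_max le_max lexx/= le_max xy orbT.
have [x1|x1] := leP x 1; have [y1|y1] := leP y 1; lra.
Qed.

Lemma logplusM x y : 0 <= x -> 0 <= y -> logplus (x * y) <= logplus x + logplus y.
Proof.
move=> x0 y0; rewrite !logplusE ?mulr_ge0// -lnM ?posrE ?max1_gt0//.
rewrite ler_ln ?posrE ?mulr_gt0 ?max1_gt0// ge_max.
apply/andP; split.
  by rewrite -[leLHS]mulr1 ler_pM// le_max lexx.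
by rewrite ler_pM// le_max lexx orbT.
Qed.

Lemma logplus_ge1 x : 1 <= x -> logplus x = ln x.
Proof. by move=> x1; rewrite logplusE ?max_r//; lra. Qed.

Lemma measurable_logplus : measurable_fun setT (@logplus R).
Proof. by apply: measurable_maxr => //; exact: measurable_ln. Qed.

Lemma rpolE (r t : R) : (r * cos t) +i* (r * sin t) = r%:C * expi t.
Proof. by apply/eqP; rewrite eq_complex/= !mul0r subr0 addr0 !eqxx. Qed.

Lemma cmod_rpol (r t : R) : 0 <= r -> cmod (r%:C * expi t) = r.
Proof. by move=> r0; rewrite cmodM cmod_expi mulr1 cmodR ger0_norm. Qed.

Lemma vder_rpol (r t : R) : vder (fun s => r%:C * expi s) t (r%:C * expi t * 'i).
Proof.
split; rewrite /expi /=.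
  under eq_fun do rewrite mul0r subr0.
  have := @is_deriveZ _ _ _ (@cos R) r t 1 _ (is_derive_cos t).
  by move=> H; apply: is_derive_eq H _; rewrite /GRing.scale/=; ring.
under eq_fun do rewrite mul0r addr0.
have := @is_deriveZ _ _ _ (@sin R) r t 1 _ (is_derive_sin t).
by move=> H; apply: is_derive_eq H _; rewrite /GRing.scale/=; ring.
Qed.

Lemma vder_rpol1 (r t : R) : vder (fun s => s%:C * expi t) r (expi t).
Proof.
split; rewrite /expi /=.
  under eq_fun do rewrite mul0r subr0.
  have H : is_derive r 1 (fun s : R => s * cos t) (r *: 0 + cos t *: 1).
    by apply: is_deriveM.
  by apply: is_derive_eq H _; rewrite /GRing.scale/=; ring.
under eq_fun do rewrite mul0r addr0.
have H : is_derive r 1 (fun s : R => s * sin t) (r *: 0 + sin t *: 1).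
  by apply: is_deriveM.
by apply: is_derive_eq H _; rewrite /GRing.scale/=; ring.
Qed.

Lemma is_derive_continuous (f : R -> R) (t d : R) : is_derive t 1 f d -> {for t, continuous f}.
Proof.
by move=> [df _]; apply: differentiable_continuous; exact/derivable1_diffP.
Qed.

Lemma cmeas_rpol (f : R[i] -> R[i]) (r : R) : 0 <= r < 1 ->
  (forall z, cmod z < 1 -> exists d, cder f z d) -> cmeas (fun t => f (r%:C * expi t)).
Proof.
move=> /andP[r0 r1] Hf.
have cm t : cmod (r%:C * expi t) < 1 by rewrite cmod_rpol.
have H t : exists v, vder (fun s => f (r%:C * expi s)) t v.
  have [d fd] := Hf _ (cm t); eexists.
  exact: (@vder_comp _ f (fun s => r%:C * expi s) t _ _ fd (vder_rpol r t)).
split; apply: continuous_measurable_fun => t; have [v [v1 v2]] := H t.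
  exact: is_derive_continuous v1.
exact: is_derive_continuous v2.
Qed.

(** Such a function is Cauchy at 1. *)
Lemma lipschitz_cvg_left1 (f : R -> R) (C : R) :
  (forall r s, 0 <= r < 1 -> 0 <= s < 1 -> `|f r - f s| <= C * `|r - s|) ->
  cvg (f r @[r --> (1:R)^'-]).
Proof.
move=> Hf; apply/cauchy_cvgP; apply: cauchy_exP => e e0.
pose D := `|C| + 1; have D0 : 0 < D by rewrite ltr_wpDl.
pose r0 := Num.max 0 (1 - e / D / 2).
have eD : 0 < e / D by rewrite divr_gt0.
have r01 : 0 <= r0 < 1 by rewrite le_max lexx/= gt_max ltr01/=; lra.
exists (f r0).
suff : \forall r \near (1:R)^'-, `|f r0 - f r| < e by [].
have /andP[r00 r0lt] := r01.
near=> r.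
have rr0 : r0 <= r by near: r; exact: nbhs_left_ge.
have r1 : r < 1 by near: r; exact: nbhs_left_lt.
have rr : 0 <= r < 1 by rewrite r1 andbT; exact: le_trans rr0.
apply: le_lt_trans (Hf _ _ r01 rr) _.
have h1 : `|r0 - r| <= e / D / 2.
  rewrite ler0_norm ?subr_le0// opprB; have : 1 - e / D / 2 <= r0 by rewrite le_max lexx orbT.
  lra.
apply: le_lt_trans (_ : D * (e / D / 2) < e).
  apply: le_trans (_ : D * `|r0 - r| <= _); last by rewrite ler_wpM2l// ltW.
  by rewrite ler_wpM2r// (le_trans (ler_norm _))// lerDl.
by rewrite mulrA mulrCA divff ?gt_eqF// mulr1; lra.
Unshelve. all: end_near. Qed.

End LogPlus.

(** * Measures on a Beurling-Carleson set *)

Section ZeroToOne.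
Context {R : realType} (mu : {finite_measure set (plane R) -> \bar R}).
Variable E : set (plane R).
Hypotheses (cE : closed E) (Ec : E `<=` circle) (sE : supported_on mu E).
Local Notation K := (K mu).
Local Notation mass := (mass mu).
Local Notation qd := (qd mu).
Local Notation lam := (@lebesgue_measure R).
Local Notation S := (singular_inner mu).

Lemma Rint_supported_bound (f : plane R -> R) (M : R) : 0 <= M ->
  mu.-integrable circle (EFin \o f) ->
  (forall p, E p -> f p <= M) -> \int[mu]_(p in circle) f p <= M * mass.
Proof.
move=> M0 iF fM; have mC := @measurable_circle R.
have mE := closed_plane_measurable cE.
have mN : measurable (circle `\` E) by exact: measurableD.
have mD : measurable (circle `\` (circle `\` E)) by exact: measurableD.
have -> : \int[mu]_(p in circle) f p = \int[mu]_(p in circle `\` (circle `\` E)) f p.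
  by rewrite /Rintegral (negligible_integral mN mC iF sE).
apply: le_trans (_ : \int[mu]_(p in circle `\` (circle `\` E)) M <= _).
  apply: le_Rintegral => //.
  - by apply: integrableS iF => //; exact: subDsetl.
  - exact: finite_measure_integrable_cst.
  - by move=> p [Cp nN]; apply: fM; apply: contrapT => nE; exact: nN.
rewrite Rintegral_cst// ler_wpM2l// fine_le// ?fin_num_measure//.
by apply: le_measure; rewrite ?inE//; exact: subDsetl.
Qed.

Lemma Cint_supported_bound F (M : R) : 0 <= M -> bfun F ->
  (forall p, E p -> cmod (F p) <= M) -> cmod (Cint mu F) <= M * mass.
Proof.
move=> M0 bF FM; apply: le_trans (cmod_Cint _ bF) _.
by apply: Rint_supported_bound => //; exact: bfun_integrable_cmod.
Qed.

(** Passing from the boundary point to its radius loses only a factor 2. *)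
Lemma far_inv_dist k t (r : R) p : ~ near E k t -> 0 <= r < 1 -> E p ->
  cmod (toC p - r%:C * expi t)^-1 <= 2 ^+ k.+1.
Proof.
move=> nt /andP[r0 r1] Ep.
have [s _ ps] := circle_ptP (Ec Ep).
have h : 2 ^- k.+1 <= cmod (toC p - r%:C * expi t).
  have := @dist_expi_rad R r s t ltac:(by rewrite r0 ltW).
  have : 2 ^- k <= cmod (expi s - expi t).
    rewrite leNgt; apply/negP => H; apply: nt; exists p => //.
    by rewrite ps toC_pt cmodBC.
  rewrite ps toC_pt exprS invfM; move=> H1 H2.
  by rewrite mulrC ler_pdivrMr// mulrC; apply: le_trans H1 H2.
by apply: le_trans (inv_dist_le _ h) _; rewrite ?invrK// invr_gt0 exprn_gt0.
Qed.

Lemma qd_far k t (r : R) : ~ near E k t -> 0 <= r < 1 ->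
  qd (r%:C * expi t) <= (2 ^+ k.+1) ^+ 2 * mass.
Proof.
move=> nt r01; have /andP[r0 r1] := r01.
apply: Rint_supported_bound.
- by rewrite !exprn_ge0.
- by apply: inv_dist_integrable; rewrite cmod_rpol.
- move=> p Ep; rewrite lerXn2r ?nnegrE ?invr_ge0 ?cmod_ge0 ?exprn_ge0//.
  by rewrite -cmodV; exact: far_inv_dist.
Qed.

Lemma K2_lipschitz k t (r s : R) : ~ near E k t -> 0 <= r < 1 -> 0 <= s < 1 ->
  cmod (K 2 (r%:C * expi t) - K 2 (s%:C * expi t)) <= 2 * (2 ^+ k.+1) ^+ 3 * mass * `|r - s|.
Proof.
move=> nt r01 s01; have /andP[r0 r1] := r01; have /andP[s0 s1] := s01.
have cr : cmod (r%:C * expi t) < 1 by rewrite cmod_rpol.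
have cs : cmod (s%:C * expi t) < 1 by rewrite cmod_rpol.
rewrite -(CintB _ (bfun_kern 2 cr) (bfun_kern 2 cs)).
have M0 : 0 <= 2 ^+ k.+1 :> R by rewrite exprn_ge0.
rewrite mulrAC; apply: Cint_supported_bound.
- by rewrite mulr_ge0// mulr_ge0// exprn_ge0.
- exact: bfunB (bfun_kern 2 cr) (bfun_kern 2 cs).
move=> p Ep; have Cp := Ec Ep.
have ha := far_inv_dist nt r01 Ep; have hb := far_inv_dist nt s01 Ep.
rewrite /kern -mulrBr cmodM (cmod_toC Cp) mul1r.
set a := (toC p - r%:C * expi t)^-1 in ha *; set b := (toC p - s%:C * expi t)^-1 in hb *.
have n1 : toC p - r%:C * expi t != 0.
  by rewrite -cmod_gt0 (lt_le_trans _ (dist_circle _ Cp))// subr_gt0.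
have n2 : toC p - s%:C * expi t != 0.
  by rewrite -cmod_gt0 (lt_le_trans _ (dist_circle _ Cp))// subr_gt0.
have -> : a ^+ 2 - b ^+ 2 = ((r - s)%:C * expi t) * (a * b * (a + b)).
  rewrite /a /b rmorphB/=; field; by rewrite n1 n2.
rewrite cmodM cmodM cmod_expi mulr1 cmodR mulrC ler_wpM2r// !cmodM.
have hab : cmod (a + b) <= 2 ^+ k.+1 + 2 ^+ k.+1 by apply: le_trans (cmodD _ _) _; exact: lerD.
have -> : 2 * (2 ^+ k.+1) ^+ 3 = (2 ^+ k.+1 * 2 ^+ k.+1) * (2 ^+ k.+1 + 2 ^+ k.+1) :> R by ring.
by rewrite ler_pM ?mulr_ge0 ?cmod_ge0// ler_pM ?cmod_ge0.
Qed.

Lemma free_far t : ~ E (pt t) -> exists k, ~ near E k t.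
Proof.
move=> nE; have oE := closed_openC cE.
have [e e0 He] := free_nbhd cE nE.
have [k Hk] := @pow2_below R (Num.min e 1 / 2) ltac:(by rewrite divr_gt0// lt_min e0 ltr01).
exists k => -[p Ep] tp; have [s _ ps] := circle_ptP (Ec Ep).
have [j /andP[j1 j2]] := shift_2pi s t.
have Es : E (pt (s + j%:~R * (2 * pi))) by rewrite pt_periodicz -ps.
apply: (He (s + j%:~R * (2 * pi))) => //; rewrite distrC.
apply: le_trans (le_cmod_expiB _) _.
  by rewrite ler_norml; apply/andP; split; lra.
rewrite -!toC_pt pt_periodicz -ps toC_pt.
apply: le_trans (_ : 2 * (Num.min e 1 / 2) <= _).
  by rewrite ler_wpM2l// ltW// (lt_le_trans tp).
by rewrite mulrCA divff// mulr1 ge_min lexx.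
Qed.

Lemma dS_cmod z : cmod z < 1 ->
  cmod (derive1 S z) = 2 * cmod (K 2 z) * expR (- ((1 - cmod z ^+ 2) * qd z)).
Proof.
move=> z1; rewrite derive1_S// cmodM cmodN cmodM cmod_S// Re_herg//.
by rewrite (_ : 2 = 2%:C :> R[i]) ?cmodR ?ger0_norm// rmorph_nat.
Qed.

(** A point off E has a positive distance to the support. Along its radius p' is
    Lipschitz and Re p tends to zero, so |S'| = |p'| exp (- Re p) converges. *)
Lemma radial_limit t : ~ E (pt t) ->
  cvg (logplus (cmod (derive1 S (r%:C * expi t))) * r @[r --> (1:R)^'-]).
Proof.
move=> nE; have [k nt] := free_far nE.
have near01 : \forall r \near (1:R)^'-, 0 <= r < 1.
  near=> r; apply/andP; split; near: r; [|exact: nbhs_left_lt].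
  by apply: nbhs_left_ge; rewrite ltr01.
have c2 : cvg (2 * cmod (K 2 (r%:C * expi t)) @[r --> (1:R)^'-]).
  apply: (@lipschitz_cvg_left1 _ _ (2 * (2 * (2 ^+ k.+1) ^+ 3 * mass))) => r s r01 s01.
  rewrite -mulrBr normrM ger0_norm// -mulrA ler_wpM2l//.
  apply: le_trans (K2_lipschitz nt r01 s01).
  rewrite ler_norml cmod_dist andbT lerNl opprB.
  by rewrite cmodBC cmod_dist.
have cexp : expR (- ((1 - r ^+ 2) * qd (r%:C * expi t))) @[r --> (1:R)^'-] --> (1 : R).
  rewrite -[X in _ --> X]expR0 -oppr0.
  apply: continuous_cvg; first exact: continuous_expR.
  apply: cvgN.
  pose B := (2 ^+ k.+1) ^+ 2 * mass.
  apply: (@squeeze_cvgr _ _ _ _ (cst 0) (fun r => (1 - r ^+ 2) * B) _).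
  - near=> r; have rr : 0 <= r < 1 by near: r.
    have h : 0 <= 1 - r ^+ 2 by rewrite subr_ge0 expr_le1//; case/andP: rr => ? /ltW.
    by rewrite mulr_ge0 ?qd_ge0//= ler_wpM2l// qd_far.
  - exact: cvg_cst.
  - rewrite -[X in _ --> X](mul0r B) -[X in X * B](subrr 1) -[X in (_ - X) * B](expr1n R 2).
    apply: cvgM; last exact: cvg_cst.
    apply: cvgB; first exact: cvg_cst.
    by apply: cvg_at_left_filter; exact: exprn_continuous.
have /cvg_ex[l Hl] := c2.
have c3 : cmod (derive1 S (r%:C * expi t)) @[r --> (1:R)^'-] --> l * 1.
  apply: (cvg_trans _ (cvgM Hl cexp)); apply: near_eq_cvg.
  near=> r; have /andP[r0 r1] : 0 <= r < 1 by near: r.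
  by rewrite /= dS_cmod cmod_rpol.
rewrite mulr1 in c3.
have l0 : 0 <= l.
  rewrite -(cvg_lim _ c3)//; apply: limr_ge; first by apply/cvg_ex; eexists; exact: c3.
  by apply: nearW => r; exact: cmod_ge0.
apply/cvg_ex; exists (logplus l * 1); apply: cvgM; last first.
  exact: cvg_at_left_filter.
apply/cvgrPdist_lt => e e0.
have /cvgrPdist_lt/(_ _ e0) := c3.
apply: filterS => r; apply: le_lt_trans.
by apply: logplus_lipschitz => //; exact: cmod_ge0.
Unshelve. all: end_near. Qed.

(** As |S| <= 1, the derivative is bounded by |p'| <= 2 q, and q is at most
    4^(k+1) times the mass at a point of depth k. Its logarithm is 2 k log 2
    plus a constant, and log 2 <= 1. *)
Lemma logplus_dS_far k t (r : R) : (forall j, (j < k)%N -> near E j t) -> ~ near E k t ->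
  0 <= r < 1 ->
  ((logplus (cmod (derive1 S (r%:C * expi t))) * r)%:E <=
   (logplus (8 * mass))%:E + (depth E t + depth E t))%E.
Proof.
move=> nj nt r01; have /andP[r0 r1] := r01.
have cr : cmod (r%:C * expi t) < 1 by rewrite cmod_rpol.
have m0 := mass_ge0 mu.
apply: (@le_trans _ _ ((logplus (8 * mass))%:E + (k%:R%:E + k%:R%:E))%E); last first.
  by rewrite leeD2l// leeD// depth_ge.
rewrite -!EFinD lee_fin; apply: le_trans (_ : logplus (cmod (derive1 S (r%:C * expi t))) <= _).
  by rewrite ler_piMr ?logplus_ge0// ltW.
apply: le_trans (_ : logplus (8 * mass * (2 ^+ k * 2 ^+ k)) <= _).
  apply: ler_logplus; first exact: cmod_ge0.
  rewrite dS_cmod//; apply: le_trans (_ : 2 * qd (r%:C * expi t) * 1 <= _).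
    apply: ler_pM; rewrite ?expR_ge0 ?mulr_ge0 ?cmod_ge0//.
      by rewrite ler_wpM2l// cmod_K2.
    rewrite -[leRHS]expR0 ler_expR oppr_le0 mulr_ge0 ?qd_ge0// subr_ge0 expr_le1 ?cmod_ge0//.
    exact: ltW.
  rewrite mulr1 (_ : 8 * mass * (2 ^+ k * 2 ^+ k) = 2 * ((2 ^+ k.+1) ^+ 2 * mass)).
    by rewrite ler_wpM2l// qd_far.
  by rewrite (exprS 2 k); ring.
apply: le_trans (logplusM _ _) _; rewrite ?mulr_ge0 ?exprn_ge0// lerD2l.
have k2 : logplus (2 ^+ k) <= k%:R :> R.
  rewrite logplus_ge1 ?exprn_ege1 ?ler1n// lnXn//.
  by apply: le_trans (ler_wMn2r k ln2_le1) _.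
by apply: le_trans (logplusM _ _) _; rewrite ?exprn_ge0// lerD.
Qed.

Lemma logplus_dS_bound t (r : R) : ~ E (pt t) -> 0 <= r < 1 ->
  ((logplus (cmod (derive1 S (r%:C * expi t))) * r)%:E <=
   (logplus (8 * mass))%:E + (depth E t + depth E t))%E.
Proof.
move=> /free_far[k0 nk0] r01.
have exP : exists k, ~~ `[< near E k t >] by exists k0; apply/asboolPn.
case: (ex_minnP exP) => k /asboolPn nk kmin.
apply: (@logplus_dS_far k) => // j jk; apply: contrapT => nj.
by have := kmin j; rewrite leqNgt jk => /(_ _)/negP; apply => //; apply/asboolPn.
Qed.

Lemma circle_integrand_measurable (r : R) D : 0 <= r < 1 ->
  measurable_fun D (fun t => (logplus (cmod (derive1 S (r%:C * expi t))) * r)%:E).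
Proof.
move=> r01; apply: measurable_funTS; apply/measurable_EFinP.
apply: measurable_funM => //; apply: measurableT_comp; first exact: measurable_logplus.
apply: measurable_cmod; apply: cmeas_rpol => // z; exact: cder_dS.
Qed.

Lemma circle_logplusE (f : R[i] -> R[i]) (r : R) :
  measurable_fun setT (fun t => (logplus (cmod (f (r%:C * expi t))) * r)%:E) ->
  circle_logplus f r = (\int[lam]_(t in turn) (logplus (cmod (f (r%:C * expi t))) * r)%:E)%E.
Proof.
move=> mf; rewrite /circle_logplus -integral_itv_bndo_bndc; last first.
  apply: measurable_funTS; move: mf; congr measurable_fun; apply/funext => t.
  by rewrite rpolE.
by apply: eq_integral => t _; rewrite rpolE.
Qed.

(** The depth is an integrable majorant of log^+ |S'| on every circle, and S'
    has radial limits off the null set E. *)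
Lemma nevanlinna_of_BC : Beurling_Carleson E -> E !=set0 -> Nevanlinna (derive1 S).
Proof.
move=> BC E0; split; first exact: derivable_dS.
have [_ _ lE _] := BC.
have mA : measurable (angles E).
  rewrite angles_turn; apply: measurableI; first exact: measurable_turn.
  by apply: closed_measurable; exact: closed_pt_preimage.
pose D := turn `\` angles E.
have mD : measurable D by apply: measurableD => //; exact: measurable_turn.
have DE t : D t -> ~ E (pt t).
  by move=> [tt nt] Et; apply: nt; split => //; move: tt; rewrite /turn/= in_itv.
pose h r t : R := logplus (cmod (derive1 S (r%:C * expi t))) * r.
pose g t : \bar R := ((logplus (8 * mass))%:E + (depth E t + depth E t))%E.
have h0 r t : 0 <= r < 1 -> 0 <= h r t.
  by move=> /andP[r0 _]; rewrite mulr_ge0 ?logplus_ge0.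
have circ r : 0 <= r < 1 -> circle_logplus (derive1 S) r = (\int[lam]_(t in D) (h r t)%:E)%E.
  move=> r01; rewrite circle_logplusE; last exact: circle_integrand_measurable.
  rewrite (@ge0_negligible_integral _ _ _ lam turn (angles E))//.
  - exact: measurable_turn.
  - exact: circle_integrand_measurable.
  - by move=> t _; rewrite lee_fin; exact: h0.
have mg : measurable_fun D g.
  apply: emeasurable_funD => //.
  by apply: emeasurable_funD; exact: measurable_depth.
have g0 t : (0 <= g t)%E by rewrite adde_ge0 ?adde_ge0 ?depth_ge0// lee_fin logplus_ge0.
have ig : lam.-integrable D g.
  apply/integrableP; split => //.
  apply: le_lt_trans (_ : (\int[lam]_(t in turn) g t < +oo)%E).
    under eq_integral do rewrite gee0_abs//.
    apply: ge0_subset_integral => //.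
    - exact: measurable_turn.
    - by apply: emeasurable_funD => //; apply: emeasurable_funD; exact: measurable_depth.
    - exact: subDsetl.
  have fd := depth_of_BC BC E0.
  have mt := @measurable_turn R.
  have md := @measurable_depth R E turn.
  rewrite ge0_integralD//; last 3 first.
  - by move=> t _; rewrite lee_fin logplus_ge0.
  - by move=> t _; rewrite adde_ge0 ?depth_ge0.
  - by apply: emeasurable_funD.
  rewrite ge0_integralD//; [|by move=> t _; exact: depth_ge0|by move=> t _; exact: depth_ge0].
  apply: lte_add_pinfty; last exact: lte_add_pinfty.
  by rewrite integral_cst// -[ltLHS]/((logplus (8 * mass))%:E * lam turn)%E lam_turn -EFinM ltry.
have hg r t : D t -> 0 <= r < 1 -> ((h r t)%:E <= g t)%E.
  by move=> /DE nE r01; exact: logplus_dS_bound.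
pose L t : R := lim (h r t @[r --> (1:R)^'-]).
have hL t : D t -> h r t @[r --> (1:R)^'-] --> L t by move=> /DE /radial_limit.
have seqL (v : nat -> R) : (forall n, 0 <= v n < 1) -> v n @[n --> \oo] --> (1 : R) ->
    lam.-integrable D (fun t => (L t)%:E) /\
    (\int[lam]_(t in D) (h (v n) t)%:E)%E @[n --> \oo] --> (\int[lam]_(t in D) (L t)%:E)%E.
  move=> v01 v1.
  have cvgn t : D t -> (h (v n) t)%:E @[n --> \oo] --> (L t)%:E.
    move=> Dt; apply/cvg_EFin; first exact: nearW.
    have /cvg_at_leftP := hL _ Dt; apply; split => // n; by case/andP: (v01 n).
  have mh n : measurable_fun D (fun t => (h (v n) t)%:E) by exact: circle_integrand_measurable.
  have mL : measurable_fun D (fun t => (L t)%:E) by exact: emeasurable_fun_cvg cvgn.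
  have aec : {ae lam, forall t, D t -> (h (v n) t)%:E @[n --> \oo] --> (L t)%:E}.
    exact: aeW.
  have aeb : {ae lam, forall t, forall n, D t -> (`|(h (v n) t)%:E| <= g t)%E}.
    by apply: aeW => t n Dt; rewrite gee0_abs ?lee_fin ?h0//; exact: hg.
  have := @dominated_convergence _ _ R lam D mD (fun n t => (h (v n) t)%:E)
    (fun t => (L t)%:E) g mh mL.
  by move=> /(_ aec ig aeb) [iL _ cL].
pose v0 n : R := 1 - n.+1%:R^-1.
have v001 n : 0 <= v0 n < 1.
  by rewrite /v0 subr_ge0 invf_le1 ?ltr0Sn// ler1n/= ltrBlDr ltrDl invr_gt0 ltr0Sn.
have v01c : v0 n @[n --> \oo] --> (1 : R).
  rewrite -[X in _ --> X]subr0; apply: cvgB; first exact: cvg_cst.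
  exact: cvg_harmonic.
have [iL _] := seqL _ v001 v01c.
have fL : (\int[lam]_(t in D) (L t)%:E)%E \is a fin_num by apply: integrable_fin_num.
exists (fine (\int[lam]_(t in D) (L t)%:E)%E).
have ih r : 0 <= r < 1 -> (\int[lam]_(t in D) (h r t)%:E)%E \is a fin_num.
  move=> r01; apply: integrable_fin_num => //.
  apply: le_integrable ig => //; first exact: circle_integrand_measurable.
  by move=> t Dt; rewrite !gee0_abs ?lee_fin ?h0//; exact: hg.
(* The limit at 1 is tested on sequences in the whole left neighbourhood, whose
   members may be negative; the truncation at 0 does not change the limit. *)
pose Phi r := fine (\int[lam]_(t in D) (h (Num.max r 0) t)%:E)%E.
have max01 (r : R) : r < 1 -> 0 <= Num.max r 0 < 1 by move=> r1; rewrite le_max lexx orbT gt_max r1 ltr01.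
have Pc : Phi r @[r --> (1:R)^'-] --> fine (\int[lam]_(t in D) (L t)%:E)%E.
  apply/cvg_at_leftP => u [u1 cu].
  have um n : 0 <= Num.max (u n) 0 < 1 by exact: max01.
  have cum : Num.max (u n) 0 @[n --> \oo] --> (1 : R).
    apply: (cvg_trans _ cu); apply: near_eq_cvg.
    have /cvgrPdist_lt/(_ 1 ltr01) := cu.
    apply: filterS => n; rewrite ltr_norml => /andP[_]; rewrite ltrBlDr -ltrBlDl subrr => u0.
    by rewrite max_l// ltW.
  have [_ ] := seqL _ um cum.
  by move=> H; apply: fine_cvg; rewrite fineK.
have P2 : (Phi r)%:E @[r --> (1:R)^'-] --> (fine (\int[lam]_(t in D) (L t)%:E)%E)%:E.
  by apply/cvg_EFin => //; exact: nearW.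
apply: cvg_trans P2; apply: near_eq_cvg; near=> r.
have r0 : 0 <= r by near: r; apply: nbhs_left_ge; exact: ltr01.
have r1 : r < 1 by near: r; exact: nbhs_left_lt.
by rewrite circ ?r0// /Phi max_l// fineK// ih// r0.
Unshelve. all: end_near. Qed.

End ZeroToOne.

(** For empty E the depth is zero and there is no gap to work with; but then mu
    vanishes and S is constant. *)
Theorem supported_on_BC_nevanlinna (R : realType)
    (mu : {finite_measure set (plane R) -> \bar R}) (E : set (plane R)) :
  Beurling_Carleson E -> supported_on mu E -> Nevanlinna (derive1 (singular_inner mu)).
Proof.
move=> BC sE; have [cE Ec _ _] := BC.
have [E0|] := pselect (E !=set0); first exact: (nevanlinna_of_BC cE Ec sE BC E0).
move/set0P/negP; rewrite negbK => /eqP E0.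
have m0 : mass mu = 0.
  by move: sE; rewrite /supported_on E0 setD0 /mass => ->.
split; first exact: derivable_dS.
have H : (fun=> 0%:E : \bar R) r @[r --> (1:R)^'-] --> (0%:E : \bar R) by exact: cvg_cst.
exists 0; apply: (cvg_trans _ H); apply: near_eq_cvg; near=> r.
have r0 : 0 <= r by near: r; apply: nbhs_left_ge; exact: ltr01.
have r1 : r < 1 by near: r; exact: nbhs_left_lt.
rewrite /circle_logplus /= integral0_eq// => t _.
have z1 : cmod (r%:C * expi t) < 1 by rewrite cmod_rpol.
rewrite rpolE dS_cmod//.
have -> : cmod (K mu 2 (r%:C * expi t)) = 0.
  apply/eqP; rewrite eq_le cmod_ge0 andbT.
  by apply: le_trans (cmod_K2 mu z1) _; apply: le_trans (qd_upper mu z1) _; rewrite m0 mulr0.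
by rewrite mulr0 mul0r /logplus ln0// maxxx mul0r.
Unshelve. all: end_near. Qed.

(** * Whitney boxes *)

Section DyadicBoxes.
Context {R : realType}.
Implicit Types (t : R) (j i : nat).

Definition wid j : R := 2 * pi / 2 ^+ j.

Lemma wid_gt0 j : 0 < wid j.
Proof. by rewrite divr_gt0 ?two_pi_gt0// exprn_gt0. Qed.

Lemma wid_lt8 j : wid j < 8 * 2 ^- j.
Proof. by rewrite ltr_pM2r ?invr_gt0 ?exprn_gt0//; have := @pi_lt4 R; lra. Qed.

Lemma wid_ge4 j : 4 * 2 ^- j <= wid j.
Proof. by rewrite ler_pM2r ?invr_gt0 ?exprn_gt0//; have := @pi_ge2 R; lra. Qed.

(** The centre of the Whitney box number i of generation j: it lies at distance
    2^-j from the circle, above the left end of a dyadic arc. *)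
Definition zc j i : R[i] := (1 - 2 ^- j)%:C * expi (wid j * i%:R).

Lemma pow2N_gt0 j : 0 < 2 ^- j :> R.
Proof. by rewrite invr_gt0 exprn_gt0. Qed.

Lemma pow2N_le1 j : 2 ^- j <= 1 :> R.
Proof. by rewrite invf_le1 ?exprn_gt0// exprn_ege1// ler1n. Qed.

Lemma cmod_zc j i : cmod (zc j i) = 1 - 2 ^- j.
Proof. by rewrite cmod_rpol// subr_ge0 pow2N_le1. Qed.

Lemma cmod_zc_lt1 j i : cmod (zc j i) < 1.
Proof. by rewrite cmod_zc gtrBl pow2N_gt0. Qed.

Lemma wid_mul j : wid j * (2 ^ j)%:R = 2 * pi.
Proof. by rewrite natrX /wid divfK// expf_neq0. Qed.

(** The chord between neighbouring centres is comparable to the width of an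
    arc; this makes small squares around the centres disjoint. *)
Lemma zc_separated j i i' : (i < i')%N -> (i' < 2 ^ j)%N ->
  2 ^- j <= cmod (zc j i - zc j i').
Proof.
move=> ii' i'j; case: j i'j => [|j] i'j.
  by move: i'j ii'; rewrite expn0 ltnS leqn0 => /eqP ->.
have -> : zc j.+1 i - zc j.+1 i' = (1 - 2 ^- j.+1)%:C *
    (expi (wid j.+1 * i%:R) - expi (wid j.+1 * i'%:R)) by rewrite /zc; ring.
have h12 : 2 ^- j.+1 <= 1 / 2 :> R.
  by rewrite exprS invfM mul1r ler_piMr// ?pow2N_le1.
rewrite cmodM cmodR ger0_norm; last by lra.
apply: le_trans (_ : 1 / 2 * (2 * 2 ^- j.+1) <= _).
  by rewrite mulrA mul1r mulVf// mul1r.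
apply: ler_pM; rewrite ?mulr_ge0 ?(ltW (pow2N_gt0 _))//; first by lra.
have w0 := wid_gt0 j.+1; have w4 := wid_ge4 j.+1; have w1 := wid_mul j.+1.
have d1 : 1 <= (i'%:R - i%:R : R) by rewrite -natrB ?ler1n ?subn_gt0// ltnW.
have d2 : i'%:R - i%:R <= (2 ^ j.+1)%:R - 1 :> R.
  have : i'%:R + 1 <= (2 ^ j.+1)%:R :> R by rewrite natr1 ler_nat.
  have : 0 <= i%:R :> R by [].
  lra.
set s := wid j.+1 * i%:R; set s' := wid j.+1 * i'%:R.
have key : s' - s = wid j.+1 * (i'%:R - i%:R) by rewrite /s /s'; ring.
have k1 : wid j.+1 <= s' - s by rewrite key ler_peMr// ltW.
have k2 : s' - s <= 2 * pi - wid j.+1.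
  by have := ler_wpM2l (ltW w0) d2; rewrite (mulrBr _ (2 ^ _)%:R) w1 mulr1 key.
have half (u : R) : wid j.+1 <= u -> 2 * 2 ^- j.+1 <= u / 2.
  by move=> hu; rewrite ler_pdivlMr//; move: hu w4; clear; lra.
have [h|h] := leP (s' - s) pi.
  apply: le_trans (half _ k1) _; rewrite ler_pdivrMr// mulrC cmodBC.
  have := @le_cmod_expiB R s' s; rewrite ger0_norm; last by apply: le_trans k1; exact: ltW.
  exact.
have k3 : wid j.+1 <= s + 2 * pi - s' by move: k2; clear; lra.
apply: le_trans (half _ k3) _; rewrite ler_pdivrMr// [leRHS]mulrC.
have := @le_cmod_expiB R (s + 2 * pi) s'; rewrite ger0_norm; last by apply: le_trans k3; exact: ltW.
rewrite expiD expi2pi mulr1; apply.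
by move: h; clear; lra.
Qed.

End DyadicBoxes.

(** * The area condition bounds the bad sums *)

Section AreaToSum.
Context {R : realType} (mu : {finite_measure set (plane R) -> \bar R}).
Implicit Types (t : R) (j i : nat) (z : R[i]).
Local Notation S := (singular_inner mu).
Local Notation herg := (herg mu).
Local Notation qd := (qd mu).
Local Notation leb2 := ((@lebesgue_measure R) \x (@lebesgue_measure R))%E.

(** Harnack's inequality for Re p, with B comparing the factors 1 - |z|^2 of the
    two points. *)
Lemma herg_harnack z z' (A B : R) : cmod z < 1 -> cmod z' < 1 -> 0 <= A -> 0 <= B ->
  cmod (z' - z) <= A * (1 - cmod z') -> 1 - cmod z' <= B * (1 - cmod z) ->
  Re (herg z') <= 2 * B * (1 + A) ^+ 2 * Re (herg z).
Proof.
move=> z1 z'1 A0 B0 hA hB; rewrite !Re_herg//.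
have q0 := qd_ge0 mu z.
apply: le_trans (_ : (1 - cmod z' ^+ 2) * ((1 + A) ^+ 2 * qd z) <= _).
  rewrite ler_wpM2l ?qd_harnack// subr_ge0 expr_le1 ?cmod_ge0//; exact: ltW.
have c0 := cmod_ge0 z; have c0' := cmod_ge0 z'.
have h1 : 1 - cmod z' ^+ 2 <= 2 * (1 - cmod z').
  move: c0' z'1; move: (cmod z') => a a0 a1; nra.
have h2 : 1 - cmod z <= 1 - cmod z ^+ 2.
  move: c0 z1; clear; move: (cmod z) => a a0 a1; nra.
apply: le_trans (_ : 2 * B * (1 - cmod z ^+ 2) * ((1 + A) ^+ 2 * qd z) <= _); last first.
  by rewrite le_eqVlt; apply/orP; left; apply/eqP; ring.
apply: ler_wpM2r; first by rewrite mulr_ge0// sqr_ge0.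
apply: le_trans h1 _; rewrite -mulrA ler_wpM2l//; apply: le_trans hB _.
by rewrite ler_wpM2l.
Qed.

Definition bad (kappa : R) j i := kappa <= Re (herg (zc j i)).

Definition square (c : R[i]) (a : R) : set (plane R) :=
  `]Re c - a, Re c + a[%classic `*` `]Im c - a, Im c + a[%classic.

Lemma measurable_square c a : measurable (square c a).
Proof. exact: measurableX. Qed.

Lemma square_dist c a p : square c a p -> cmod (toC p - c) <= 2 * a.
Proof.
case: p => x y [] /=; rewrite !in_itv/= => /andP[x1 x2] /andP[y1 y2].
apply: le_trans (cmod_le_ReIm _) _; rewrite ReB ImB /=.
have h1 : `|x - Re c| <= a by rewrite ler_distl; apply/andP; split; apply: ltW.
have h2 : `|y - Im c| <= a by rewrite ler_distl; apply/andP; split; apply: ltW.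
by move: h1 h2; clear; lra.
Qed.

Lemma square_measure c a : 0 <= a -> leb2 (square c a) = ((2 * a) ^+ 2)%:E.
Proof.
move=> a0; have side (x : R) : (@lebesgue_measure R) `]x - a, x + a[%classic = (2 * a)%:E.
  rewrite lebesgue_measure_itv/= lte_fin; case: ltP => h.
    by rewrite -EFinB; congr EFin; ring.
  by congr EFin; move: h a0; clear; lra.
rewrite product_measure1E//= ?measurable_itv//; try exact: measurable_itv.
by rewrite -[X in (X * _)%E]/(lebesgue_measure _) !side -EFinM expr2.
Qed.

Definition sublevel (c : R) : set (plane R) :=
  disk `&` [set p | cmod (S (toC p)) < c].

Lemma ball_toC (p q : plane R) (e : R) : ball p e q -> cmod (toC q - toC p) < 2 * e.
Proof.
move=> [h1 h2]; apply: le_lt_trans (cmod_le_ReIm _) _; rewrite ReB ImB /=.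
move: h1 h2; rewrite /ball/= /ball_/= distrC => h1; rewrite distrC => h2.
by rewrite mulr_natl mulr2n ltrD.
Qed.

Lemma open_sublevel c : open (sublevel c).
Proof.
rewrite openE => p [dp Sp].
have z1 : cmod (toC p) < 1 by [].
have e0 : 0 < c - cmod (S (toC p)) by rewrite subr_gt0.
have {}[k k0 Hk] := cder_continuous (cder_S mu z1) e0.
pose e := Num.min k (1 - cmod (toC p)) / 2.
have ep : 0 < e by rewrite divr_gt0// lt_min k0 subr_gt0.
have e2 : 2 * e = Num.min k (1 - cmod (toC p)) by rewrite /e mulrC divfK.
apply/nbhs_ballP; exists e => //= q pq.
have := ball_toC pq; rewrite e2 lt_min => /andP[q1 q2].
split.
  by have := le_lt_trans (cmod_dist (toC q) (toC p)) q2; rewrite ltrD2r.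
have := Hk _ q1; rewrite (_ : toC p + (toC q - toC p) = toC q); last by ring.
by move=> h; have := le_lt_trans (cmod_dist (S (toC q)) (S (toC p))) h; rewrite ltrD2r.
Qed.

Lemma measurable_sublevel c : measurable (sublevel c).
Proof. by apply: open_plane_measurable; exact: open_sublevel. Qed.

Lemma measurable_invdist D : measurable_fun D (fun p : plane R => ((1 - cmod (toC p))^-1)%:E).
Proof.
apply: measurable_funTS; apply/measurable_EFinP.
apply: (measurableT_comp measurable_realV).
by apply: measurable_funB => //; apply: measurable_cmod; exact: cmeas_toC.
Qed.

(** The truncation at generation N keeps the sum finite; a bound independent of
    N expresses convergence. *)
Definition badsum (kappa : R) N : R :=
  \sum_(j < N) \sum_(i < 2 ^ j) (bad kappa j i)%:R * 2 ^- j.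

Definition pairs N : seq (nat * nat) := [seq (j, i) | j <- iota 0 N, i <- iota 0 (2 ^ j)].

Lemma mem_pairs N x : x \in pairs N -> (x.1 < N)%N /\ (x.2 < 2 ^ x.1)%N.
Proof.
move=> /allpairsPdep[j [i [jN ij ->]]] /=.
by move: jN ij; rewrite !mem_iota !add0n.
Qed.

Lemma uniq_pairs N : uniq (pairs N).
Proof.
apply: allpairs_uniq_dep; first exact: iota_uniq.
  by move=> j _; exact: iota_uniq.
by move=> [j i] [j' i'] _ _ [-> ->].
Qed.

Lemma badsumE kappa N :
  badsum kappa N = \sum_(x <- pairs N | bad kappa x.1 x.2) 2 ^- x.1.
Proof.
rewrite /pairs big_mkcond big_allpairs_dep /badsum -(big_mkord xpredT
  (fun j => \sum_(i < 2 ^ j) (bad kappa j i)%:R * 2 ^- j)) /index_iota subn0.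
apply: eq_bigr => j _; rewrite -(big_mkord xpredT (fun i => (bad kappa j i)%:R * 2 ^- j)).
rewrite /index_iota subn0; apply: eq_bigr => i _ /=.
by case: ifP => _; rewrite ?mul1r ?mul0r.
Qed.

(** Small enough to be disjoint for different boxes and to have x comparable to
    its value at the centre, large enough to have area comparable to 4^-j. *)
Definition bsq (x : nat * nat) : set (plane R) := square (zc x.1 x.2) (2 ^- x.1 / 16).

Lemma bsq_dist x p : bsq x p -> cmod (toC p - zc x.1 x.2) <= 2 ^- x.1 / 8.
Proof. by move=> /square_dist; rewrite (_ : 2 * (_ / 16) = 2 ^- x.1 / 8)//; field; rewrite expf_neq0. Qed.

Lemma bsq_rad x p : bsq x p -> 7 / 8 * 2 ^- x.1 <= 1 - cmod (toC p) <= 9 / 8 * 2 ^- x.1.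
Proof.
move=> /bsq_dist h; have := cmod_dist (toC p) (zc x.1 x.2); have := cmod_dist (zc x.1 x.2) (toC p).
rewrite cmodBC in h; rewrite (cmodBC (toC p)) cmod_zc; move: h; set d := 2 ^- x.1.
by move: (cmod (_ - _)) (cmod (toC p)) => a b; clear; move=> h1 h2 h3; apply/andP; split; lra.
Qed.

(** Squares of different generations are separated by their distance to the
    circle, those of one generation by the distance of their centres. *)
Lemma bsq_disjoint N x y p : x \in pairs N -> y \in pairs N -> bsq x p -> bsq y p -> x = y.
Proof.
move=> /mem_pairs[_ x2] /mem_pairs[_ y2] xp yp.
wlog xy : x y x2 y2 xp yp / (x.1 < y.1)%N || (x.1 == y.1) && (x.2 <= y.2)%N => [H|].
  case: (ltngtP x.1 y.1) => h.
  - by apply: H => //; rewrite h.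
  - by apply/esym/H => //; rewrite h.
  case: (leqP x.2 y.2) => h2; first by apply: H => //; rewrite h eqxx h2 orbT.
  by apply/esym/H => //; rewrite h eqxx (ltnW h2) orbT.
have /andP[a1 a2] := bsq_rad xp; have /andP[b1 b2] := bsq_rad yp.
case/orP: xy => [xy|/andP[/eqP x1y1]].
  have : 2 ^- y.1 <= 1 / 2 * 2 ^- x.1 :> R.
    rewrite mul1r -invfM -exprS lef_pV2 ?posrE ?exprn_gt0//.
    by rewrite ler_weXn2l// ler1n.
  have := pow2N_gt0 (R := R) x.1.
  move=> h1 h2; exfalso; move: (cmod (toC p)) (2 ^- x.1) (2 ^- y.1) a1 b2 h1 h2.
  by clear; move=> *; lra.
rewrite leq_eqVlt => /orP[/eqP x2y2|xy].
  by move: x1y1 x2y2; case: x {x2 xp a1 a2}; case: y {y2 yp b1 b2} => /= ? ? ? ? -> ->.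
have h1 := bsq_dist xp; have h2 := bsq_dist yp; rewrite -x1y1 in h2 y2.
have := zc_separated (R := R) xy y2.
have := cmod_tri (toC p) (zc x.1 x.2) (zc x.1 y.2).
rewrite cmodBC in h1; have := pow2N_gt0 (R := R) x.1.
move=> h3 h4 h5; exfalso.
move: (2 ^- x.1) (cmod (zc x.1 x.2 - toC p)) (cmod (toC p - zc x.1 y.2)) (cmod (zc x.1 x.2 - zc x.1 y.2)) h1 h2 h3 h4 h5.
by clear; move=> *; lra.
Qed.

(** By Harnack's inequality x >= kappa / 16 on the whole square of a bad box, so
    the squares lie in a set where |S| is bounded away from 1. Each square
    contributes a multiple of 4^-j 2^j = 2^-j to the area integral. *)
Lemma badsum_of_area kappa : 0 < kappa -> area_condition S ->
  exists B : R, forall N, badsum kappa N <= B.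
Proof.
move=> k0 area; pose c := expR (- (kappa / 16)).
have c01 : 0 < c < 1.
  by rewrite expR_gt0/= -[ltRHS]expR0 ltr_expR oppr_lt0 divr_gt0.
have := area c c01; rewrite -/(sublevel c); set I := integral _ _ _ => Ifin.
have I0 : (0 <= I)%E.
  apply: integral_ge0 => p [dp _]; rewrite lee_fin invr_ge0 subr_ge0; exact: ltW.
exists (128 * fine I) => N.
have If : I \is a fin_num by rewrite ge0_fin_numE.
rewrite badsumE -ler_pdivrMl// -lee_fin fineK//.
have inD x p : bad kappa x.1 x.2 -> bsq x p -> sublevel c p.
  move=> bx xp; have /andP[p1 p2] := bsq_rad xp.
  have pw := pow2N_gt0 (R := R) x.1.
  have z1 : cmod (toC p) < 1.
    by move: p1 pw; move: (cmod _) (2 ^- x.1); clear; move=> *; lra.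
  split; first by [].
  suff : cmod (S (toC p)) < c by [].
  rewrite cmod_S// ltr_expR ltrN2.
  have := herg_harnack (z := toC p) (z' := zc x.1 x.2) (A := 1 / 8) (B := 2) z1 (cmod_zc_lt1 _ _).
  rewrite cmod_zc opprB addrCA subrr addr0 => /(_ ltac:(lra) ltac:(lra)).
  rewrite cmodBC => /(_ _ _) H.
  have := H ltac:(by rewrite mul1r mulrC; exact: bsq_dist) ltac:(by move: p1 pw; move: (cmod _) (2 ^- x.1); clear; move=> *; lra).
  move: bx; rewrite /bad; move: (Re _) (Re _) k0 => a b; clear.
  by move=> k0 h1 h2; lra.
pose s := [seq x <- pairs N | bad kappa x.1 x.2].
have ms x : x \in s -> bad kappa x.1 x.2 /\ x \in pairs N by rewrite mem_filter => /andP[].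
have mB : measurable (\big[setU/set0]_(x <- s) bsq x).
  by apply: bigsetU_measurable => x _; exact: measurable_square.
have sub : \big[setU/set0]_(x <- s) bsq x `<=` sublevel c.
  by move=> p; rewrite -bigcup_seq => -[x /= /ms[bx _]]; exact: inD.
apply: (@le_trans _ _ (\int[leb2]_(p in \big[setU/set0]_(x <- s) bsq x) ((1 - cmod (toC p))^-1)%:E)%E); last first.
  apply: ge0_subset_integral => //.
  - exact: measurable_sublevel.
  - exact: measurable_invdist.
  - by move=> p [dp _]; rewrite lee_fin invr_ge0 subr_ge0; exact: ltW.
rewrite ge0_integral_bigsetU//.
- rewrite -big_filter -/s mulr_sumr -sumEFin.
  rewrite big_seq [leRHS]big_seq; apply: lee_sum => x /ms[bx xN].
  apply: (@le_trans _ _ (\int[leb2]_(p in bsq x) (2 ^+ x.1 / 2)%:E)%E).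
    rewrite integral_cst; last exact: measurable_square.
    rewrite -[X in (_ * X)%E]/(leb2 (bsq x)) square_measure//.
    rewrite -EFinM lee_fin le_eqVlt; apply/orP; left; apply/eqP.
    by field; rewrite expf_neq0.
  apply: ge0_le_integral.
  - exact: measurable_square.
  - by move=> p _; rewrite lee_fin divr_ge0 ?exprn_ge0.
  - exact: measurable_cst.
  - exact: measurable_invdist.
  - move=> p xp; rewrite lee_fin; have /andP[p1 p2] := bsq_rad xp.
    have pw := pow2N_gt0 (R := R) x.1.
    rewrite -[leLHS]invrK lef_pV2 ?posrE ?invr_gt0 ?divr_gt0 ?exprn_gt0//.
      rewrite invf_div; move: p2 pw; clear; move: (cmod _) => a *; lra.
    by move: p1 pw; move: (cmod _) (2 ^- x.1); clear; move=> *; lra.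
- by move=> x; exact: measurable_square.
- by rewrite filter_uniq// uniq_pairs.
- by move=> x y /ms[_ xN] /ms[_ yN] [p [xp yp]]; exact: bsq_disjoint xN yN xp yp.
- exact: measurable_invdist.
- move=> p /sub [dp _]; rewrite lee_fin invr_ge0 subr_ge0; exact: ltW.
Qed.

End AreaToSum.

(** * Heavy arcs and the sets they generate *)

Section Cells.
Context {R : realType} (mu : {finite_measure set (plane R) -> \bar R}).
Implicit Types (t : R) (j k i : nat).
Local Notation lam := (@lebesgue_measure R).
Local Notation mass := (mass mu).
Local Notation herg := (herg mu).
Local Notation qd := (qd mu).

Definition cell k i : set R := `[wid k * i%:R, wid k * i.+1%:R[%classic.

(** Arcs are images of intervals of angles: this avoids any convention about
    arcs that pass through the angle 0. *)
Definition parc (A : set R) : set (plane R) := [set pt t | t in A].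

Lemma measurable_cell k i : measurable (cell k i).
Proof. exact: measurable_itv. Qed.

Lemma cell_len k i : wid k * i.+1%:R = wid k * i%:R + wid k :> R.
Proof. by rewrite -natr1; ring. Qed.

Lemma lam_cell k i : lam (cell k i) = (wid k)%:E.
Proof.
rewrite lebesgue_measure_itv/= lte_fin cell_len ltrDl wid_gt0 -EFinB.
by congr EFin; ring.
Qed.

Lemma cell_inj k i i' t : cell k i t -> cell k i' t -> i = i'.
Proof.
rewrite /cell/= !in_itv/= => /andP[a1 a2] /andP[b1 b2].
have h1 := le_lt_trans a1 b2; have h2 := le_lt_trans b1 a2.
rewrite !ltr_pM2l ?wid_gt0// !ltr_nat !ltnS in h1 h2.
by apply/eqP; rewrite eqn_leq h1.
Qed.

Lemma cell_exists k t : 0 <= t < 2 * pi -> exists2 i, (i < 2 ^ k)%N & cell k i t.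
Proof.
move=> /andP[t0 t2].
have h0 : 0 <= t / wid k by rewrite divr_ge0// ltW// wid_gt0.
have /andP[h1 h2] := truncn_itv h0.
exists (Num.truncn (t / wid k)); last first.
  rewrite /cell/= in_itv/= ![wid k * _]mulrC -ler_pdivlMr ?wid_gt0// h1/=.
  by rewrite -ltr_pdivrMr ?wid_gt0.
rewrite -(ltr_nat R); apply: le_lt_trans h1 _.
by rewrite ltr_pdivrMr ?wid_gt0// mulrC wid_mul.
Qed.

Lemma wid_split k d : wid k = wid (k + d) * (2 ^ d)%:R :> R.
Proof. by rewrite /wid exprD natrX; field; rewrite !expf_neq0. Qed.

Lemma cell_coarser k d i i' t : cell (k + d) i t -> cell k i' t -> i' = (i %/ 2 ^ d)%N.
Proof.
have e x : wid k * x%:R = wid (k + d) * (2 ^ d * x)%:R :> R.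
  by rewrite (wid_split k d) natrM mulrA.
rewrite /cell/= !in_itv/= !e => /andP[a1 a2] /andP[b1 b2].
have h1 := le_lt_trans a1 b2; have h2 := le_lt_trans b1 a2.
rewrite !ltr_pM2l ?wid_gt0// !ltr_nat ltnS in h1 h2.
apply/eqP; rewrite eqn_leq leq_divRL ?expn_gt0// mulnC h2/=.
by rewrite -ltnS ltn_divLR ?expn_gt0// mulnC.
Qed.

Lemma cell_turn k i t : (i < 2 ^ k)%N -> cell k i t -> 0 <= t < 2 * pi.
Proof.
move=> ik; rewrite /cell/= in_itv/= => /andP[a1 a2].
have w0 := @wid_gt0 R k.
apply/andP; split; first by apply: le_trans a1; rewrite mulr_ge0// ltW.
by apply: lt_le_trans a2 _; rewrite -(wid_mul k) ler_pM2l// ler_nat.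
Qed.

Lemma plane_hausdorff : hausdorff_space (plane R).
Proof. exact: norm_hausdorff. Qed.

Lemma closed_parc a b : closed (parc `[a, b]%classic).
Proof.
apply: compact_closed; first exact: plane_hausdorff.
apply: continuous_compact; last exact: segment_compact.
by apply: continuous_subspaceT; exact: continuous_pt.
Qed.

Lemma measurable_parc_cell k i : measurable (parc (cell k i)).
Proof.
have -> : parc (cell k i) =
    \bigcup_n parc `[wid k * i%:R, wid k * i.+1%:R - n.+1%:R^-1]%classic.
  apply/seteqP; split => [_ [t tc <-]|_ [n _ [t /= tn <-]]]; last first.
    exists t => //; move: tn; rewrite /cell/= !in_itv/= => /andP[-> h]/=.
    by apply: le_lt_trans h _; rewrite gtrBl invr_gt0.
  move: tc; rewrite /cell/= in_itv/= => /andP[a1 a2].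
  have d0 : 0 < wid k * i.+1%:R - t by rewrite subr_gt0.
  have [n /= _ /(_ n (leqnn _)) H] := near_infty_natSinv_lt (PosNum d0).
  exists n => //; exists t => //=; rewrite in_itv/= a1/= lerBrDr -lerBrDl.
  by move: H => /= /ltW.
apply: bigcupT_measurable => n; apply: closed_plane_measurable; exact: closed_parc.
Qed.

Lemma parc_cell_circle k i : parc (cell k i) `<=` circle.
Proof. by move=> _ [t _ <-]; exact: circle_pt. Qed.

Lemma measure_seqU_le d (T : measurableType d) (m : {measure set T -> \bar R}) (I : Type)
    (s : seq I) (F : I -> set T) : (forall i : I, measurable (F i)) ->
  (m (\big[setU/set0]_(i <- s) F i) <= \sum_(i <- s) m (F i))%E.
Proof.
move=> mF; elim: s => [|i s IH]; first by rewrite !big_nil measure0.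
rewrite !big_cons; apply: le_trans (measureU2 _ _ _) _ => //.
  by apply: bigsetU_measurable => k _; exact: mF.
exact: leeD.
Qed.

(** The threshold 81 is 9^2, as all points of the arc are within 9 2^-k
    of the centre of the Whitney box of generation k; see heavy_bad. *)
Definition heavy k i := 81 * 2 ^- k <= fine (mu (parc (cell k i))).

(** The arc alone contributes 81 2^-k (9 2^-k)^-2 = 2^k to q at the centre of
    the box, where 1 - |z|^2 >= 2^-k. *)
Lemma heavy_bad k i : heavy k i -> bad mu 1 k i.
Proof.
rewrite /heavy /bad => H; set z := zc k i; have z1 : cmod z < 1 := cmod_zc_lt1 _ _.
have mC := @measurable_circle R.
have mp := measurable_parc_cell k i.
have pw := pow2N_gt0 (R := R) k.
set m := fine (mu (parc (cell k i))) in H.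
pose c : R := (9 * 2 ^- k)^-1 ^+ 2.
have mE : mu (parc (cell k i)) = m%:E by rewrite fineK// fin_num_measure.
have qb : c * m <= qd z.
  have iz := inv_dist_integrable mu z1.
  have qE : (qd z)%:E = (\int[mu]_(p in circle) ((cmod (toC p - z))^-1 ^+ 2)%:E)%E.
    by rewrite fineK//; exact: integrable_fin_num.
  rewrite -lee_fin qE EFinM -mE -integral_cst//.
  apply: (@le_trans _ _ (\int[mu]_(p in parc (cell k i)) ((cmod (toC p - z))^-1 ^+ 2)%:E)%E); last first.
    apply: ge0_subset_integral => //.
    - by apply/measurable_EFinP; apply: measurable_funTS; exact: measurable_inv_dist.
    - by move=> p _; rewrite lee_fin sqr_ge0.
    - exact: parc_cell_circle.
  apply: ge0_le_integral => //.
  - by move=> p _; rewrite lee_fin sqr_ge0.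
  - by apply/measurable_EFinP; apply: measurable_funTS; exact: measurable_inv_dist.
  - move=> _ [t tc <-]; rewrite lee_fin /c lerXn2r ?nnegrE ?invr_ge0 ?cmod_ge0//.
    have n0 : 0 < cmod (toC (pt t) - z).
      by rewrite (lt_le_trans _ (dist_circle z (circle_pt t)))// subr_gt0.
    rewrite lef_pV2 ?posrE ?mulr_gt0//.
    apply: le_trans (cmod_tri (expi (wid k * i%:R)) _ _) _.
    have h1 : cmod (toC (pt t) - expi (wid k * i%:R)) <= wid k.
      apply: le_trans (cmod_expiB_le _ _) _.
      move: tc; rewrite /cell/= in_itv/= cell_len => /andP[a1 a2].
      by rewrite ger0_norm ?subr_ge0// lerBlDl ltW.
    have h2 : cmod (expi (wid k * i%:R) - z) = 2 ^- k.
      rewrite /z /zc (_ : _ - _ = (2 ^- k)%:C * expi (wid k * i%:R)); last first.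
        by rewrite rmorphB/=; ring.
      by rewrite cmod_rpol// ltW.
    rewrite h2; apply: le_trans (lerD h1 (lexx _)) _.
    have := wid_lt8 (R := R) k; set w := wid k; set e := 2 ^- k; clear; clearbody w e.
    by move=> *; lra.
rewrite Re_herg// cmod_zc.
have q0 := qd_ge0 mu z; have p1 := pow2N_le1 (R := R) k.
apply: le_trans (_ : 2 ^- k * (c * m) <= _); last first.
  apply: le_trans (_ : 2 ^- k * qd z <= _); first by rewrite ler_wpM2l// ltW.
  by apply: ler_wpM2r => //; move: pw p1; move: (2 ^- k) => a; clear; nra.
apply: le_trans (_ : 2 ^- k * (c * (81 * 2 ^- k)) <= _); last first.
  by rewrite ler_wpM2l ?(ltW pw)// ler_wpM2l// sqr_ge0.
by rewrite /c le_eqVlt; apply/orP; left; apply/eqP; field; rewrite expf_neq0.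
Qed.

Definition nheavy k : R := \sum_(i < 2 ^ k) (heavy k i)%:R.

Lemma nheavy_ge0 k : 0 <= nheavy k.
Proof. by apply: sumr_ge0. Qed.

Lemma sum_nheavy N : \sum_(k < N) nheavy k * 2 ^- k <= badsum mu 1 N.
Proof.
apply: ler_sum => k _; rewrite /nheavy mulr_suml; apply: ler_sum => i _.
rewrite ler_wpM2r ?(ltW (pow2N_gt0 _))// ler_nat.
by case: (boolP (heavy k i)) => // /heavy_bad ->.
Qed.

(** Closed arcs are used here in order that the level be closed. *)
Definition level k : set (plane R) :=
  \bigcup_(i in [set i | (i < 2 ^ k)%N /\ heavy k i])
    parc `[wid k * i%:R, wid k * i%:R + wid k]%classic.

(** Using all generations k >= n lets the neighbourhood of order k of E_n be
    estimated by the heavy arcs of generation k alone. *)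
Definition En n : set (plane R) := \bigcap_(k in [set k | (n <= k)%N]) level k.

Lemma closed_level k : closed (level k).
Proof.
apply: closed_bigcup => [|i _]; last exact: closed_parc.
by apply: (@sub_finite_set _ _ `I_(2 ^ k)); [move=> i []|exact: finite_II].
Qed.

Lemma closed_En n : closed (En n).
Proof. by apply: closed_bigI => k _; exact: closed_level. Qed.

Lemma levelP k p : level k p -> exists i : nat, [/\ (i < 2 ^ k)%N, heavy k i &
  exists2 t, wid k * i%:R <= t <= wid k * i%:R + wid k & p = pt t].
Proof.
by move=> [i [ik hi] [t /= tc <-]]; exists i; split => //; exists t.
Qed.

Lemma level_circle k : level k `<=` circle.
Proof. by move=> p /levelP[i [_ _ [t _ ->]]]; exact: circle_pt. Qed.

Lemma En_circle n : En n `<=` circle.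
Proof. by move=> p /(_ n (leqnn _)); exact: level_circle. Qed.

Definition hlist k : seq nat := [seq i <- iota 0 (2 ^ k) | heavy k i].

Lemma size_hlist k : (size (hlist k))%:R = nheavy k.
Proof.
rewrite /nheavy size_filter -sum1_count natr_sum big_mkcond/=.
rewrite -(big_mkord xpredT (fun i => (heavy k i)%:R)) /index_iota subn0.
by apply: eq_bigr => i _; case: (heavy k i).
Qed.

(** Angles near an arc may differ from those of the arc by a period, so each heavy
    arc contributes its midpoint and two translates by 2 pi. *)
Definition centers k : seq R :=
  flatten [seq [:: wid k * i%:R + wid k / 2 - 2 * pi; wid k * i%:R + wid k / 2;
                   wid k * i%:R + wid k / 2 + 2 * pi] | i <- hlist k].

Lemma size_centers k : (size (centers k))%:R = 3 * nheavy k.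
Proof.
rewrite /centers size_flatten /shape -map_comp -size_hlist.
elim: (hlist k) => [|i s IH] /=; first by rewrite mulr0.
by rewrite natrD IH -natr1; ring.
Qed.

(** The neighbourhood of order k of E_n is contained in that of the heavy arcs
    of generation k, whose length is already comparable to 2^-k. *)
Lemma near_En_measure n k : (n <= k)%N ->
  (lam (near (En n) k `&` turn) <= (42 * (nheavy k * 2 ^- k))%:E)%E.
Proof.
move=> nk; pose d : R := 7 * 2 ^- k.
have pw := pow2N_gt0 (R := R) k.
have -> : 42 * (nheavy k * 2 ^- k) = (size (centers k))%:R * (2 * d).
  by rewrite size_centers /d; ring.
apply: lam_balls; first by rewrite mulr_ge0// ltW.
  by apply: measurableI; [exact: measurable_near|exact: measurable_turn].
move=> t [[p pE tp] tt].
have [i [ik hi [s /andP[s1 s2] ps]]] := levelP (pE k nk).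
have [j /andP[j1 j2]] := shift_2pi t s; set t' := t + _ in j1 j2.
have tE : t' = t + j%:~R * (2 * pi) by [].
have expit : expi t' = expi t by rewrite -!toC_pt pt_periodicz.
have w8 := wid_lt8 (R := R) k; have w0 := @wid_gt0 R k.
have p4 := @pi_lt4 R; have p0 := @pi_gt0 R.
have ts : `|t' - s| < 2 * 2 ^- k.
  apply: le_lt_trans (le_cmod_expiB _) _.
    by rewrite ler_norml; apply/andP; split; move: j1 j2; clear; move=> *; lra.
  by rewrite expit ltr_pM2l// -(toC_pt s) -ps.
have tc : `|t' - (wid k * i%:R + wid k / 2)| < d.
  move: ts s1 s2 w8 w0; rewrite /d; set a : R := wid k * i%:R; set b : R := wid k.
  set c : R := 2 ^- k; clearbody a b c; clear; rewrite !ltr_norml => /andP[h1 h2] h3 h4 h5 h6; apply/andP; split; lra.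
have [t0 t2] : 0 <= t /\ t < 2 * pi by move: tt; rewrite /turn/= in_itv/= => /andP[].
have s0 : 0 <= s by apply: le_trans s1; rewrite mulr_ge0// ltW.
have s2p : s <= 2 * pi.
  by apply: le_trans s2 _; rewrite -cell_len -(wid_mul k) ler_pM2l// ler_nat.
have jb : (-1 <= j <= 1)%R.
  have h3 : (-2 < j)%R.
    rewrite -(ltr_int R) -(ltr_pM2r (two_pi_gt0 (R:=R))).
    by move: tE j1 j2 s0 s2p t0 t2 p0; set x := j%:~R * _; clear; move=> *; lra.
  have h4 : (j < 2)%R.
    rewrite -(ltr_int R) -(ltr_pM2r (two_pi_gt0 (R:=R))).
    by move: tE j1 j2 s0 s2p t0 t2 p0; set x := j%:~R * _; clear; move=> *; lra.
  by move: h3 h4; clear; lia.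
have il : i \in hlist k by rewrite mem_filter hi mem_iota.
have inc x : x \in [:: wid k * i%:R + wid k / 2 - 2 * pi; wid k * i%:R + wid k / 2;
                   wid k * i%:R + wid k / 2 + 2 * pi] -> x \in centers k.
  by move=> xl; apply/flattenP; eexists; [apply/mapP; exists i; [exact: il|reflexivity]|].
have [jE|[jE|jE]] : j = -1 \/ j = 0 \/ j = 1 by move: jb; clear; lia.
- exists (wid k * i%:R + wid k / 2 + 2 * pi); first by apply: inc; rewrite !inE eqxx !orbT.
  by move: tc; rewrite tE jE mulN1r; congr (`|_| < _); ring.
- exists (wid k * i%:R + wid k / 2); first by apply: inc; rewrite !inE eqxx !orbT.
  by move: tc; rewrite tE jE mul0r addr0.
- exists (wid k * i%:R + wid k / 2 - 2 * pi); first by apply: inc; rewrite !inE eqxx.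
  by move: tc; rewrite tE jE mul1r; congr (`|_| < _); ring.
Qed.

(** The terms below n are bounded by the full length of the circle. The others
    add up to the bad sum, since each heavy arc has a bad box. *)
Lemma depth_En_fin n (B : R) : (forall N, badsum mu 1 N <= B) ->
  (\int[lam]_(t in turn) depth (En n) t <= (n%:R * (2 * pi) + 42 * B)%:E)%E.
Proof.
move=> HB; rewrite integral_depth; last exact: measurable_turn.
apply: lime_le; first exact: is_cvg_nneseries.
apply: nearW => N.
have h k : (lam (near (En n) k `&` turn) <=
    (((k < n)%N)%:R * (2 * pi) + 42 * (nheavy k * 2 ^- k))%:E)%E.
  have [kn|nk] := ltnP k n; last by rewrite mul0r add0r; exact: near_En_measure.
  apply: (@le_trans _ _ (lam turn)).
    apply: le_measure; rewrite ?inE//; [|exact: measurable_turn].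
    by apply: measurableI; [exact: measurable_near|exact: measurable_turn].
  by rewrite lam_turn lee_fin mul1r lerDl mulr_ge0// mulr_ge0 ?nheavy_ge0// ltW// pow2N_gt0.
apply: le_trans (lee_sum _ (fun k _ => h k)) _.
rewrite sumEFin lee_fin big_split/=; apply: lerD.
  rewrite -mulr_suml ler_wpM2r ?(ltW two_pi_gt0)// -natr_sum ler_nat.
  suff -> : (\sum_(0 <= k < N) (k < n) = minn N n)%N by rewrite geq_minr.
  elim: N {h} => [|N IH]; first by rewrite big_geq// min0n.
  by rewrite big_nat_recr//= IH /minn; case: (ltnP N n); case: (ltnP N.+1 n); lia.
rewrite -mulr_sumr ler_wpM2l// big_mkord; apply: le_trans (sum_nheavy N) (HB N).
Qed.

End Cells.

(** * Covering the remaining mass by light arcs *)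

Section LightCover.
Context {R : realType} (mu : {finite_measure set (plane R) -> \bar R}).
Implicit Types (t : R) (j k i : nat).
Local Notation lam := (@lebesgue_measure R).

Lemma measurable_pt : measurable_fun setT (@pt R).
Proof.
by apply/measurable_fun_pairP; split; apply: continuous_measurable_fun;
  [exact: continuous_cos|exact: continuous_sin].
Qed.

Lemma measurable_angles (A : set (plane R)) : measurable A -> measurable (angles A).
Proof.
move=> mA; rewrite angles_turn; apply: measurableI; first exact: measurable_turn.
by rewrite -[X in measurable X]setTI; exact: measurable_pt.
Qed.

(** The depth is infinite on E. *)
Lemma angles_null_of_depth (E : set (plane R)) : closed E ->
  (\int[lam]_(t in turn) depth E t < +oo)%E -> arc_length E = 0%E.
Proof.
move=> cE fin; have mE : measurable (angles E).
  by apply: measurable_angles; exact: closed_plane_measurable.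
have deep N t : angles E t -> ((N%:R)%:E <= depth E t)%E.
  move=> [_ Et]; have kE k : near E k t.
    by exists (pt t) => //; rewrite toC_pt subrr cmod0 pow2N_gt0.
  apply: (@le_trans _ _ (\sum_(0 <= k < N) (\1_(near E k) t)%:E)%E).
    rewrite (eq_bigr (fun _ => (1 : R)%:E)); last by move=> k _; rewrite indicE mem_set.
    by rewrite sumEFin lee_fin big_mkord sumr_const card_ord.
  by apply: nneseries_lim_ge => k _ _; rewrite lee_fin.
rewrite -[arc_length E]/(lam (angles E)).
have I0 : (0 <= \int[lam]_(t in turn) depth E t)%E.
  by apply: integral_ge0 => t _; exact: depth_ge0.
have le N : ((N%:R)%:E * lam (angles E) <= \int[lam]_(t in turn) depth E t)%E.
  rewrite -integral_cst//.
  apply: (@le_trans _ _ (\int[lam]_(t in angles E) depth E t)%E).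
    apply: ge0_le_integral => //.
    - by move=> t _; rewrite lee_fin.
    - exact: measurable_depth.
    - by move=> t; exact: deep.
  apply: ge0_subset_integral => //.
  - exact: measurable_turn.
  - exact: measurable_depth.
  - by move=> t _; exact: depth_ge0.
  - by rewrite angles_turn => t [].
move: fin I0 le; case: (integral _ _ _) => [I| |]// _ I0 le.
have : (lam (angles E) <= I%:E)%E by have := le 1%N; rewrite mul1e.
have : (0 <= lam (angles E))%E by exact: measure_ge0.
move: le; case: (lam (angles E)) => [l| |]// le; rewrite !lee_fin => l0 _.
apply/eqP; rewrite eqe eq_le l0 andbT leNgt; apply/negP => lp.
have := truncnS_gt (I / l); rewrite ltr_pdivrMr// => h.
by have := le (Num.truncn (I / l)).+1; rewrite -EFinM lee_fin leNgt h.
Qed.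

Lemma light_measure k i : ~ heavy mu k i -> (mu (parc (cell k i)) <= (81 * 2 ^- k)%:E)%E.
Proof.
move=> nh; have mE : mu (parc (cell k i)) = (fine (mu (parc (cell k i))))%:E.
  by rewrite fineK// fin_num_measure//; exact: measurable_parc_cell.
by rewrite mE lee_fin leNgt; apply/negP => h; apply: nh; exact: ltW.
Qed.

Definition light_in (U : set R) k i : bool :=
  `[< [/\ (i < 2 ^ k)%N, ~ heavy mu k i & cell k i `<=` U] >].

(** The light cells that meet no light cell of an earlier generation: these are
    pairwise disjoint and have the same union as all light cells. *)
Definition first_light U k i : bool := light_in U k i &&
  `[< forall k' i', (k' < k)%N -> light_in U k' i' -> cell k i `&` cell k' i' = @set0 R >].

Definition first_cells U k : set R :=
  \big[setU/set0]_(i < 2 ^ k | first_light U k i) cell k i.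

Definition first_arcs U k : set (plane R) :=
  \big[setU/set0]_(i < 2 ^ k | first_light U k i) parc (cell k i).

Lemma in_ord_union T n (P : pred nat) (F : nat -> set T) x :
  (\big[setU/set0]_(i < n | P i) F i) x <-> exists i, [/\ (i < n)%N, P i & F i x].
Proof.
rewrite -(big_mkord P F) -bigcup_seq_cond; split.
  by move=> [i /= /andP[]]; rewrite mem_index_iota => iN Pi Fx; exists i.
by move=> [i [iN Pi Fx]]; exists i => //=; rewrite mem_index_iota iN.
Qed.

Lemma first_lightE U k i : first_light U k i ->
  [/\ (i < 2 ^ k)%N, ~ heavy mu k i, cell k i `<=` U &
   forall k' i', (k' < k)%N -> light_in U k' i' -> cell k i `&` cell k' i' = @set0 R].
Proof. by move=> /andP[/asboolP[? ? ?] /asboolP ?]. Qed.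

Lemma first_cells_disjoint U : trivIset setT (first_cells U).
Proof.
apply/trivIsetP => k k' _ _ kk'.
wlog lt : k k' {kk'} / (k' < k)%N => [H|].
  by move: kk'; rewrite neq_ltn => /orP[] h; [rewrite setIC|]; exact: H.
apply/seteqP; split => // t [] /in_ord_union[i [ik fi ti]] /in_ord_union[i' [ik' fi' ti']].
have [_ _ _ /(_ k' i' lt)] := first_lightE fi.
by move=> <-; [split|case/andP: fi'].
Qed.

Lemma first_cells_sub U k : first_cells U k `<=` U.
Proof.
move=> t /in_ord_union[i [_ fi ti]].
by have [_ _ + _] := first_lightE fi; apply.
Qed.

Lemma measurable_first_cells U k : measurable (first_cells U k).
Proof. by apply: bigsetU_measurable => i _; exact: measurable_cell. Qed.

(** A light arc has mass at most 81 2^-k and length at least 4 2^-k. *)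
Lemma first_arcs_measure U k :
  (mu (first_arcs U k) <= (81 / 4)%:E * lam (first_cells U k))%E.
Proof.
rewrite /first_arcs -big_filter.
apply: le_trans (measure_seqU_le mu _ _) _.
  by move=> i; exact: measurable_parc_cell.
rewrite big_filter /first_cells measure_bigsetU_ord_cond; last 2 first.
- by move=> i _; exact: measurable_cell.
- apply/trivIsetP => i j _ _ ij; apply/seteqP; split => // t [ti tj].
  by move/eqP: ij; apply; apply: val_inj; exact: cell_inj ti tj.
rewrite ge0_sume_distrr; last by move=> i _; exact: measure_ge0.
apply: lee_sum => i fi; rewrite -[X in (_ * X)%E]/(lam (cell k i)) lam_cell -EFinM.
have [_ nh _ _] := first_lightE fi.
apply: le_trans (light_measure nh) _; rewrite lee_fin.
have := wid_ge4 (R := R) k.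
by set w := wid k; set e := 2 ^- k; clearbody w e; clear; lra.
Qed.

Lemma first_arcs_total U : open U ->
  (mu (\bigcup_k first_arcs U k) <= (81 / 4)%:E * lam U)%E.
Proof.
move=> oU; have mU : measurable U by exact: open_measurable.
have mP k : measurable (first_arcs U k).
  by apply: bigsetU_measurable => i _; exact: measurable_parc_cell.
apply: le_trans (_ : \sum_(0 <= k <oo) mu (first_arcs U k) <= _)%E.
  by apply: measure_sigma_subadditive => //; exact: bigcupT_measurable.
apply: le_trans (_ : \sum_(0 <= k <oo) ((81 / 4)%:E * lam (first_cells U k)) <= _)%E.
  apply: lee_nneseries => k _ => [//|]; exact: first_arcs_measure.
rewrite nneseriesZl; last by move=> k _; exact: measure_ge0.
apply: lee_wpmul2l; first by rewrite lee_fin.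
rewrite -measure_semi_bigcup//.
- apply: le_measure; rewrite ?inE//.
    by apply: bigcupT_measurable => k; exact: measurable_first_cells.
  by apply: bigcup_sub => k _; exact: first_cells_sub.
- by move=> k; exact: measurable_first_cells.
- exact: first_cells_disjoint.
- by apply: bigcupT_measurable => k; exact: measurable_first_cells.
Qed.

(** A point that is outside infinitely many levels lies in light cells of
    arbitrarily small size, hence in the cover drawn from any neighbourhood. *)
Lemma light_cover U t : open U -> 0 <= t < 2 * pi -> U t ->
  (forall n, ~ En mu n (pt t)) -> exists k, first_arcs U k (pt t).
Proof.
move=> oU t2 Ut nE.
have : nbhs t U by exact: open_nbhs_nbhs.
move=> [e /= e0 He].
have [n ne] : exists n, wid n < e :> R.
  have [n hn] := pow2_below (divr_gt0 e0 (ltr0n _ 8)).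
  exists n; apply: lt_le_trans (wid_lt8 n) _.
  by rewrite mulrC -ler_pdivlMr.
have [k nk nl] : exists2 k, (n <= k)%N & ~ level mu k (pt t).
  apply: contrapT => H; apply: (nE n) => k /= nk.
  by apply: contrapT => nl; apply: H; exists k.
have M : exists k, `[< exists2 i, light_in U k i & cell k i t >].
  exists k; apply/asboolP; have [i ik ti] := cell_exists k t2.
  have ct : wid k * i%:R <= t < wid k * i%:R + wid k.
    by move: ti; rewrite /cell/= in_itv/= cell_len.
  exists i => //; apply/asboolP; split => //.
    move=> hv; apply: nl; exists i => //; exists t => //=.
    by rewrite in_itv/=; case/andP: ct => -> /ltW.
  move=> s; rewrite /cell/= in_itv/= cell_len => sc; apply: He.
  have wk : wid k <= wid n :> R.
    by rewrite ler_wpM2l ?(ltW (two_pi_gt0))// lef_pV2 ?posrE ?exprn_gt0// ler_weXn2l// ler1n.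
  rewrite /ball_/= ltr_distl; move: ct sc wk ne; set a : R := wid k * i%:R.
  set w : R := wid k; set w' : R := wid n; clearbody a w w'; clear.
  by move=> /andP[? ?] /andP[? ?] ? ?; apply/andP; split; lra.
(* The coarsest light cell around t meets no coarser light cell, since dyadic
   cells are nested. *)
have [m /asboolP[i li ti] mmin] := ex_minnP M.
have /asboolP[im _ _] := li.
exists m; rewrite /first_arcs.
apply/(@in_ord_union _ (2 ^ m) (first_light U m) (fun i => parc (cell m i))).
exists i; split => //; last by exists t.
apply/andP; split => //; apply/asboolP => k' i' lt li'.
apply/seteqP; split => // s [s1 s2].
have [i'' _ ti''] := cell_exists k' t2.
have mE : m = (k' + (m - k'))%N by rewrite subnKC// ltnW.
rewrite mE in s1 ti.
have e1 := cell_coarser s1 s2; have e2 := cell_coarser ti ti''.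
have : (m <= k')%N by apply: mmin; apply/asboolP; exists i' => //; rewrite e1 -e2.
by rewrite leqNgt lt.
Qed.

(** The carrier is covered by open sets of arbitrarily small length. By
    light_cover the part outside all E_n has mass at most a multiple of that
    length. *)
Lemma singular_carried : singular mu -> supported_on mu (\bigcup_n En mu n).
Proof.
move=> [N [mN Nc N0 muN]].
have mE n : measurable (En mu n) by apply: closed_plane_measurable; exact: closed_En.
have mUE : measurable (\bigcup_n En mu n) by exact: bigcupT_measurable.
have mC := @measurable_circle R.
have mA : measurable (N `\` \bigcup_n En mu n) by exact: measurableD.
suff A0 : mu (N `\` \bigcup_n En mu n) = 0%E.
  have B0 : mu ((circle `\` N) `|` (N `\` \bigcup_n En mu n)) = 0%E.
    by rewrite measureU0//; exact: measurableD.
  have mB : measurable ((circle `\` N) `|` (N `\` \bigcup_n En mu n)).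
    by apply: measurableU => //; exact: measurableD.
  apply/eqP; rewrite eq_le measure_ge0 andbT -[leRHS]B0.
  apply: le_measure; rewrite ?inE//; first exact: measurableD.
  by move=> p [cp nE]; case: (pselect (N p)) => h; [right|left].
apply/eqP; rewrite eq_le measure_ge0 andbT; apply/lee_addgt0Pr => e e0.
rewrite add0e.
have l0 : (lam (angles N) < +oo)%E by rewrite [lam _]N0.
(* 21 exceeds 81 / 4, the largest mass per unit length of a light arc. *)
have [U [oU NU lU]] := lebesgue_regularity_outer (measurable_angles mN) l0 (divr_gt0 e0 (ltr0n _ 21)).
have lUe : (lam U <= (e / 21)%:E)%E.
  have -> : U = angles N `|` (U `\` angles N) by rewrite setDUK.
  apply: le_trans (measureU2 _ _ _) _.
  - exact: measurable_angles.
  - by apply: measurableD; [exact: open_measurable|exact: measurable_angles].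
  - by rewrite -[X in (X + _)%E]/(arc_length N) N0 add0e; exact: ltW.
apply: (@le_trans _ _ (mu (\bigcup_k first_arcs U k))).
  apply: le_measure; rewrite ?inE//.
    by apply: bigcupT_measurable => k; apply: bigsetU_measurable => i _; exact: measurable_parc_cell.
  move=> p [Np nE]; have [t t2 pE] := circle_ptP (Nc _ Np).
  have Ut : U t by apply: NU; split => //; rewrite -pE.
  have [n|k h] := light_cover oU t2 Ut.
    by rewrite -pE => h; apply: nE; exists n.
  by exists k => //; rewrite pE.
apply: le_trans (first_arcs_total oU) _.
apply: le_trans (lee_wpmul2l _ lUe) _; first by rewrite lee_fin.
by rewrite -EFinM lee_fin; move: e0; clear; lra.
Qed.

(** The bad sums of level 1 are finite, hence every E_n has integrable depth. *)
Lemma area_condition_carried : singular mu -> area_condition (singular_inner mu) ->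
  exists E : nat -> set (plane R), (forall n, Beurling_Carleson (E n)) /\
    supported_on mu (\bigcup_n E n).
Proof.
move=> sing area; exists (En mu); split; last exact: singular_carried.
have [B HB] := badsum_of_area ltr01 area.
move=> n; have fin : (\int[lam]_(t in turn) depth (En mu n) t < +oo)%E.
  by apply: le_lt_trans (depth_En_fin n HB) _; rewrite ltry.
have cE := @closed_En R mu n.
by apply: BC_of_depth => //; [exact: En_circle|exact: angles_null_of_depth].
Qed.

End LightCover.

(** * Circular means of subharmonic functions *)

Section CircularMeans.
Context {R : realType}.
Implicit Types (s t : R).
Local Notation lam := (@lebesgue_measure R).

Lemma continuous_itv_integrable (f : R -> R) (a b : R) : continuous f ->
  lam.-integrable `[a, b] (EFin \o f).
Proof.
move=> cf; apply: continuous_compact_integrable; first exact: segment_compact.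
exact: continuous_subspaceT.
Qed.

(** Differentiation under the integral, with a dominating constant. *)
Lemma is_derive_integral (f f1 : R -> R -> R) (a b s0 s1 C : R) : s0 < s1 ->
  (forall s t, s < s1 -> is_derive s 1 (f^~ t) (f1 s t)) ->
  (forall s, s < s1 -> continuous (f s)) ->
  (forall s t, s < s1 -> `|f1 s t| <= C) ->
  is_derive s0 1 (fun s => \int[lam]_(t in `[a, b]) f s t)
    (\int[lam]_(t in `[a, b]) f1 s0 t).
Proof.
move=> s01 df cf bf.
have mI : measurable (`[a, b]%classic : set R) by exact: measurable_itv.
have Ia : `]s0 - 1, s1[%classic s0 by rewrite /= in_itv/= s01 andbT ltrBlDr ltrDl.
have inI s : `]s0 - 1, s1[%classic s -> s < s1 by rewrite /= in_itv/= => /andP[].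
have C0 : 0 <= C by apply: le_trans (bf s0 0 s01).
have intf s : `]s0 - 1, s1[%classic s -> lam.-integrable `[a, b] (EFin \o f s).
  by move=> /inI /cf; exact: continuous_itv_integrable.
have der s t : `]s0 - 1, s1[%classic s -> `[a, b]%classic t -> derivable (f^~ t) s 1.
  by move=> /inI ss _; have [] := df s t ss.
have intC : lam.-integrable `[a, b] (EFin \o (fun=> C)).
  by apply: continuous_itv_integrable => x; exact: cvg_cst.
have pE s t : s < s1 -> partial1of2 f s t = f1 s t.
  by move=> ss; rewrite partial1of2E; have [_ ->] := df s t ss.
have bnd s t : `]s0 - 1, s1[%classic s -> `[a, b]%classic t -> `|partial1of2 f s t| <= C.
  by move=> /inI ss _; rewrite pE//; exact: bf.
split.
  apply: (@derivable_under_integral R _ _ lam f _ mI s0 (s0 - 1) s1 Ia) intf der _ (fun=> C0) intC bnd.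
rewrite -derive1E.
rewrite (@differentiation_under_integral R _ _ lam f _ mI s0 (s0 - 1) s1 Ia intf der _ (fun=> C0) intC bnd).
by apply: eq_Rintegral => t _; exact: pE.
Qed.

Lemma integral_periodic_derive (V V' : R -> R) (a b : R) : a < b ->
  (forall t, is_derive t 1 V (V' t)) -> continuous V' -> V a = V b ->
  \int[lam]_(t in `[a, b]) V' t = 0.
Proof.
move=> ab dV cV' Vab.
have cV : continuous V by move=> t; exact: is_derive_continuous (dV t).
rewrite /Rintegral (@continuous_FTC2 _ V' V a b ab).
- by rewrite Vab subee.
- exact: continuous_subspaceT.
- split.
  + by move=> t _; have [] := dV t.
  + by apply: cvg_at_right_filter; exact: cV.
  + by apply: cvg_at_left_filter; exact: cV.
- by move=> t _; rewrite derive1E; have [_ ->] := dV t.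
Qed.

(** In logarithmic polar coordinates the circular means of a subharmonic
    function are convex in the logarithm of the radius: the angular second
    derivative integrates to zero by periodicity. Being bounded as the radius
    shrinks, they are nondecreasing. *)
Lemma subharmonic_mean (U U1 U2 V1 V2 : R -> R -> R) (s1 C u0 : R) : 0 < s1 ->
  (forall s t, s < s1 -> is_derive s 1 (U^~ t) (U1 s t)) ->
  (forall s t, s < s1 -> is_derive s 1 (U1^~ t) (U2 s t)) ->
  (forall s t, s < s1 -> is_derive t 1 (V1 s) (V2 s t)) ->
  (forall s, s < s1 -> continuous (U s) /\ continuous (U1 s)) ->
  (forall s, s < s1 -> continuous (U2 s) /\ continuous (V2 s)) ->
  (forall s t, s < s1 -> `|U1 s t| <= C /\ `|U2 s t| <= C) ->
  (forall s, s < s1 -> V1 s (- pi) = V1 s pi) ->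
  (forall s t, s < s1 -> 0 <= U2 s t + V2 s t) ->
  (forall s t, s < s1 -> U s t <= C) ->
  (forall e, 0 < e -> exists2 s, s <= 0 & forall t, u0 - e <= U s t) ->
  2 * pi * u0 <= \int[lam]_(t in `[- pi, pi]) U 0 t.
Proof.
move=> s10 dU dU1 dV1 c01 c22 bC per pos ubd small.
have p0 := @pi_gt0 R.
have pp : - pi < pi :> R by rewrite gtrN.
pose M s := \int[lam]_(t in `[- pi, pi]) U s t.
pose M1 s := \int[lam]_(t in `[- pi, pi]) U1 s t.
have mI : measurable (`[- pi, pi]%classic : set R) by exact: measurable_itv.
have dM s : s < s1 -> is_derive s 1 M (M1 s).
  move=> ss; apply: (@is_derive_integral U U1 _ _ _ s1 C) => //.
    by move=> x /c01 [].
  by move=> x t xs; have [] := bC x t xs.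
have dM1 s : s < s1 -> is_derive s 1 M1 (\int[lam]_(t in `[- pi, pi]) U2 s t).
  move=> ss; apply: (@is_derive_integral U1 U2 _ _ _ s1 C) => //.
    by move=> x /c01 [].
  by move=> x t xs; have [] := bC x t xs.
have M2 s : s < s1 -> 0 <= \int[lam]_(t in `[- pi, pi]) U2 s t.
  move=> ss; have [c2 cv] := c22 s ss.
  have I0 : \int[lam]_(t in `[- pi, pi]) V2 s t = 0.
    by apply: (integral_periodic_derive pp) (cv) (per s ss) => t; exact: dV1.
  rewrite -[leRHS]addr0 -[X in _ + X]I0.
  rewrite -RintegralD//; try exact: continuous_itv_integrable.
  by apply: Rintegral_ge0 => t _; exact: pos.
have M1_mono x y : x <= y -> y <= 0 -> M1 x <= M1 y.
  move=> xy y0.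
  apply: (@ger0_derive1_ndecrNy _ M1 0) => //.
  - by move=> z; rewrite in_itv/= => z0; have [] := dM1 z (lt_trans z0 s10).
  - move=> z; rewrite in_itv/= => z0; rewrite derive1E.
    by have [_ ->] := dM1 z (lt_trans z0 s10); apply: M2; exact: lt_trans s10.
  - apply: derivable_within_continuous => z; rewrite in_itv/= => z0.
    by have [] := dM1 z (le_lt_trans z0 s10).
have cM x y : y <= 0 -> {within `[x, y], continuous M}.
  move=> y0; apply: derivable_within_continuous => z; rewrite in_itv/= => /andP[_ zy].
  by have [] := dM z (le_lt_trans (le_trans zy y0) s10).
have MVTM x y : x < y -> y <= 0 -> exists2 c, c \in `]x, y[ & M y - M x = M1 c * (y - x).
  move=> xy y0; apply: MVT => //; last exact: cM.
  move=> z; rewrite in_itv/= => /andP[_ zy].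
  by apply: dM; apply: lt_le_trans zy _; apply: le_trans y0 (ltW s10).
have Mub s : s < s1 -> M s <= 2 * pi * C.
  move=> ss; have [cU _] := c01 s ss.
  have -> : 2 * pi * C = \int[lam]_(t in `[- pi, pi]) C.
    rewrite Rintegral_cst//= lebesgue_measure_itv/= lte_fin pp -EFinB/=; ring.
  apply: le_Rintegral => //; first exact: continuous_itv_integrable.
    by apply: continuous_itv_integrable => x; exact: cvg_cst.
  by move=> t _; exact: ubd.
have M1_ge0 s : s <= 0 -> 0 <= M1 s.
  move=> s0; rewrite leNgt; apply/negP => neg.
  pose k := (2 * pi * C - M s + 1) / - M1 s.
  have k0 : 0 < k.
    rewrite divr_gt0 ?oppr_gt0//.
    by have := Mub s (le_lt_trans s0 s10); lra.
  have [|c] := MVTM (s - k) s _ s0; first by rewrite ltrBlDr ltrDl.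
  rewrite in_itv/= => /andP[_ cs] E.
  have h1 : M1 c <= M1 s by apply: M1_mono => //; exact: ltW.
  have h2 : M s - M (s - k) <= M1 s * k.
    by rewrite E opprB addrCA subrr addr0 ler_wpM2r// ltW.
  have h3 : M1 s * k = - (2 * pi * C - M s + 1).
    by rewrite /k; field; move: neg; exact: ltr0_neq0.
  have := Mub (s - k) (lt_trans (_ : s - k < 0) s10).
  have sk : s - k < 0 by lra.
  by move=> /(_ sk); lra.
have M_mono s : s <= 0 -> M s <= M 0.
  rewrite le_eqVlt => /orP[/eqP ->//|s0].
  have [c] := MVTM s 0 s0 (lexx _); rewrite in_itv/= => /andP[_ c0] E.
  by rewrite -subr_ge0 E mulr_ge0 ?M1_ge0 ?subr_ge0// ltW.
apply/ler_addgt0Pr => e e0; have ee : 0 < e / (2 * pi) by rewrite divr_gt0// two_pi_gt0.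
have [s s0 Hs] := small _ ee.
apply: le_trans (_ : M s + e <= _); last by rewrite lerD2r; exact: M_mono.
have ss := le_lt_trans s0 s10; have [cU _] := c01 s ss.
have -> : 2 * pi * u0 = \int[lam]_(t in `[- pi, pi]) (u0 - e / (2 * pi)) + e.
  rewrite Rintegral_cst//= lebesgue_measure_itv/= lte_fin pp -EFinB/= opprK.
  have pn : (pi : R) != 0 by rewrite gt_eqF.
  suff arith (x y z : R) : x != 0 -> 2 * x * y = (y - z / (2 * x)) * (x + x) + z by exact: arith.
  by move=> xn; field.
rewrite lerD2r; apply: le_Rintegral => //; last exact: continuous_itv_integrable.
by apply: continuous_itv_integrable => x; exact: cvg_cst.
Qed.
End CircularMeans.

(** * Subharmonicity of log (1 + |h|^2) *)

Section LogMean.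
Context {R : realType}.
Implicit Types (s t : R) (z : R[i]).
Local Notation lam := (@lebesgue_measure R).

Lemma continuous_addf (f g : R -> R) : continuous f -> continuous g ->
  continuous (fun t => f t + g t).
Proof. by move=> cf cg t; apply: cvgD; [exact: cf|exact: cg]. Qed.

Lemma continuous_mulf (f g : R -> R) : continuous f -> continuous g ->
  continuous (fun t => f t * g t).
Proof. by move=> cf cg t; apply: cvgM; [exact: cf|exact: cg]. Qed.

Lemma continuous_oppf (f : R -> R) : continuous f -> continuous (fun t => - f t).
Proof. by move=> cf t; apply: cvgN; exact: cf. Qed.

Lemma continuous_cstf (c : R) : continuous (fun _ : R => c).
Proof. by move=> t; exact: cvg_cst. Qed.

Lemma continuous_invf (f : R -> R) : (forall t, f t != 0) -> continuous f ->
  continuous (fun t => (f t)^-1).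
Proof. by move=> f0 cf t; apply: cvgV => //; exact: cf. Qed.

Lemma is_derive_sum2 (a b c d : R -> R) t (a' b' c' d' : R) :
  is_derive t 1 a a' -> is_derive t 1 b b' -> is_derive t 1 c c' -> is_derive t 1 d d' ->
  is_derive t 1 (fun x => a x * c x + b x * d x)
    (a' * c t + a t * c' + (b' * d t + b t * d')).
Proof.
move=> Da Db Dc Dd.
have H : is_derive t 1 (a * c + b * d) (a t *: c' + c t *: a' + (b t *: d' + d t *: b')).
  by apply: is_deriveD.
by apply: is_derive_eq H _; rewrite /GRing.scale/=; ring.
Qed.

Lemma is_derive_quot (N D : R -> R) t (N' D' : R) : D t != 0 ->
  is_derive t 1 N N' -> is_derive t 1 D D' ->
  is_derive t 1 (fun x => N x / D x) (N' / D t - N t * D' / D t ^+ 2).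
Proof.
move=> D0 DN DD.
have H : is_derive t 1 (N * (fun x => (D x)^-1)) (N t *: (- (D t) ^- 2 *: D') + (D t)^-1 *: N').
  by apply: is_deriveM; exact: is_deriveV.
by apply: is_derive_eq H _; rewrite /GRing.scale/=; field.
Qed.

(** Written with products in order that the derivative rules apply directly. *)
Definition sq1 (a b : R) : R := 1 + (a * a + b * b).

Lemma sq1_ge1 a b : 1 <= sq1 a b.
Proof. by rewrite lerDl -!expr2 addr_ge0// sqr_ge0. Qed.

Lemma sq1_gt0 a b : 0 < sq1 a b.
Proof. exact: lt_le_trans (sq1_ge1 _ _). Qed.

Lemma is_derive_sq1 (a b : R -> R) t (a' b' : R) :
  is_derive t 1 a a' -> is_derive t 1 b b' ->
  is_derive t 1 (fun x => sq1 (a x) (b x)) (2 * (a t * a' + b t * b')).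
Proof.
move=> Da Db; have H := is_derive_sum2 Da Db Da Db.
have H2 : is_derive t 1 (cst 1 + (fun x => a x * a x + b x * b x))
   (0 + (a' * a t + a t * a' + (b' * b t + b t * b'))) by apply: is_deriveD.
by apply: is_derive_eq H2 _; ring.
Qed.

Lemma is_derive_log (a b : R -> R) t (a' b' : R) :
  is_derive t 1 a a' -> is_derive t 1 b b' ->
  is_derive t 1 (fun x => ln (sq1 (a x) (b x))) (2 * ((a t * a' + b t * b') / sq1 (a t) (b t))).
Proof.
move=> Da Db; have H := is_derive_sq1 Da Db.
have L := is_derive1_ln (sq1_gt0 (a t) (b t)).
have H2 := @is_derive1_comp R (@ln R) (fun x => sq1 (a x) (b x)) t _ _ L H.
by apply: is_derive_eq H2 _; rewrite mulrC; ring.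
Qed.

Lemma is_derive_logder (p q c d a b : R -> R) t (p' q' c' d' a' b' : R) :
  is_derive t 1 p p' -> is_derive t 1 q q' -> is_derive t 1 c c' -> is_derive t 1 d d' ->
  is_derive t 1 a a' -> is_derive t 1 b b' ->
  is_derive t 1 (fun x => 2 * ((p x * c x + q x * d x) / sq1 (a x) (b x)))
    (2 * ((p' * c t + p t * c' + (q' * d t + q t * d')) / sq1 (a t) (b t)
      - (p t * c t + q t * d t) * (2 * (a t * a' + b t * b')) / sq1 (a t) (b t) ^+ 2)).
Proof.
move=> Dp Dq Dc Dd Da Db.
have Dn : sq1 (a t) (b t) != 0 by rewrite gt_eqF// sq1_gt0.
have H := @is_derive_quot (fun x => p x * c x + q x * d x) (fun x => sq1 (a x) (b x)) t _ _ Dn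
  (is_derive_sum2 Dp Dq Dc Dd) (is_derive_sq1 Da Db).
exact: (is_deriveZ 2 H).
Qed.

Lemma quot_bound (x d y : R) : 1 <= d -> `|x| <= y -> `|x / d| <= y.
Proof.
move=> d1 xy; have d0 : 0 < d by lra.
have y0 : 0 <= y := le_trans (normr_ge0 _) xy.
by rewrite normrM normfV (gtr0_norm d0) ler_pdivrMr//; apply: le_trans xy _; rewrite ler_peMr.
Qed.

Lemma sum2_bound (a b c d C : R) : `|a| <= C -> `|b| <= C -> `|c| <= C -> `|d| <= C ->
  `|a * c + b * d| <= 2 * C ^+ 2.
Proof.
move=> ha hb hc hd; apply: le_trans (ler_normD _ _) _; rewrite !normrM.
have -> : 2 * C ^+ 2 = C * C + C * C by ring.
by apply: lerD; apply: ler_pM.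
Qed.

(** Here h = a + i b has first and second derivatives c + i d and e + i f with
    respect to s + i t, and the Cauchy-Riemann equations have been substituted in
    the two second derivatives of log (1 + |h|^2). The terms with e and f cancel
    and 4 |h'|^2 / (1 + |h|^2)^2 remains. *)
Lemma laplacian_ge0 (a b c d e f : R) :
  0 <= 2 * ((c * c + a * e + (d * d + b * f)) / sq1 a b - (a * c + b * d) * (2 * (a * c + b * d)) / sq1 a b ^+ 2) +
       2 * ((c * c - b * f + (d * d - a * e)) / sq1 a b - (b * c - a * d) * (2 * (b * c - a * d)) / sq1 a b ^+ 2).
Proof.
have D0 : sq1 a b != 0 by rewrite gt_eqF// sq1_gt0.
have -> : 2 * ((c * c + a * e + (d * d + b * f)) / sq1 a b - (a * c + b * d) * (2 * (a * c + b * d)) / sq1 a b ^+ 2) +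
       2 * ((c * c - b * f + (d * d - a * e)) / sq1 a b - (b * c - a * d) * (2 * (b * c - a * d)) / sq1 a b ^+ 2) =
   4 * (c ^+ 2 + d ^+ 2) / sq1 a b ^+ 2.
  by move: D0; rewrite /sq1 => D0; field.
by rewrite divr_ge0 ?mulr_ge0 ?addr_ge0 ?sqr_ge0// exprn_ge0// ltW// sq1_gt0.
Qed.

Lemma cmod_sq1 z : sq1 (Re z) (Im z) = 1 + cmod z ^+ 2.
Proof. by rewrite /sq1 cmod_sqr -!expr2. Qed.

(** The Laplacian of log (1 + |h|^2) is 4 |h'|^2 / (1 + |h|^2)^2 >= 0. Three
    derivatives of h are required because the Laplacian has to be continuous. *)
Lemma log_mean (h h1 h2 : R[i] -> R[i]) (rho B : R) : 1 < rho ->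
  (forall z, cmod z < rho -> [/\ cder h z (h1 z), cder h1 z (h2 z) & exists d, cder h2 z d]) ->
  (forall z, cmod z < rho -> [/\ cmod (h z) <= B, cmod (h1 z) <= B & cmod (h2 z) <= B]) ->
  2 * pi * ln (1 + cmod (h 0) ^+ 2) <=
  \int[lam]_(t in `[- pi, pi]) ln (1 + cmod (h (expi t)) ^+ 2).
Proof.
move=> rho1 hd hb; have r0 : 0 < rho by lra.
pose s1 := ln rho; have s10 : 0 < s1 by rewrite ln_gt0.
have zin s t : s < s1 -> cmod (pol s t) < rho.
  by move=> ss; rewrite cmod_pol -(lnK (x := rho)) ?posrE// ltr_expR.
have B0 : 0 <= B by have [h0 _ _] := hb 0 ltac:(by rewrite cmod0); apply: le_trans h0; exact: cmod_ge0.
pose F z := h1 z * z; pose G z := (h2 z * z + h1 z) * z.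
have dF z : cmod z < rho -> cder F z (h2 z * z + h1 z).
  move=> zr; have [_ d1 _] := hd z zr.
  by apply: cder_eq (cderM d1 (cder_id z)) _; rewrite mulr1.
have dG z : cmod z < rho -> exists d, cder G z d.
  move=> zr; have [_ d1 [d d2]] := hd z zr; eexists.
  exact: (cderM (cderD (cderM d2 (cder_id z)) d1) (cder_id z)).
pose C0 := (B * rho + B) * rho + B.
have Bh z : cmod z < rho -> cmod (h z) <= C0.
  move=> zr; have [+ _ _] := hb z zr; move=> hB; apply: le_trans hB _.
  by rewrite lerDr !mulr_ge0 ?addr_ge0 ?mulr_ge0// ltW.
have BF z : cmod z < rho -> cmod (F z) <= C0.
  move=> zr; have [_ h1B _] := hb z zr; rewrite cmodM.
  apply: le_trans (_ : B * rho <= _); first by apply: ler_pM; rewrite ?cmod_ge0// ltW.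
  by rewrite /C0 mulrDl -addrA addrCA lerDl !addr_ge0 ?mulr_ge0// ltW.
have BG z : cmod z < rho -> cmod (G z) <= C0.
  move=> zr; have [_ h1B h2B] := hb z zr; rewrite cmodM.
  apply: le_trans (_ : (B * rho + B) * rho <= _); last by rewrite lerDl.
  apply: ler_pM; rewrite ?cmod_ge0//; last exact: ltW.
  apply: le_trans (cmodD _ _) _; apply: lerD => //; rewrite cmodM.
  by apply: ler_pM; rewrite ?cmod_ge0// ltW.
pose a s t := Re (h (pol s t)); pose b s t := Im (h (pol s t)).
pose c s t := Re (F (pol s t)); pose d s t := Im (F (pol s t)).
pose e s t := Re (G (pol s t)); pose f s t := Im (G (pol s t)).
have vh1 s t : s < s1 -> is_derive s 1 (a^~ t) (c s t) /\ is_derive s 1 (b^~ t) (d s t).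
  move=> ss; have [d0 _ _] := hd _ (zin s t ss); exact: (@vder_comp R h (fun x => pol x t) s _ _ d0 (vder_pol1 s t)).
have vF1 s t : s < s1 -> is_derive s 1 (c^~ t) (e s t) /\ is_derive s 1 (d^~ t) (f s t).
  move=> ss; exact: (@vder_comp R F (fun x => pol x t) s _ _ (dF _ (zin s t ss)) (vder_pol1 s t)).
have iRe (w z : R[i]) : Re (w * (z * 'i)) = - Im (w * z).
  by case: w => ? ?; case: z => ? ? /=; ring.
have iIm (w z : R[i]) : Im (w * (z * 'i)) = Re (w * z).
  by case: w => ? ?; case: z => ? ? /=; ring.
have vh2 s t : s < s1 -> is_derive t 1 (a s) (- d s t) /\ is_derive t 1 (b s) (c s t).
  move=> ss; have [d0 _ _] := hd _ (zin s t ss).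
  by have := @vder_comp R h (pol s) t _ _ d0 (vder_pol2 s t); rewrite /vder iRe iIm.
have vF2 s t : s < s1 -> is_derive t 1 (c s) (- f s t) /\ is_derive t 1 (d s) (e s t).
  move=> ss; have := @vder_comp R F (pol s) t _ _ (dF _ (zin s t ss)) (vder_pol2 s t).
  by rewrite /vder iRe iIm.
have vG2 s t : s < s1 -> {for t, continuous (e s)} /\ {for t, continuous (f s)}.
  move=> ss; have [g dg] := dG _ (zin s t ss).
  have [v1 v2] := @vder_comp R G (pol s) t _ _ dg (vder_pol2 s t).
  by split; [exact: is_derive_continuous v1|exact: is_derive_continuous v2].
pose D s t := sq1 (a s t) (b s t).
have D1 s t : 1 <= D s t := sq1_ge1 _ _.
have Dn s t : D s t != 0 by rewrite gt_eqF// sq1_gt0.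
pose U s t := ln (D s t).
pose N1 s t := a s t * c s t + b s t * d s t.
pose N2 s t := b s t * c s t - a s t * d s t.
pose U1 s t := 2 * (N1 s t / D s t).
pose V1 s t := 2 * (N2 s t / D s t).
pose U2 s t := 2 * ((c s t * c s t + a s t * e s t + (d s t * d s t + b s t * f s t)) / D s t
   - N1 s t * (2 * N1 s t) / D s t ^+ 2).
pose V2 s t := 2 * ((c s t * c s t - b s t * f s t + (d s t * d s t - a s t * e s t)) / D s t
   - N2 s t * (2 * N2 s t) / D s t ^+ 2).
have bnd s t : s < s1 -> [/\ `|a s t| <= C0, `|b s t| <= C0, `|c s t| <= C0, `|d s t| <= C0 &
    `|e s t| <= C0 /\ `|f s t| <= C0].
  move=> ss; have zr := zin s t ss.
  split; [| | | |split]; by [apply: le_trans (ler_Re_cmod _) _; auto|apply: le_trans (ler_Im_cmod _) _; auto].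
have cts s : s < s1 -> [/\ continuous (a s), continuous (b s), continuous (c s), continuous (d s) &
    continuous (e s) /\ continuous (f s)].
  move=> ss; split; [| | | |split] => t.
  - by have [v _] := vh2 s t ss; exact: is_derive_continuous v.
  - by have [_ v] := vh2 s t ss; exact: is_derive_continuous v.
  - by have [v _] := vF2 s t ss; exact: is_derive_continuous v.
  - by have [_ v] := vF2 s t ss; exact: is_derive_continuous v.
  - by have [v _] := vG2 s t ss.
  - by have [_ v] := vG2 s t ss.
have p20 : 0 <= C0 by apply: le_trans (Bh 0 _); rewrite ?cmod_ge0// cmod0.
have -> : \int[lam]_(t in `[- pi, pi]) ln (1 + cmod (h (expi t)) ^+ 2) =
          \int[lam]_(t in `[- pi, pi]) U 0 t.
  by apply: eq_Rintegral => t _; rewrite /U /D cmod_sq1 /pol expiE.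
apply: (@subharmonic_mean _ U U1 U2 V1 V2 s1 (16 * C0 ^+ 4 + 8 * C0 ^+ 2)) => //.
- by move=> s t ss; have [v1 v2] := vh1 s t ss; exact: is_derive_log.
- move=> s t ss; have [v1 v2] := vh1 s t ss; have [w1 w2] := vF1 s t ss.
  exact: (@is_derive_logder _ _ _ _ _ _ s _ _ _ _ _ _ v1 v2 w1 w2 v1 v2).
- move=> s t ss; have [v1 v2] := vh2 s t ss; have [w1 w2] := vF2 s t ss.
  have nv1 : is_derive t 1 (fun x => - a s x) (d s t).
    by have := is_deriveN v1; rewrite opprK.
  have := @is_derive_logder _ _ _ _ _ _ t _ _ _ _ _ _ v2 nv1 w1 w2 v1 v2.
  rewrite (_ : (fun x => 2 * ((b s x * c s x + - a s x * d s x) / sq1 (a s x) (b s x))) = V1 s); last first.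
    by apply/funext => x; rewrite /V1 /N2 mulNr.
  move=> H; apply: is_derive_eq H _.
  by rewrite /V2 /N2 -/(D s t); congr (2 * _); field.
- move=> s ss; have [ca cb cc cd [ce cf]] := cts s ss.
  have cD : continuous (D s).
    by apply: continuous_addf; [exact: continuous_cstf|apply: continuous_addf; exact: continuous_mulf].
  split.
    by move=> t; apply: continuous_comp; [exact: cD|apply: continuous_ln; exact: sq1_gt0].
  apply: continuous_mulf; first exact: continuous_cstf.
  apply: continuous_mulf; last exact: continuous_invf.
  by apply: continuous_addf; exact: continuous_mulf.
- move=> s ss; have [ca cb cc cd [ce cf]] := cts s ss.
  have cD : continuous (D s).
    by apply: continuous_addf; [exact: continuous_cstf|apply: continuous_addf; exact: continuous_mulf].
  have cD2 : continuous (fun t => (D s t ^+ 2)^-1).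
    apply: continuous_invf; first by move=> t; rewrite expf_neq0.
    exact: (continuous_mulf cD cD).
  have cN1 : continuous (N1 s) by apply: continuous_addf; exact: continuous_mulf.
  have cN2 : continuous (N2 s).
    by apply: continuous_addf; [exact: continuous_mulf|apply: continuous_oppf; exact: continuous_mulf].
  have cQ (X N : R -> R) : continuous X -> continuous N ->
      continuous (fun t => 2 * (X t / D s t - N t * (2 * N t) / D s t ^+ 2)).
    move=> cX cN; have cDi := continuous_invf (Dn s) cD.
    have c2N := continuous_mulf (@continuous_cstf 2) cN.
    apply: (continuous_mulf (@continuous_cstf 2)).
    apply: (continuous_addf (continuous_mulf cX cDi)).
    exact: (continuous_oppf (continuous_mulf (continuous_mulf cN c2N) cD2)).
  have cm := continuous_mulf.
  split.
    apply: (cQ (fun t => c s t * c s t + a s t * e s t + (d s t * d s t + b s t * f s t)) (N1 s)) => //.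
    apply: continuous_addf; apply: continuous_addf; exact: cm.
  apply: (cQ (fun t => c s t * c s t - b s t * f s t + (d s t * d s t - a s t * e s t)) (N2 s)) => //.
  by apply: continuous_addf; (apply: continuous_addf; [exact: cm|apply: continuous_oppf; exact: cm]).
- move=> s t ss; have [ha hb' hc hd' [he hf]] := bnd s t ss.
  have n1 : `|N1 s t| <= 2 * C0 ^+ 2 by exact: sum2_bound.
  have q1 : `|N1 s t / D s t| <= 2 * C0 ^+ 2 by exact: quot_bound.
  have c4 : 0 <= C0 ^+ 4 by exact: exprn_ge0.
  have c2 : 0 <= C0 ^+ 2 by exact: exprn_ge0.
  split.
    rewrite normrM ger0_norm//; move: q1 c4 c2; move: (`| _ |) (C0 ^+ 4) (C0 ^+ 2); clear.
    by move=> *; lra.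
  rewrite normrM ger0_norm//.
  apply: le_trans (_ : 2 * ((2 * C0 ^+ 2 + 2 * C0 ^+ 2) + 8 * C0 ^+ 4) <= _); last first.
    by move: c4 c2; move: (C0 ^+ 4) (C0 ^+ 2); clear; move=> *; lra.
  rewrite ler_wpM2l//; apply: le_trans (ler_normB _ _) _; apply: lerD.
    apply: quot_bound => //; apply: le_trans (_ : `|(c s t * c s t + d s t * d s t) + (a s t * e s t + b s t * f s t)| <= _).
      by rewrite le_eqVlt; apply/orP; left; apply/eqP; congr `| _ |; ring.
    by apply: le_trans (ler_normD _ _) _; apply: lerD; exact: sum2_bound.
  have -> : N1 s t * (2 * N1 s t) / D s t ^+ 2 = 2 * (N1 s t / D s t) ^+ 2 by field.
  have -> : 8 * C0 ^+ 4 = 2 * (2 * C0 ^+ 2) ^+ 2 by ring.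
  by rewrite normrM ger0_norm// ler_wpM2l// normrX lerXn2r ?nnegrE// mulr_ge0.
- move=> s ss; rewrite /V1 /N2 /D /a /b /c /d.
  by have -> : pol s pi = pol s (- pi); [rewrite -(pol_periodic s (- pi)); congr pol; ring|].
- by move=> s t ss; exact: laplacian_ge0.
- move=> s t ss; have [ha hb' _ _ _] := bnd s t ss.
  have c4 : 0 <= C0 ^+ 4 by exact: exprn_ge0.
  have c2 : 0 <= C0 ^+ 2 by exact: exprn_ge0.
  apply: le_trans (_ : 2 * C0 ^+ 2 <= _).
    rewrite /U; apply: le_trans (_ : D s t - 1 <= _).
      have := le_ln1Dx (x := D s t - 1); rewrite (addrC 1) subrK; apply.
      by have := D1 s t; lra.
    rewrite /D /sq1 addrC addKr; apply: le_trans (ler_norm _) _; exact: sum2_bound.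
  by move: c4 c2; move: (C0 ^+ 4) (C0 ^+ 2); clear; move=> *; lra.
- move=> ep ep0; have [h0' _ _] := hd 0 ltac:(by rewrite cmod0).
  have ek : 0 < ep / (2 * C0 + 1) by rewrite divr_gt0// ltr_wpDl// mulr_ge0.
  have [k k0 Hk] := cder_continuous h0' ek.
  exists (Num.min 0 (ln (k / 2))); first by rewrite ge_min lexx.
  move=> t; set s := Num.min _ _; set z := pol s t.
  have zr : cmod z < rho.
    by apply: zin; apply: le_lt_trans s10; rewrite /s ge_min lexx.
  have zk : cmod z < k.
    rewrite cmod_pol; apply: le_lt_trans (_ : k / 2 < k); last by rewrite gtr_pMr//; lra.
    by rewrite -[leRHS]lnK ?posrE ?divr_gt0// ler_expR /s ge_min lexx orbT.
  have := Hk z zk; rewrite add0r => hz.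
  rewrite -[U s t]/(ln (sq1 (Re (h z)) (Im (h z)))) cmod_sq1.
  set x := cmod (h z); set y := cmod (h 0).
  have x0 : 0 <= x := cmod_ge0 _; have y0 : 0 <= y := cmod_ge0 _.
  have [xy|yx] := leP y x.
    rewrite lerBlDr; apply: le_trans (_ : ln (1 + x ^+ 2) <= _); last by rewrite lerDl ltW.
    by rewrite ler_ln ?posrE ?ltr_wpDr ?sqr_ge0// lerD2l lerXn2r.
  have xC : x <= C0 by exact: Bh.
  have yC : y <= C0 by apply: Bh; rewrite cmod0.
  have dxy : y - x < ep / (2 * C0 + 1).
    by apply: le_lt_trans hz; rewrite cmodBC; exact: cmod_dist.
  have L : ln (1 + y ^+ 2) - ln (1 + x ^+ 2) <= (1 + y ^+ 2) - (1 + x ^+ 2).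
    apply: ln_lipschitz; first by rewrite lerDl sqr_ge0.
    by rewrite lerD2l lerXn2r ?nnegrE// ltW.
  rewrite lerBlDr -lerBlDl; apply: le_trans L _.
  have -> : 1 + y ^+ 2 - (1 + x ^+ 2) = (y - x) * (x + y) by ring.
  apply: le_trans (_ : ep / (2 * C0 + 1) * (2 * C0 + 1) <= _).
    apply: ler_pM; [by rewrite subr_ge0 ltW|by rewrite addr_ge0|exact: ltW|].
    by move: xC yC; clear; lra.
  by rewrite divfK// gt_eqF// ltr_wpDl// mulr_ge0.
Qed.

End LogMean.

(** * The Poisson inequality *)

Section PoissonInequality.
Context {R : realType}.
Implicit Types (s t r : R) (z c : R[i]).
Local Notation lam := (@lebesgue_measure R).

Definition pden r t : R := 1 - 2 * r * cos t + r ^+ 2.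

(** The Poisson kernel at distance r from the centre. *)
Definition pker r t : R := (1 - r ^+ 2) / pden r t.

Lemma pdenE r t : pden r t = (1 - r * cos t) ^+ 2 + (r * sin t) ^+ 2.
Proof. by rewrite /pden exprMn sin2cos2; ring. Qed.

Lemma pden_ge r t : 0 <= r < 1 -> (1 - r) ^+ 2 <= pden r t.
Proof.
move=> /andP[r0 r1]; have := cos_le1 t; rewrite /pden; move: (cos t) => u u1.
rewrite -subr_ge0 (_ : _ - _ = 2 * r * (1 - u)); last by ring.
by rewrite !mulr_ge0// subr_ge0.
Qed.

Lemma pden_gt0 r t : 0 <= r < 1 -> 0 < pden r t.
Proof.
move=> r01; apply: lt_le_trans (pden_ge t r01).
by rewrite exprn_gt0// subr_gt0; case/andP: r01.
Qed.

Lemma pker_gt0 r t : 0 <= r < 1 -> 0 < pker r t.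
Proof.
move=> r01; rewrite divr_gt0 ?pden_gt0// subr_gt0 expr_lt1//; by case/andP: r01.
Qed.

(** The boundary values of the inverse of the disk automorphism
    (z + r) / (1 + r z), written as a change of angle. *)
Definition psub r t : R := t + 2 * atan (r * sin t / (1 - r * cos t)).

Lemma rcos_lt1 r t : 0 <= r < 1 -> 0 < 1 - r * cos t.
Proof.
move=> /andP[r0 r1]; rewrite subr_gt0; apply: le_lt_trans r1.
by rewrite -[leRHS]mulr1 ler_wpM2l// cos_le1.
Qed.

Lemma is_derive_psub r t : 0 <= r < 1 -> is_derive t 1 (psub r) (pker r t).
Proof.
move=> r01; have x0 := rcos_lt1 t r01; have xn : 1 - r * cos t != 0 by rewrite gt_eqF.
have D0 := pden_gt0 t r01.
have Ds : is_derive t 1 (fun x => r * sin x) (r * cos t).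
  by have := is_deriveZ r (is_derive_sin t).
have Dc : is_derive t 1 (fun x => 1 - r * cos x) (r * sin t).
  have H : is_derive t 1 (cst 1 - (r *: (@cos R))) (0 - r *: - sin t) by apply: is_deriveB.
  by apply: is_derive_eq H _; rewrite /GRing.scale/=; ring.
have Dq := @is_derive_quot R (fun x => r * sin x) (fun x => 1 - r * cos x) t _ _ xn Ds Dc.
have Da := @is_derive1_comp R (@atan R) (fun x => r * sin x / (1 - r * cos x)) t _ _ (is_derive1_atan _) Dq.
have H : is_derive t 1 (id + (2 *: (fun x => atan (r * sin x / (1 - r * cos x))))) _ :=
  is_deriveD (is_derive_id t 1) (is_deriveZ 2 Da).
apply: is_derive_eq H _; rewrite /GRing.scale/=.
have Dn : pden r t != 0 by rewrite gt_eqF.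
have e1 : 1 + (r * sin t / (1 - r * cos t)) ^+ 2 = pden r t / (1 - r * cos t) ^+ 2.
  by rewrite pdenE; field.
rewrite e1 /pker; have e2 : r * sin t * (r * sin t) = pden r t - (1 - r * cos t) ^+ 2.
  by rewrite pdenE; ring.
rewrite e2; move: Dn; rewrite /pden => Dn; field.
by rewrite Dn xn.
Qed.

(** The argument of 1 + i q is atan q, and the ratio of this number to its
    conjugate doubles the argument. *)
Lemma expi_atan (q : R) : expi (2 * atan q) * (1 +i* (- q)) = 1 +i* q.
Proof.
have c0 : cos (atan q) != 0 by rewrite cos_atan invr_eq0 gt_eqF// sqrtr_gt0 ltr_wpDr ?sqr_ge0.
have sE : sin (atan q) = q * cos (atan q).
  by have := atanK q; rewrite /tan => {2}<-; rewrite divfK.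
have c2 : cos (atan q) ^+ 2 * (1 + q ^+ 2) = 1.
  by rewrite -[RHS](cos2Dsin2 (atan q)) sE; ring.
rewrite mulrC [2 * _]mulr_natl mulr2n expiD /expi sE; apply/eqP; rewrite eq_complex/=.
move: c2; set k := cos _; clearbody k; clear => c2.
by apply/andP; split; apply/eqP; [rewrite -[RHS]c2; ring|transitivity (q * (k ^+ 2 * (1 + q ^+ 2))); [ring|by rewrite c2 mulr1]].
Qed.

(** psub is the angle of the image of e^it under z -> (z - r) / (1 - r z). *)
Lemma psub_rotation r t : 0 <= r < 1 ->
  expi (psub r t) * (1 - r%:C * expi t) = expi t - r%:C.
Proof.
move=> r01; have xn : 1 - r * cos t != 0 by rewrite gt_eqF ?rcos_lt1.
have := expi_atan (r * sin t / (1 - r * cos t)); set q := _ / _ => H.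
have e1 : 1 - r%:C * expi t = (1 - r * cos t)%:C * (1 +i* (- q)).
  by apply/eqP; rewrite eq_complex/= /q; apply/andP; split; apply/eqP; field.
have e2 : (1 - r * cos t)%:C * (1 +i* q) = 1 - r%:C * (cos t +i* (- sin t)).
  by apply/eqP; rewrite eq_complex/= /q; apply/andP; split; apply/eqP; field.
rewrite /psub expiD e1 [_%:C * _]mulrC mulrA -(mulrA (expi t)) -/q H mulrAC -mulrA e2.
have := cos2Dsin2 t; rewrite /expi; move: (cos t) (sin t) => u v uv.
apply/eqP; rewrite eq_complex/=; apply/andP; split; apply/eqP.
  by transitivity (u - r * (u ^+ 2 + v ^+ 2)); [ring|rewrite uv mulr1].
by ring.
Qed.

Lemma psub_Npi r : psub r (- pi) = - pi.
Proof. by rewrite /psub sinN sinpi oppr0 mulr0 mul0r atan0 mulr0 addr0. Qed.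

Lemma psub_pi r : psub r pi = pi.
Proof. by rewrite /psub sinpi mulr0 mul0r atan0 mulr0 addr0. Qed.

Lemma continuous_pker r : 0 <= r < 1 -> continuous (pker r).
Proof.
move=> r01; apply: continuous_mulf; first exact: continuous_cstf.
apply: continuous_invf; first by move=> t; rewrite gt_eqF ?pden_gt0.
apply: continuous_addf; last exact: continuous_cstf.
apply: continuous_addf; first exact: continuous_cstf.
apply: continuous_oppf; apply: continuous_mulf; first exact: continuous_cstf.
exact: continuous_cos.
Qed.

Lemma derive1_psub r : 0 <= r < 1 -> (psub r)^`()%classic = pker r.
Proof. by move=> r01; apply/funext => t; rewrite derive1E; have [_ ->] := is_derive_psub t r01. Qed.

Lemma continuous_psub r : 0 <= r < 1 -> continuous (psub r).
Proof. by move=> r01 t; exact: is_derive_continuous (is_derive_psub t r01). Qed.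

(** Change of variables along the disk automorphism: the Poisson kernel is the
    derivative of psub. *)
Lemma psub_integral r (G : R -> R) : 0 <= r < 1 -> continuous G ->
  \int[lam]_(t in `[- pi, pi]) G t = \int[lam]_(t in `[- pi, pi]) (pker r t * G (psub r t)).
Proof.
move=> r01 cG; have p0 := @pi_gt0 R; have pp : - pi < pi :> R by rewrite gtrN.
have ck := continuous_pker r01; have cs := continuous_psub r01.
have der t : derivable (psub r) t 1 by have [] := is_derive_psub t r01.
congr fine; rewrite -[X in `[X, _]](psub_Npi r) -[X in `[_, X]](psub_pi r).
rewrite integration_by_substitution_increasing.
- by rewrite psub_Npi psub_pi; apply: eq_integral => t _; rewrite derive1_psub//= mulrC.
- exact: ltW.
- apply: gtr0_derive1_lt_cc => //; last exact: continuous_subspaceT.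
  by move=> t _; rewrite derive1_psub// pker_gt0.
- by move=> t _; rewrite derive1_psub//; exact: ck.
- by rewrite derive1_psub//; apply/cvg_ex; exists (pker r (- pi)); apply: cvg_at_right_filter; exact: ck.
- by rewrite derive1_psub//; apply/cvg_ex; exists (pker r pi); apply: cvg_at_left_filter; exact: ck.
- split; first by move=> t _; exact: der.
  + by apply: cvg_at_right_filter; exact: cs.
  + by apply: cvg_at_left_filter; exact: cs.
- exact: continuous_subspaceT.
Qed.

Lemma cmod_moebius r z : cmod (z + r%:C) ^+ 2 =
  cmod (1 + r%:C * z) ^+ 2 + (1 - r ^+ 2) * (cmod z ^+ 2 - 1).
Proof. by case: z => x y; rewrite !cmod_sqr/=; ring. Qed.

(** The mean value inequality at the centre, transported to an arbitrary point
    by a disk automorphism: this is where the Poisson kernel comes from. *)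
Lemma poisson_log (g g1 g2 : R[i] -> R[i]) c r :
  (forall z, cmod z < 1 -> [/\ cder g z (g1 z), cder g1 z (g2 z) & exists d, cder g2 z d]) ->
  (forall q, 0 <= q < 1 -> exists B, forall z, cmod z <= q ->
     [/\ cmod (g z) <= B, cmod (g1 z) <= B & cmod (g2 z) <= B]) ->
  cmod c < 1 -> 0 <= r < 1 ->
  2 * pi * ln (1 + cmod (g (c * r%:C)) ^+ 2) <=
  \int[lam]_(t in `[- pi, pi]) (pker r t * ln (1 + cmod (g (c * expi t)) ^+ 2)).
Proof.
move=> gd gb c1 r01; have /andP[r0 r1] := r01; have c0 := cmod_ge0 c.
pose q := (1 + cmod c) / 2.
have q01 : 0 <= q < 1 by rewrite /q; apply/andP; split; lra.
have [B HB] := gb q q01; have q0 : 0 <= q by case/andP: q01.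
pose m := (1 - r) / 2; have m0 : 0 < m by rewrite /m; lra.
have m1 : m <= 1 / 2 by rewrite /m; lra.
(* an eta so small that the automorphism still maps |z| < 1 + eta into the
   disk of radius q / |c| *)
pose eta := m ^+ 2 * (1 - cmod c) / 3.
have eta0 : 0 < eta by rewrite /eta !mulr_gt0 ?exprn_gt0 ?subr_gt0.
have etam : eta <= m.
  have : m * (1 - cmod c) <= m * 1 by rewrite ler_wpM2l ?(ltW m0)// gerBl.
  have : m * (m * (1 - cmod c)) <= 1 / 2 * (m * (1 - cmod c)).
    by rewrite ler_wpM2r// mulr_ge0 ?(ltW m0)// subr_ge0 ltW.
  rewrite (_ : eta = m * (m * (1 - cmod c)) / 3); last by rewrite /eta; ring.
  by move: m0; set x := m * (1 - _); move: x; clear => x *; lra.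
pose den z := 1 + r%:C * z; pose phi z := (z + r%:C) / den z.
have den_lb z : cmod z < 1 + eta -> m <= cmod (den z).
  move=> zr; have := cmod_dist 1 (- (r%:C * z)); rewrite opprK cmod1 cmodN cmodM cmodR ger0_norm//.
  have h1 : r * cmod z <= r * (1 + eta) by rewrite ler_wpM2l// ltW.
  have h2 : r * eta <= 1 * eta by rewrite ler_wpM2r// ltW.
  move: h1 h2 etam; rewrite mulrDr mulr1 mul1r /den /m; move: (cmod (_ + _)) (r * cmod z) (r * eta).
  by clear; move=> *; lra.
have denn z : cmod z < 1 + eta -> den z != 0.
  by move=> /den_lb h; rewrite -cmod_gt0; exact: lt_le_trans h.
have phi_q z : cmod z < 1 + eta -> cmod (c * phi z) <= q.
  move=> zr; have zn := denn z zr; have dm := den_lb z zr.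
  have D0 : 0 < cmod (den z) by rewrite cmod_gt0.
  rewrite /phi !cmodM cmodV mulrA ler_pdivrMr// -(ler_pXn2r (n:=2)) ?nnegrE ?q0// ?(mulr_ge0 q0 (cmod_ge0 _)) ?(mulr_ge0 c0 (cmod_ge0 _))//.
  rewrite exprMn cmod_moebius -/(den z) exprMn.
  have z2 : cmod z ^+ 2 - 1 <= 3 * eta.
    have : cmod z ^+ 2 <= (1 + eta) ^+ 2 by rewrite lerXn2r ?nnegrE ?cmod_ge0 ?addr_ge0// ltW.
    have : eta * eta <= 1 * eta by rewrite ler_wpM2r ?(ltW eta0)//; lra.
    by rewrite (_ : (1 + eta) ^+ 2 = 1 + 2 * eta + eta * eta); [lra|ring].
  have h3 : (1 - r ^+ 2) * (cmod z ^+ 2 - 1) <= (1 - cmod c) * cmod (den z) ^+ 2.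
    apply: le_trans (_ : 1 * (3 * eta) <= _).
      apply: le_trans (_ : (1 - r ^+ 2) * (3 * eta) <= _).
        by rewrite ler_wpM2l// subr_ge0 expr_le1// ltW.
      by apply: ler_wpM2r; [rewrite mulr_ge0// ltW|rewrite gerBl sqr_ge0].
    rewrite mul1r (_ : 3 * eta = (1 - cmod c) * m ^+ 2); last by rewrite /eta; field.
    by rewrite ler_wpM2l ?subr_ge0 ?(ltW c1)// lerXn2r ?nnegrE// ltW.
  apply: le_trans (_ : cmod c ^+ 2 * (cmod (den z) ^+ 2 + (1 - cmod c) * cmod (den z) ^+ 2) <= _).
    by rewrite ler_wpM2l ?sqr_ge0// lerD2l.
  rewrite (_ : _ * (_ + _) = cmod c ^+ 2 * (2 - cmod c) * cmod (den z) ^+ 2); last by ring.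
  rewrite ler_wpM2r ?sqr_ge0// -subr_ge0 /q.
  rewrite (_ : _ - _ = (1 - cmod c) ^+ 2 * (1 + 4 * cmod c) / 4); last by field.
  by rewrite divr_ge0// mulr_ge0 ?sqr_ge0// addr_ge0// mulr_ge0.
have cphi z : cmod z < 1 + eta -> cmod (c * phi z) < 1.
  by move=> zr; apply: le_lt_trans (phi_q z zr) _; case/andP: q01.
pose k : R[i] := (1 - r ^+ 2)%:C.
pose p1 z := c * (k * (den z)^-1 ^+ 2).
pose p2 z := c * (k * (- 2 * r%:C * (den z)^-1 ^+ 3)).
have dden z : cder den z r%:C.
  by apply: cder_eq (cderD (cder_cst 1 z) (cderM (cder_cst r%:C z) (cder_id z))) _; ring.
have dinv z : cmod z < 1 + eta -> cder (fun x => (den x)^-1) z (- r%:C * (den z)^-1 ^+ 2).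
  by move=> /denn zn; apply: cder_eq (cderV zn (dden z)) _; rewrite exprVn.
have dphi z : cmod z < 1 + eta -> cder (fun x => c * phi x) z (p1 z).
  move=> zr; have zn := denn z zr.
  apply: cder_eq (cderM (cder_cst c z) (cderM (cderD (cder_id z) (cder_cst r%:C z)) (dinv z zr))) _.
  rewrite /p1 /k rmorphB rmorph1 rmorphXn /=; move: zn; rewrite /den => zn; by field.
have dp1 z : cmod z < 1 + eta -> cder p1 z (p2 z).
  move=> zr; have zn := denn z zr; have di := dinv z zr.
  apply: cder_eq (cderM (cder_cst c z) (cderM (cder_cst k z) (cderM di di))) _.
  by rewrite /p2; ring.
have dp2 z : cmod z < 1 + eta -> exists d, cder p2 z d.
  move=> zr; have di := dinv z zr; eexists.
  exact: (cderM (cder_cst c z) (cderM (cder_cst k z) (cderM (cder_cst (- 2 * r%:C) z) (cderM di (cderM di di))))).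
pose h z := g (c * phi z); pose h1 z := g1 (c * phi z) * p1 z.
pose h2 z := g2 (c * phi z) * p1 z * p1 z + g1 (c * phi z) * p2 z.
have hd z : cmod z < 1 + eta -> [/\ cder h z (h1 z), cder h1 z (h2 z) & exists d, cder h2 z d].
  move=> zr; have [d0 d1 [d d2]] := gd _ (cphi z zr); have dp := dphi z zr.
  have C0 := @cder_comp R g (fun x => c * phi x) z _ _ d0 dp.
  have C1 := @cder_comp R g1 (fun x => c * phi x) z _ _ d1 dp.
  have C2 := @cder_comp R g2 (fun x => c * phi x) z _ _ d2 dp.
  have P1 := dp1 z zr; have [e P2] := dp2 z zr.
  split => //; first exact: (cderM C1 P1).
  eexists; exact: (cderD (cderM (cderM C2 P1) P1) (cderM C1 P2)).
have B0 : 0 <= B.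
  by have [+ _ _] := HB 0 ltac:(by rewrite cmod0; case/andP: q01); apply: le_trans; exact: cmod_ge0.
have k1 : cmod k <= 1.
  rewrite cmodR ger0_norm; first by rewrite gerBl sqr_ge0.
  by rewrite subr_ge0 expr_le1// ltW.
have inv_b z : cmod z < 1 + eta -> cmod (den z)^-1 <= m^-1.
  by move=> /den_lb hz; rewrite cmodV lef_pV2 ?posrE//; exact: lt_le_trans hz.
have m1' : 0 <= m^-1 by rewrite invr_ge0 ltW.
pose Q := 1 + m^-1 ^+ 2 + 2 * m^-1 ^+ 3.
have Q1 : 1 <= Q by rewrite /Q -addrA lerDl addr_ge0 ?mulr_ge0 ?exprn_ge0.
have p1b z : cmod z < 1 + eta -> cmod (p1 z) <= Q.
  move=> /inv_b hz; rewrite /p1 cmodM cmodM cmodX.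
  apply: le_trans (_ : 1 * (1 * m^-1 ^+ 2) <= _).
    by apply: ler_pM; rewrite ?mulr_ge0 ?exprn_ge0 ?cmod_ge0// ?(ltW c1)//; apply: ler_pM; rewrite ?exprn_ge0 ?cmod_ge0//; apply: lerXn2r; rewrite ?nnegrE ?cmod_ge0.
  by rewrite !mul1r /Q -addrA addrCA lerDl addr_ge0 ?mulr_ge0 ?exprn_ge0.
have p2b z : cmod z < 1 + eta -> cmod (p2 z) <= Q.
  move=> /inv_b hz; rewrite /p2 cmodM cmodM cmodM cmodX cmodM cmodN cmodR ger0_norm//.
  have -> : cmod (2 : R[i]) = 2.
    by rewrite (_ : 2 = 2%:C :> R[i]) ?cmodR ?ger0_norm// rmorph_nat.
  apply: le_trans (_ : 1 * (1 * (2 * 1 * m^-1 ^+ 3)) <= _); last first.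
    by rewrite !mul1r mulr1 /Q lerDr addr_ge0 ?exprn_ge0.
  apply: ler_pM; rewrite ?mulr_ge0 ?exprn_ge0 ?cmod_ge0// ?(ltW c1)//.
  apply: ler_pM; rewrite ?mulr_ge0 ?exprn_ge0 ?cmod_ge0//.
  apply: ler_pM; rewrite ?mulr_ge0 ?exprn_ge0 ?cmod_ge0//; first by rewrite ler_wpM2l// ltW.
  by apply: lerXn2r; rewrite ?nnegrE ?cmod_ge0.
pose BB := B * Q * Q + B * Q.
have BQ0 : 0 <= B * Q by rewrite mulr_ge0// (le_trans ler01).
have hb z : cmod z < 1 + eta -> [/\ cmod (h z) <= BB, cmod (h1 z) <= BB & cmod (h2 z) <= BB].
  move=> zr; have [b0 b1 b2] := HB _ (phi_q z zr); have P1 := p1b z zr; have P2 := p2b z zr.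
  have Q0 : 0 <= Q := le_trans ler01 Q1.
  have BQ2 : 0 <= B * Q * Q by rewrite mulr_ge0.
  have BQ : B <= B * Q by rewrite ler_peMr.
  split.
  - by rewrite /BB; apply: le_trans b0 _; apply: le_trans BQ _; rewrite lerDr.
  - rewrite cmodM; apply: le_trans (_ : B * Q <= _); last by rewrite /BB lerDr.
    exact: (ler_pM (cmod_ge0 _) (cmod_ge0 _) b1 P1).
  - apply: le_trans (cmodD _ _) _.
    rewrite (cmodM _ (p2 z)) (cmodM (_ * _) (p1 z)) (cmodM (g2 _) (p1 z)); apply: lerD.
      have b21 := ler_pM (cmod_ge0 _) (cmod_ge0 _) b2 P1.
      exact: (ler_pM (mulr_ge0 (cmod_ge0 _) (cmod_ge0 _)) (cmod_ge0 _) b21 P1).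
    exact: (ler_pM (cmod_ge0 _) (cmod_ge0 _) b1 P2).
have := log_mean (rho := 1 + eta) ltac:(by rewrite ltrDl) hd hb.
have -> : h 0 = g (c * r%:C) by rewrite /h /phi /den mulr0 addr0 add0r divr1.
move=> H; apply: le_trans H _.
have in1 t : cmod (expi t) < 1 + eta by rewrite cmod_expi ltrDl.
have ch : continuous (fun t => ln (1 + cmod (h (expi t)) ^+ 2)).
  have vh t : exists v, vder (fun x => h (expi x)) t v.
    have [d0 _ _] := hd _ (in1 t); have := vder_rpol 1 t.
    rewrite (_ : (fun s => 1%:C * expi s) = @expi R); last by apply/funext => x; rewrite mul1r.
    by move=> v; eexists; exact: (@vder_comp R h (@expi R) t _ _ d0 v).
  move=> t; rewrite (_ : (fun t => _) = (fun t => ln (sq1 (Re (h (expi t))) (Im (h (expi t)))))); last first.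
    by apply/funext => x; rewrite cmod_sq1.
  have [v [v1 v2]] := vh t.
  exact: is_derive_continuous (is_derive_log v1 v2).
rewrite (psub_integral r01 ch) le_eqVlt; apply/orP; left; apply/eqP.
apply: eq_Rintegral => t _; congr (_ * ln (1 + cmod (g (c * _)) ^+ 2)).
have zn := denn _ (in1 (psub r t)).
rewrite /phi; apply: (mulIf zn); rewrite divfK// /den.
have key : expi t - r%:C - expi (psub r t) * (1 - r%:C * expi t) = 0.
  by rewrite psub_rotation// subrr.
by apply/eqP; rewrite -subr_eq0; apply/eqP; rewrite -[RHS]oppr0 -key; ring.
Qed.

End PoissonInequality.

(** * Poisson averages and the maximal function *)

Section RadialBound.
Context {R : realType}.
Implicit Types (s t r a : R) (z c : R[i]) (W : R -> R).
Local Notation lam := (@lebesgue_measure R).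

Lemma integral_shift W a b s : a <= b -> continuous W ->
  (\int[lam]_(t in `[(s + a)%R, (s + b)%R]) (W t)%:E = \int[lam]_(t in `[a, b]) (W (s + t)%R)%:E)%E.
Proof.
move=> ab cW.
have der (t : R) : is_derive t 1 (fun x => s + x) (1 : R).
  have H : is_derive t 1 (cst s + id) (0 + 1 : R) by apply: is_deriveD.
  by apply: is_derive_eq H _; rewrite add0r.
have cs : continuous (fun x : R => s + x) by move=> t; exact: is_derive_continuous (der t).
have dE : (fun x => s + x)^`()%classic = (fun=> 1 : R).
  by apply/funext => t; rewrite derive1E; have [_ ->] := der t.
rewrite (@integration_by_substitution_increasing R (fun x => s + x) W a b).
- by apply: eq_integral => t _; rewrite dE /= mulr1.
- by [].
- by move=> x y _ _ xy; rewrite ltrD2l.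
- by move=> t _; rewrite dE; exact: cvg_cst.
- by rewrite dE; apply/cvg_ex; exists 1; exact: cvg_cst.
- by rewrite dE; apply/cvg_ex; exists 1; exact: cvg_cst.
- split; first by move=> t _; have [] := der t.
  + by apply: cvg_at_right_filter; exact: cs.
  + by apply: cvg_at_left_filter; exact: cs.
- exact: continuous_subspaceT.
Qed.

Lemma four_le_2pi : 4 <= 2 * pi :> R.
Proof. by have := @pi_ge2 R; lra. Qed.

(** For angles beyond 1 - r the Poisson kernel decays like (1 - r) / t^2. *)
Lemma pden_quad r t : 1 / 2 <= r < 1 -> `|t| <= pi -> t ^+ 2 / 8 <= pden r t.
Proof.
move=> /andP[r0 r1] tpi.
have h := @le_cmod_expiB R t 0; rewrite subr0 in h; have {}h := h tpi.
have e : cmod (expi t - expi 0) ^+ 2 = 2 * (1 - cos t).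
  by rewrite cmod_sqr /expi /= cos0 sin0 subr0 sin2cos2; ring.
have h2 : t ^+ 2 <= 4 * (2 * (1 - cos t)).
  rewrite -e -(real_normK (num_real t)) (_ : 4 = 2 ^+ 2 :> R); last by ring.
  by rewrite -exprMn lerXn2r ?nnegrE ?mulr_ge0 ?cmod_ge0.
have c1 := cos_le1 t; rewrite /pden; move: (cos t) h2 c1 => u; move: (t ^+ 2) => T; nra.
Qed.

(** The Poisson kernel is dominated by a sum of normalized indicators of
    intervals centred at the origin, with geometric weights. *)
Lemma pker_layers r : 1 / 2 <= r < 1 -> exists n, forall t, `|t| <= pi ->
  pker r t <= \sum_(k < n) 64 / (1 - r) / 4 ^+ k * (`|t| <= 2 ^+ k * (1 - r))%R%:R.
Proof.
move=> r01; have /andP[r0 r1] := r01; set d := 1 - r.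
have d0 : 0 < d by rewrite subr_gt0.
have [n Hn] := @pow2_below R (d / 4) ltac:(by rewrite divr_gt0).
exists n.+1 => t tpi.
have term_ge0 (k : nat) : 0 <= 64 / d / 4 ^+ k * (`|t| <= 2 ^+ k * d)%R%:R :> R.
  by rewrite mulr_ge0// divr_ge0 ?exprn_ge0// divr_ge0// ltW.
have r0' : 0 <= r < 1 by rewrite r1 andbT; lra.
have num : 1 - r ^+ 2 <= 2 * d by rewrite /d; move: r0' => /andP[]; clear; nra.
have num0 : 0 <= 1 - r ^+ 2 by rewrite subr_ge0 expr_le1//; lra.
have big (k : 'I_n.+1) : pker r t <= 64 / d / 4 ^+ k * (`|t| <= 2 ^+ k * d)%R%:R ->
    pker r t <= \sum_(k < n.+1) 64 / d / 4 ^+ k * (`|t| <= 2 ^+ k * d)%R%:R.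
  move=> h; rewrite (bigD1 k)//=; apply: le_trans h _; rewrite lerDl.
  by apply: sumr_ge0 => j _.
have [td|td] := leP `|t| d.
  apply: (big ord0); rewrite expr0 mul1r divr1 td mulr1.
  rewrite ler_pdivrMr ?pden_gt0//; apply: le_trans num _.
  apply: le_trans (_ : 64 / d * d ^+ 2 <= _).
    by rewrite expr2 mulrA divfK ?gt_eqF//; move: d0; clear; lra.
  by rewrite ler_wpM2l ?divr_ge0 ?(ltW d0)// pden_ge.
have ex : exists k, `|t| <= 2 ^+ k * d.
  exists n; apply: le_trans tpi _; apply: le_trans (ltW pi_lt4) _.
  move: Hn; rewrite ler_pdivlMr// -ler_pdivlMl ?invr_gt0 ?exprn_gt0//.
  by rewrite invrK.
have [k kt kmin] := ex_minnP ex.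
have kn : (k < n.+1)%N.
  rewrite ltnS; apply: kmin; apply: le_trans tpi _; apply: le_trans (ltW pi_lt4) _.
  move: Hn; rewrite ler_pdivlMr// -ler_pdivlMl ?invr_gt0 ?exprn_gt0//.
  by rewrite invrK.
apply: (big (Ordinal kn)); rewrite /= kt mulr1.
case: k kt kmin kn => [|k] kt kmin kn; first by move: kt; rewrite expr0 mul1r leNgt td.
have tk : 2 ^+ k * d < `|t|.
  by rewrite ltNge; apply/negP => /kmin; rewrite ltnn.
have q := pden_quad r01 tpi.
rewrite ler_pdivrMr ?pden_gt0//; apply: le_trans num _.
apply: le_trans (_ : 64 / d / 4 ^+ k.+1 * ((2 ^+ k * d) ^+ 2 / 8) <= _).
  rewrite exprMn -exprM mulnC exprM (_ : 2 ^+ 2 = 4 :> R); last by ring.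
  rewrite exprS le_eqVlt; apply/orP; left; apply/eqP; field.
  by rewrite expf_neq0 ?gt_eqF.
rewrite ler_wpM2l ?divr_ge0 ?exprn_ge0 ?(ltW d0)//.
apply: le_trans q; rewrite ler_pM2r// -(real_normK (num_real t)).
by rewrite lerXn2r ?nnegrE// ?mulr_ge0 ?exprn_ge0 ?(ltW d0)// ltW.
Qed.

(** Three periods, so that the points within distance pi of an angle of the
    basic period stay inside the window. *)
Definition window : set R := `]- (2 * pi), 4 * pi[%classic.

(** The cut-off makes a periodic function integrable on the line and keeps its
    values within distance 2 pi of the basic period. *)
Definition windowed W t : R := W t * \1_window t.

(** Each layer of the kernel is an average over an interval, bounded by the
    maximal function; the weights of the layers form a geometric series. *)
Lemma poisson_maximal W r a (L : R) : continuous W -> (forall t, 0 <= W t) ->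
  1 / 2 <= r < 1 -> 0 <= a < 2 * pi -> (HL_maximal (windowed W) a <= L%:E)%E ->
  \int[lam]_(t in `[- pi, pi]) (pker r t * W (a + t)) <= 512 * L.
Proof.
move=> cW W0 r01 /andP[a0 a2] HL; have /andP[r0 r1] := r01; set d := 1 - r.
have d0 : 0 < d by rewrite subr_gt0.
have r0' : 0 <= r < 1 by rewrite r1 andbT; lra.
have p0 := @pi_gt0 R.
have cWa : continuous (fun t => W (a + t)).
  move=> t; apply: (@continuous_comp _ _ _ (fun t => a + t) W); last exact: cW.
  by apply: cvgD; [exact: cvg_cst|exact: cvg_id].
have cI := continuous_mulf (continuous_pker r0') cWa.
have iI := @continuous_itv_integrable R _ (- pi) pi cI.
have [n Hn] := pker_layers r01.
have mI : measurable (`[- pi, pi]%classic : set R) by exact: measurable_itv.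
have mW D : measurable_fun D (fun t => (W (a + t))%:E).
  by apply: measurable_funTS; apply/measurable_EFinP; exact: continuous_measurable_fun.
pose b (k : nat) : R := Num.min (2 ^+ k * d) pi.
have b0 k : 0 < b k by rewrite lt_min p0 mulr_gt0 ?exprn_gt0.
have avg k : (\int[lam]_(t in `[(- b k)%R, b k]) (W (a + t)%R)%:E <= (4 * (2 ^+ k * d) * L)%:E)%E.
  have e0 : 0 < 2 * (2 ^+ k * d) by rewrite !mulr_gt0 ?exprn_gt0.
  rewrite -integral_shift//; last by rewrite ge0_cp// ltW.
  have bb : b k <= 2 ^+ k * d by rewrite ge_min lexx.
  have bp : b k <= pi by rewrite ge_min lexx orbT.
  have ib : (iavg (windowed W) (ball a (2 * (2 ^+ k * d))) <= L%:E)%E.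
    apply: le_trans HL; apply: ereal_sup_ubound.
    by exists (2 * (2 ^+ k * d)) => //=; rewrite in_itv/= e0.
  have lb : lam (ball a (2 * (2 ^+ k * d))) = (4 * (2 ^+ k * d))%:E.
    rewrite lebesgue_measure_ball; last exact: ltW.
    by congr EFin; ring.
  have l0 : 0 < 4 * (2 ^+ k * d) by move: e0; clear; lra.
  move: ib; rewrite /iavg [lam _]lb inver gt_eqF// muleC lee_pdivrMr//.
  rewrite -EFinM (mulrC L) => ib; apply: le_trans ib.
  apply: (@le_trans _ _ (\int[lam]_(t in `[(a - b k)%R, (a + b k)%R]) `|(windowed W t)%:E|)%E).
    apply: ge0_le_integral => //.
    - by move=> t _; rewrite lee_fin.
    - by apply: measurable_funTS; apply/measurable_EFinP; exact: continuous_measurable_fun.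
    - apply: measurable_funTS; apply: measurableT_comp => //; apply/measurable_EFinP.
      apply: measurable_funM; first exact: continuous_measurable_fun.
      by apply: measurable_indic; exact: measurable_itv.
    - move=> t /=; rewrite in_itv/= => /andP[t1 t2].
      rewrite /windowed indicE mem_set ?mulr1 ?ger0_norm//.
      rewrite /window/= in_itv/=; apply/andP; split; move: a0 a2 t1 t2 bp p0; clear;
        move: (b k) => B *; lra.
  apply: ge0_subset_integral => //.
  - exact: measurable_ball.
  - apply: measurable_funTS; apply: measurableT_comp => //; apply/measurable_EFinP.
    apply: measurable_funM; first exact: continuous_measurable_fun.
    by apply: measurable_indic; exact: measurable_itv.
  - move=> t /=; rewrite in_itv/= /ball/= /ball_/= ltr_distlC => /andP[t1 t2].
    apply/andP; split; move: t1 t2 bb (b0 k) e0; clear;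
      move: (b k) (2 ^+ k * d) => B C *; lra.
rewrite -lee_fin /Rintegral fineK; last exact: integrable_fin_num.
apply: (@le_trans _ _ (\int[lam]_(t in `[(- pi)%R, pi])
   \sum_(k < n) (64 / d / 4 ^+ k)%:E * ((\1_(`[(- b k)%R, b k]) t)%:E * (W (a + t)%R)%:E))%E).
  apply: ge0_le_integral => //.
  - by move=> t _; rewrite lee_fin mulr_ge0// ltW// pker_gt0.
  - by apply: measurable_funTS; apply/measurable_EFinP; exact: continuous_measurable_fun.
  - apply: emeasurable_sum => k; apply: emeasurable_funM => //.
    apply: emeasurable_funM; last exact: mW.
    by apply/measurable_EFinP; apply: measurable_indic; exact: measurable_itv.
  - move=> t /=; rewrite in_itv/= -ler_norml => tp.
    rewrite (eq_bigr (fun k : 'I_n => (64 / d / 4 ^+ k * (`|t| <= 2 ^+ k * d)%R%:R * W (a + t))%:E)).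
      by rewrite sumEFin lee_fin -mulr_suml ler_wpM2r// Hn.
    move=> k _; rewrite -!EFinM mulrA; congr ((_ * _)%:E).
    rewrite indicE; suff -> : (t \in `[(- b k)%R, b k]%classic) = (`|t| <= 2 ^+ k * d) by [].
    by rewrite mem_setE in_itv/= -ler_norml /b le_min tp andbT.
rewrite ge0_integral_sum//; last 2 first.
- move=> k; apply: emeasurable_funM => //; apply: emeasurable_funM; last exact: mW.
  by apply/measurable_EFinP; apply: measurable_indic; exact: measurable_itv.
- by move=> k t _; rewrite mule_ge0 ?mule_ge0 ?lee_fin// divr_ge0 ?exprn_ge0// divr_ge0// ltW.
apply: (@le_trans _ _ (\sum_(k < n) (256 * L / 2 ^+ k)%:E)%E).
  apply: lee_sum => k _; rewrite ge0_integralZl//; last 3 first.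
  - apply: emeasurable_funM; last exact: mW.
    by apply/measurable_EFinP; apply: measurable_indic; exact: measurable_itv.
  - by move=> t _; rewrite mule_ge0 ?lee_fin.
  - by rewrite lee_fin divr_ge0 ?exprn_ge0// divr_ge0// ltW.
  have -> : (\int[lam]_(t in `[(- pi)%R, pi]) ((\1_(`[(- b k)%R, b k]) t)%:E * (W (a + t)%R)%:E) =
      \int[lam]_(t in `[(- b k)%R, b k]) (W (a + t)%R)%:E)%E.
    rewrite integral_mkcond [RHS]integral_mkcond.
    apply: eq_integral => t _; rewrite /patch indicE.
    case: ifPn => [_|tn]; first by case: ifP => _; rewrite ?mul1e ?mul0e.
    case: ifPn => // tb; exfalso; move/negP: tn; apply.
    move: tb; rewrite !inE/= !in_itv/= -!ler_norml => tb; apply: le_trans tb _.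
    by rewrite ge_min lexx orbT.
  apply: le_trans (lee_wpmul2l _ (avg k)) _.
    by rewrite lee_fin divr_ge0 ?exprn_ge0// divr_ge0// ltW.
  rewrite -EFinM lee_fin (_ : 4 ^+ k = 2 ^+ k * 2 ^+ k :> R); last by rewrite -exprMn; congr (_ ^+ _); ring.
  rewrite le_eqVlt; apply/orP; left; apply/eqP; field.
  by rewrite expf_neq0//= gt_eqF.
have L0 : 0 <= L.
  have := avg 0; rewrite expr0 mul1r => h.
  have : (0 <= (4 * d * L)%:E)%E by apply: le_trans h; apply: integral_ge0 => t _; rewrite lee_fin.
  by rewrite lee_fin pmulr_rge0// mulr_gt0.
rewrite sumEFin lee_fin -mulr_sumr (_ : 512 * L = 256 * L * 2); last by ring.
have := mulr_ge0 (ler0n R 256) L0.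
move: (256 * L) => X X0; apply: ler_wpM2l => //.
have geo (m : nat) : \sum_(k < m) (2 ^+ k)^-1 = 2 - 2 / 2 ^+ m :> R.
  elim: m => [|m IH]; first by rewrite big_ord0 expr0 divr1 subrr.
  by rewrite big_ord_recr/= IH exprS; field; rewrite expf_neq0.
by rewrite geo gerBl divr_ge0 ?exprn_ge0.
Qed.

End RadialBound.

(** * Boundedness along almost every radius *)

Section RadialLimitBound.
Context {R : realType} (g g1 g2 : R[i] -> R[i]).
Implicit Types (s t r a : R) (z c : R[i]).
Local Notation lam := (@lebesgue_measure R).
Context (gd : forall z, cmod z < 1 ->
  [/\ cder g z (g1 z), cder g1 z (g2 z) & exists d, cder g2 z d]).
Context (gb : forall q, 0 <= q < 1 -> exists B, forall z, cmod z <= q ->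
  [/\ cmod (g z) <= B, cmod (g1 z) <= B & cmod (g2 z) <= B]).

Definition wlog r t : R := ln (1 + cmod (g (r%:C * expi t)) ^+ 2).

Lemma wlog_ge0 r t : 0 <= wlog r t.
Proof. by rewrite ln_ge0// lerDl sqr_ge0. Qed.

Lemma continuous_wlog r : 0 <= r < 1 -> continuous (wlog r).
Proof.
move=> /andP[r0 r1] t.
have [d0 _ _] := gd (z := r%:C * expi t) ltac:(by rewrite cmod_rpol).
have [v1 v2] := @vder_comp R g (fun x => r%:C * expi x) t _ _ d0 (vder_rpol r t).
rewrite (_ : wlog r = (fun x => ln (sq1 (Re (g (r%:C * expi x))) (Im (g (r%:C * expi x)))))).
  exact: is_derive_continuous (is_derive_log v1 v2).
by apply/funext => x; rewrite cmod_sq1.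
Qed.

Lemma wlog_periodic r t : wlog r (t + 2 * pi) = wlog r t.
Proof. by rewrite /wlog expiD expi2pi mulr1. Qed.

(** The Poisson inequality on the circle of radius q: the whole radius inside it
    is controlled by one maximal function. *)
Lemma wlog_maximal q r a (L : R) : 0 <= q < 1 -> 1 / 2 <= r < 1 -> 0 <= a < 2 * pi ->
  (HL_maximal (windowed (wlog q)) a <= L%:E)%E -> wlog (q * r) a <= 128 * L.
Proof.
move=> q01 r01 a2 HL; have /andP[q0 q1] := q01; have /andP[r0 r1] := r01.
have cq : cmod (q%:C * expi a) < 1 by rewrite cmod_rpol.
have H := poisson_log gd gb cq (r := r) ltac:(by rewrite r1 andbT; lra).
have M := poisson_maximal (continuous_wlog q01) (wlog_ge0 q) r01 a2 HL.
have E : \int[lam]_(t in `[- pi, pi]) (pker r t * ln (1 + cmod (g (q%:C * expi a * expi t)) ^+ 2)) =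
         \int[lam]_(t in `[- pi, pi]) (pker r t * wlog q (a + t)).
  by apply: eq_Rintegral => t _; rewrite /wlog expiD mulrA.
have e2 : ln (1 + cmod (g (q%:C * expi a * r%:C)) ^+ 2) = wlog (q * r) a.
  by rewrite /wlog rmorphM/= mulrAC.
have w0 := wlog_ge0 (q * r) a.
have p3 : 4 <= 2 * pi :> R.
  exact: four_le_2pi.
rewrite E e2 in H; have h5 := le_trans H M.
have h4 : 4 * wlog (q * r) a <= 2 * pi * wlog (q * r) a by rewrite ler_wpM2r.
have := le_trans h4 h5; rewrite (_ : 512 * L = 4 * (128 * L)); last by ring.
by rewrite ler_pM2l.
Qed.

Lemma windowed_integral r (A : R) : 0 <= r < 1 ->
  (\int[lam]_(t in `[0%R, (2 * pi)%R]) (wlog r t)%:E <= A%:E)%E ->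
  (\int[lam]_t `|(windowed (wlog r) t)%:E| <= (3 * A)%:E)%E.
Proof.
move=> r01 HA; have cW := continuous_wlog r01; have p2 := @two_pi_gt0 R.
have mW D : measurable_fun D (fun t => (wlog r t)%:E).
  by apply: measurable_funTS; apply/measurable_EFinP; exact: continuous_measurable_fun.
have w0 t : (0 <= (wlog r t)%:E)%E by rewrite lee_fin wlog_ge0.
have shift s : (forall t, wlog r (s + t) = wlog r t) ->
    (\int[lam]_(t in `[s, (s + 2 * pi)%R]) (wlog r t)%:E <= A%:E)%E.
  move=> per; rewrite -{1}[s]addr0 integral_shift ?(ltW p2)//.
  by apply: le_trans HA; under eq_integral do rewrite per.
have per1 t : wlog r (2 * pi + t) = wlog r t by rewrite addrC wlog_periodic.
have per0 t : wlog r (- (2 * pi) + t) = wlog r t.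
  by rewrite -(wlog_periodic r (- (2 * pi) + t)) addrAC addNr add0r.
pose I1 : set R := `[- (2 * pi), - (2 * pi) + 2 * pi]%classic.
pose I2 : set R := `[0, 2 * pi]%classic.
pose I3 : set R := `[2 * pi, 2 * pi + 2 * pi]%classic.
have cov : (\int[lam]_t `|(windowed (wlog r) t)%:E| <=
   \int[lam]_t (((wlog r t)%:E * (\1_I1 t)%:E + (wlog r t)%:E * (\1_I2 t)%:E) + (wlog r t)%:E * (\1_I3 t)%:E))%E.
  have mi (I : set R) : measurable I -> measurable_fun setT (fun t => (wlog r t)%:E * (\1_I t)%:E)%E.
    by move=> mI; apply: emeasurable_funM => //; apply/measurable_EFinP; exact: measurable_indic.
  apply: ge0_le_integral => //.
  - apply: measurableT_comp => //; apply/measurable_EFinP; apply: measurable_funM.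
      exact: continuous_measurable_fun.
    by apply: measurable_indic; exact: measurable_itv.
  - by apply: emeasurable_funD; [apply: emeasurable_funD|]; apply: mi; exact: measurable_itv.
  - move=> t _; rewrite /windowed -!EFinM -!EFinD lee_fin -!mulrDr normrM ger0_norm ?wlog_ge0//.
    apply: ler_wpM2l; first exact: wlog_ge0.
    rewrite ger0_norm// !indicE /window /I1 /I2 /I3 !mem_setE !in_itv/=.
    case: andP => [[t1 t2]|_]; last by rewrite !addr_ge0.
    have [h1|h1] := leP t 0.
      rewrite (ltW t1) (_ : t <= - (2 * pi) + 2 * pi)/=; last by rewrite addrC subrr.
      by rewrite -addrA lerDl addr_ge0.
    have [h2|h2] := leP t (2 * pi).
      by rewrite (ltW h1)/= -addrA addrCA lerDl addr_ge0.
    rewrite (ltW h2) (_ : t <= 2 * pi + 2 * pi)/=; last by apply: ltW; apply: lt_le_trans t2 _; lra.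
    by rewrite lerDr addr_ge0.
apply: le_trans cov _.
have piece (I : set R) : measurable I ->
    (\int[lam]_t ((wlog r t)%:E * (\1_I t)%:E) = \int[lam]_(t in I) (wlog r t)%:E)%E.
  move=> mI; rewrite [RHS]integral_mkcond; apply: eq_integral => t _.
  by rewrite /patch indicE; case: ifP => _; rewrite ?mule1 ?mule0.
have mi (I : set R) : measurable I -> measurable_fun setT (fun t => (wlog r t)%:E * (\1_I t)%:E)%E.
  by move=> mI; apply: emeasurable_funM => //; apply/measurable_EFinP; exact: measurable_indic.
have m1 : measurable I1 by exact: measurable_itv.
have m2 : measurable I2 by exact: measurable_itv.
have m3 : measurable I3 by exact: measurable_itv.
have nn (I : set R) t : (0 <= (wlog r t)%:E * (\1_I t)%:E)%E by rewrite mule_ge0// lee_fin.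
rewrite ge0_integralD//; last 3 first.
- by move=> t _; exact: adde_ge0.
- by apply: emeasurable_funD; exact: mi.
- exact: mi.
rewrite ge0_integralD//; try exact: mi.
rewrite !piece//.
have -> : (3 * A)%:E = (A%:E + A%:E + A%:E)%E by rewrite -!EFinD; congr EFin; ring.
apply: leeD; first apply: leeD.
- exact: shift.
- exact: HA.
- exact: shift.
Qed.

(** Radii r < q only: the maximal function belongs to the circle of radius q,
    and q increases to 1 afterwards. *)
Definition exceptional q Lam : set R :=
  turn `&` [set t | exists r, 1 / 2 <= r < q /\ Lam < wlog r t].

Lemma measurable_exceptional q Lam : q <= 1 -> measurable (exceptional q Lam).
Proof.
move=> q1; apply: measurableI; first exact: measurable_turn.
apply: open_measurable.
rewrite (_ : [set t | _] = \bigcup_(r in [set r | 1 / 2 <= r < q]) (wlog r @^-1` [set x | Lam < x])).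
  apply: bigcup_open => r /= /andP[r0 r1]; apply: open_comp; last exact: open_gt.
  move=> x _; apply: continuous_wlog; rewrite (lt_le_trans r1 q1) andbT.
  by apply: le_trans r0; rewrite divr_ge0.
by apply/seteqP; split => t [r]; [move=> [rq h]; exists r|move=> rq h; exists r].
Qed.

(** The weak-type inequality for the maximal function of the circle of radius q;
    its constant does not depend on q. *)
Lemma radial_exceptional (A Lam : R) (q : R) : 0 < Lam -> 0 < q < 1 ->
  (forall r, 0 <= r < 1 -> (\int[lam]_(t in `[0%R, (2 * pi)%R]) (wlog r t)%:E <= A%:E)%E) ->
  (lam (exceptional q Lam) <= (1152 * A / Lam)%:E)%E.
Proof.
move=> L0 /andP[q0 q1] HA; have q01 : 0 <= q < 1 by rewrite q1 ltW.
have cW := continuous_wlog q01.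
have lif : locally_integrable setT (windowed (wlog q)).
  have mf : measurable_fun setT (windowed (wlog q)).
    apply: measurable_funM; first exact: continuous_measurable_fun.
    by apply: measurable_indic; exact: measurable_itv.
  split => //; first exact: openT.
  move=> K _ cK; apply: (@le_lt_trans _ _ (3 * A)%:E); last by rewrite ltry.
  apply: le_trans (windowed_integral q01 (HA q q01)).
  apply: ge0_subset_integral => //.
    exact: compact_measurable.
  by apply/measurable_EFinP; exact: measurableT_comp.
have c0 : 0 < Lam / 128 by rewrite divr_gt0.
have MI := maximal_inequality lif c0.
apply: (@le_trans _ _ (lam [set x | ((Lam / 128)%:E < HL_maximal (windowed (wlog q)) x)%E])).
  apply: le_measure; rewrite ?inE.
  - exact: measurable_exceptional (ltW q1).
  - apply: open_measurable.
    by have /lower_semicontinuousP := lower_semicontinuous_HL_maximal lif; exact.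
  - move=> t [tt [r [/andP[r0 rq] lw]]] /=; rewrite ltNge; apply/negP => h.
    have tt' : 0 <= t < 2 * pi by move: tt; rewrite /turn/= in_itv.
    have rq' : 1 / 2 <= r / q < 1.
      apply/andP; split; last by rewrite ltr_pdivrMr// mul1r.
      by apply: (le_trans (r0)); rewrite ler_pdivlMr// ler_piMr ?(ltW q1)// (le_trans _ r0)// divr_ge0.
    have := wlog_maximal q01 rq' tt' h.
    rewrite mulrC divfK ?gt_eqF// mulrC divfK// => h2.
    by move: (le_lt_trans h2 lw); rewrite ltxx.
apply: le_trans MI _.
apply: le_trans (lee_wpmul2l _ (windowed_integral q01 (HA q q01))) _.
  by rewrite lee_fin divr_ge0// ltW.
rewrite -EFinM lee_fin le_eqVlt; apply/orP; left; apply/eqP; field.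
by rewrite gt_eqF.
Qed.

(** The bounds for the sets where the supremum exceeds m are uniform in the
    outer radius and decay like 1 / m. *)
Lemma radial_bounded (A : R) :
  (forall r, 0 <= r < 1 -> (\int[lam]_(t in `[0%R, (2 * pi)%R]) (wlog r t)%:E <= A%:E)%E) ->
  lam.-negligible (turn `&` [set t | forall Lam, exists r, 1 / 2 <= r < 1 /\ Lam < wlog r t]).
Proof.
move=> HA; have A0 : 0 <= A.
  rewrite -lee_fin; apply: le_trans (HA 0 _); last by rewrite lexx ltr01.
  by apply: integral_ge0 => t _; rewrite lee_fin wlog_ge0.
have mX m : measurable (exceptional 1 m) by exact: measurable_exceptional.
have bound (m : R) : 0 < m -> (lam (exceptional (1 : R)%R m) <= (1152 * A / m)%:E)%E.
  move=> m0; pose q (n : nat) : R := 1 - n.+2%:R^-1.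
  have q01 n : 0 < q n < 1.
    by rewrite /q subr_gt0 gtrBl invr_gt0 ltr0n andbT invf_lt1// ltr1n.
  have -> : exceptional 1 m = \bigcup_n exceptional (q n) m.
    apply/seteqP; split => t; last first.
      move=> [n _ [tt [r [/andP[r0 rq] h]]]]; split => //; exists r; split => //.
      by rewrite r0/= (lt_trans rq)//; have /andP[] := q01 n.
    move=> [tt [r [/andP[r0 r1] h]]].
    have d0 : 0 < 1 - r by rewrite subr_gt0.
    have [n /= _ /(_ n (leqnn _)) Hn] := near_infty_natSinv_lt (PosNum d0).
    exists n => //; split => //; exists r; split => //; rewrite r0/= /q ltrBrDr -ltrBrDl.
    apply: lt_trans Hn; rewrite ltf_pV2 ?posrE// ltr_nat//.
  have nd : nondecreasing_seq (fun n => exceptional (q n) m).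
    move=> n k nk; apply/subsetPset => t [tt [r [/andP[r0 rq] h]]].
    split => //; exists r; split => //; rewrite r0/=; apply: lt_le_trans rq _.
    by rewrite /q lerD2l lerN2 lef_pV2 ?posrE// ler_nat.
  have mq n : measurable (exceptional (q n) m).
    by apply: measurable_exceptional; apply: ltW; have /andP[] := q01 n.
  have cv := nondecreasing_cvg_mu (mu := lam) mq (bigcupT_measurable _ mq) nd.
  rewrite -(cvg_lim _ cv)//; apply: lime_le; first by apply/cvg_ex; eexists; exact: cv.
  by apply: nearW => n; exact: radial_exceptional.
exists (\bigcap_n exceptional 1 n.+1%:R); split.
- by apply: bigcapT_measurable => n; exact: mX.
- apply/eqP; rewrite eq_le measure_ge0 andbT; apply/lee_addgt0Pr => e e0; rewrite add0e.
  have [n Hn] : exists n : nat, 1152 * A / e <= n.+1%:R.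
    exists (Num.truncn (1152 * A / e)); apply: ltW; exact: truncnS_gt.
  apply: (@le_trans _ _ (lam (exceptional 1 n.+1%:R))).
    apply: le_measure; rewrite ?inE; [|exact: mX|by move=> t /(_ n I)].
    by apply: bigcapT_measurable => k; exact: mX.
  apply: le_trans (bound _ _) _; first by rewrite ltr0n.
  by rewrite lee_fin ler_pdivrMr ?ltr0n// (mulrC e) -ler_pdivrMr.
- by move=> t [tt H] n _; split => //; exact: H.
Qed.

End RadialLimitBound.

(** * Circular means of p and of p' *)

Section MeanBounds.
Context {R : realType} (mu : {finite_measure set (plane R) -> \bar R}).
Implicit Types (s t r : R) (z : R[i]).
Local Notation lam := (@lebesgue_measure R).
Local Notation K := (K mu).
Local Notation mass := (mass mu).
Local Notation herg := (herg mu).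
Local Notation qd := (qd mu).
Local Notation S := (singular_inner mu).

Definition pd z : R[i] := 2 * K 2 z.

Lemma pd_chain z : cmod z < 1 ->
  [/\ cder pd z (2 * (2%:R * K 3 z)), cder (fun z => 2 * (2%:R * K 3 z)) z (2 * (2%:R * (3%:R * K 4 z))) &
    exists d, cder (fun z => 2 * (2%:R * (3%:R * K 4 z))) z d].
Proof.
move=> z1; have C c f d : cder f z d -> cder (fun x => c * f x) z (c * d).
  by move=> df; apply: cder_eq (cderM (cder_cst c z) df) _; rewrite mul0r add0r.
split; first exact: C (cder_K mu 2 z1).
  exact: C (C _ _ _ (cder_K mu 3 z1)).
by eexists; exact: C (C _ _ _ (C _ _ _ (cder_K mu 4 z1))).
Qed.

Lemma cmod_nat n : cmod (n%:R : R[i]) = n%:R.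
Proof. by rewrite (_ : n%:R = n%:R%:C) ?cmodR ?ger0_norm// rmorph_nat. Qed.

Lemma pd_bounded q : 0 <= q < 1 -> exists B, forall z, cmod z <= q ->
  [/\ cmod (pd z) <= B, cmod (2 * (2%:R * K 3 z)) <= B & cmod (2 * (2%:R * (3%:R * K 4 z))) <= B].
Proof.
move=> /andP[q0 q1]; have d0 : 0 < 1 - q by rewrite subr_gt0.
pose i := (1 - q)^-1; have i1 : 1 <= i by rewrite invf_ge1// gerBl.
have i0 : 0 <= i := le_trans ler01 i1.
have KB k z : (k <= 4)%N -> cmod z <= q -> cmod (K k z) <= i ^+ 4 * mass.
  move=> k4 zq; have z1 := le_lt_trans zq q1.
  apply: Cint_bound; first exact: bfun_kern.
  move=> p Cp; rewrite /kern cmodM cmod_toC// mul1r cmodX.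
  apply: le_trans (_ : i ^+ k <= _); last exact: ler_weXn2l.
  apply: lerXn2r; rewrite ?nnegrE ?cmod_ge0//; apply: inv_dist_le => //.
  by apply: le_trans (dist_circle z Cp); rewrite lerD2l lerN2.
have B0 : 0 <= i ^+ 4 * mass by rewrite mulr_ge0 ?exprn_ge0// mass_ge0.
exists (12 * (i ^+ 4 * mass)) => z zq.
have b2 := KB 2%N z isT zq; have b3 := KB 3%N z isT zq; have b4 := KB 4%N z isT zq.
rewrite /pd !(cmodM 2) !(cmodM 3) !cmod_nat; move: b2 b3 b4 B0.
move: (i ^+ 4 * mass) (cmod (K 2 z)) (cmod (K 3 z)) (cmod (K 4 z)) => M x y w *.
by split; lra.
Qed.

(** The kernel is the derivative of psub, which increases by 2 pi over a period. *)
Lemma pker_total r s : 0 <= r < 1 ->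
  (\int[lam]_(t in `[0%R, (2 * pi)%R]) (pker r (t - s)%R)%:E = (2 * pi)%:E)%E.
Proof.
move=> r01.
have der t : is_derive t 1 (fun x => psub r (x - s)) (pker r (t - s)).
  have H : is_derive t 1 (id - cst s) (1 - 0 : R) by apply: is_deriveB.
  have := @is_derive1_comp R (psub r) (fun x => x - s) t _ _ (is_derive_psub (t - s) r01) H.
  by rewrite subr0 mulr1.
have cF : continuous (fun x => psub r (x - s)) by move=> t; exact: is_derive_continuous (der t).
have ck : continuous (fun x => pker r (x - s)).
  move=> t; apply: (@continuous_comp _ _ _ (fun x => x - s) (pker r)); last exact: continuous_pker.
  by apply: cvgB; [exact: cvg_id|exact: cvg_cst].
rewrite (@continuous_FTC2 _ _ (fun x => psub r (x - s)))//.
- rewrite -EFinB sub0r /psub; congr EFin.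
  rewrite (_ : 2 * pi - s = - s + pi + pi); last by ring.
  by rewrite !sinDpi !cosDpi !opprK; ring.
- exact: two_pi_gt0.
- exact: continuous_subspaceT.
- split; first by move=> t _; have [] := der t.
  + by apply: cvg_at_right_filter; exact: cF.
  + by apply: cvg_at_left_filter; exact: cF.
- by move=> t _; rewrite derive1E; have [_ ->] := der t.
Qed.

(** The measure mu lives on the plane, so the integral over the circle is first
    extended by an indicator. *)
Lemma tonelli_circle (h : plane R * R -> R) (A : set R) : measurable A ->
  measurable_fun setT h -> (forall x, 0 <= h x) ->
  (\int[lam]_(t in A) \int[mu]_(p in circle) (h (p, t))%:E =
   \int[mu]_(p in circle) \int[lam]_(t in A) (h (p, t))%:E)%E.
Proof.
move=> mA mh h0; have mC := @measurable_circle R.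
pose f (x : plane R * R) : \bar R := (h x * (\1_circle x.1 * \1_A x.2))%:E.
have f0 x : (0 <= f x)%E by rewrite lee_fin !mulr_ge0.
have mf : measurable_fun setT f.
  apply/measurable_EFinP; apply: measurable_funM => //; apply: measurable_funM.
    by apply: measurableT_comp; [exact: measurable_indic|exact: measurable_fst].
  by apply: measurableT_comp; [exact: measurable_indic|exact: measurable_snd].
have FT : (\int[mu]_p \int[lam]_t f (p, t) = \int[lam]_t \int[mu]_p f (p, t))%E.
  by apply: fubini_tonelli.
transitivity (\int[lam]_t \int[mu]_p f (p, t))%E.
  rewrite integral_mkcond; apply: eq_integral => t _; rewrite /patch.
  case: ifPn => tA.
    rewrite integral_mkcond; apply: eq_integral => p _; rewrite /patch /f/= !indicE tA.
    by case: ifP => _; rewrite ?mulr1 ?mulr0 ?mul1r ?mul0r.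
  rewrite integral0_eq// => p _; rewrite /f/= [\1_A t]indicE (negbTE tA).
  by rewrite !mulr0.
rewrite -FT [RHS]integral_mkcond; apply: eq_integral => p _; rewrite /patch.
case: ifPn => pC.
  rewrite [RHS]integral_mkcond; apply: eq_integral => t _; rewrite /patch /f/= !indicE pC.
  by case: ifP => _; rewrite ?mulr1 ?mulr0 ?mul1r ?mul0r.
rewrite integral0_eq// => t _; rewrite /f/= [\1_circle p]indicE (negbTE pC).
by rewrite mul0r mulr0.
Qed.

(** The Poisson kernel as a jointly measurable function of the mass point and
    the angle. *)
Definition pois r (x : plane R * R) : R :=
  (1 - r ^+ 2) * (cmod (toC x.1 - r%:C * expi x.2))^-1 ^+ 2.

Lemma measurable_pois r : measurable_fun setT (pois r).
Proof.
apply: measurable_funM => //; apply: measurable_funX; apply: (measurableT_comp measurable_realV).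
apply: measurable_cmod; split.
  rewrite (_ : (fun x => _) = (fun x : plane R * R => x.1.1 - r * cos x.2)); last first.
    by apply/funext => -[[a b] c]; rewrite ReB /expi/= mul0r subr0.
  apply: measurable_funB; first exact: (measurableT_comp measurable_fst measurable_fst).
  apply: measurable_funM => //; apply: measurableT_comp; last exact: measurable_snd.
  by apply: continuous_measurable_fun; exact: continuous_cos.
rewrite (_ : (fun x => _) = (fun x : plane R * R => x.1.2 - r * sin x.2)); last first.
  by apply/funext => -[[a b] c]; rewrite ImB /expi/= mul0r addr0.
apply: measurable_funB; first exact: (measurableT_comp measurable_snd measurable_fst).
apply: measurable_funM => //; apply: measurableT_comp; last exact: measurable_snd.
by apply: continuous_measurable_fun; exact: continuous_sin.
Qed.

Lemma pois_ge0 r x : 0 <= r < 1 -> 0 <= pois r x.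
Proof.
move=> /andP[r0 r1]; rewrite mulr_ge0 ?sqr_ge0// subr_ge0 expr_le1//; exact: ltW.
Qed.

Lemma pois_pker r s t : pois r (pt s, t) = pker r (t - s).
Proof.
rewrite /pois /pker toC_pt exprVn; congr (_ * _^-1); rewrite cmod_sqr /expi/= pdenE cosB sinB.
transitivity ((cos s ^+ 2 + sin s ^+ 2) - 2 * r * (cos s * cos t + sin s * sin t)
   + r ^+ 2 * (cos t ^+ 2 + sin t ^+ 2)); first by ring.
transitivity (1 - 2 * r * (cos s * cos t + sin s * sin t)
   + r ^+ 2 * ((cos t ^+ 2 + sin t ^+ 2) * (cos s ^+ 2 + sin s ^+ 2))); last by ring.
by rewrite !cos2Dsin2 !mulr1.
Qed.

Lemma Re_herg_pois r t : 0 <= r < 1 ->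
  (Re (herg (r%:C * expi t)))%:E = (\int[mu]_(p in circle) (pois r (p, t))%:E)%E.
Proof.
move=> /andP[r0 r1]; have z1 : cmod (r%:C * expi t) < 1 by rewrite cmod_rpol.
have iz := inv_dist_integrable mu z1; have mC := @measurable_circle R.
rewrite Re_herg// cmod_rpol// EFinM.
have -> : (qd (r%:C * expi t))%:E =
    (\int[mu]_(p in circle) ((cmod (toC p - r%:C * expi t))^-1 ^+ 2)%:E)%E.
  by rewrite fineK//; exact: integrable_fin_num.
rewrite -ge0_integralZl//.
- by apply/measurable_EFinP; apply: measurable_funTS; exact: measurable_inv_dist.
- by move=> p _; rewrite lee_fin sqr_ge0.
- by rewrite lee_fin subr_ge0 expr_le1// ltW.
Qed.

(** Re p is harmonic, so its circular means all equal the total mass; here this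
    is the mean of the Poisson kernel and Tonelli's theorem. *)
Lemma herg_mean r : 0 <= r < 1 ->
  (\int[lam]_(t in `[0%R, (2 * pi)%R]) (Re (herg (r%:C * expi t)))%:E <= (2 * pi * mass)%:E)%E.
Proof.
move=> r01; have mI : measurable (`[0, 2 * pi]%classic : set R) by exact: measurable_itv.
under eq_integral do rewrite Re_herg_pois//.
rewrite (@tonelli_circle (pois r))//; [|exact: measurable_pois|by move=> x; exact: pois_ge0].
have mC := @measurable_circle R.
apply: (@le_trans _ _ (\int[mu]_(p in circle) (2 * pi)%:E)%E); last first.
  rewrite integral_cst// (EFinM (2 * pi) mass); apply: lee_wpmul2l.
    by rewrite lee_fin ltW// two_pi_gt0.
  by rewrite /mass fineK// fin_num_measure.
rewrite le_eqVlt; apply/orP; left; apply/eqP; apply: eq_integral => p; rewrite inE => Cp.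
have [s _ ->] := circle_ptP Cp.
by under eq_integral do rewrite pois_pker; exact: pker_total.
Qed.

(** p' = - S' exp p, and log |exp p| = Re p. *)
Lemma logplus_pd z : cmod z < 1 ->
  logplus (cmod (pd z)) <= logplus (cmod (derive1 S z)) + Re (herg z).
Proof.
move=> z1; have x0 := Re_herg_ge0 mu z1.
have e : cmod (pd z) = cmod (derive1 S z) * expR (Re (herg z)).
  by rewrite derive1_S// (cmodM (- _) (singular_inner mu z)) cmodN cmod_S// -mulrA -expRD addNr expR0 mulr1.
rewrite e; apply: le_trans (logplusM _ _) _; rewrite ?cmod_ge0 ?expR_ge0//.
by rewrite lerD2l logplus_ge1 ?expRK// -expR0 ler_expR.
Qed.

Lemma wlog_logplus r t : wlog pd r t <= 1 + 2 * logplus (cmod (pd (r%:C * expi t))).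
Proof.
rewrite /wlog; set x := cmod _; have x0 : 0 <= x := cmod_ge0 _.
rewrite logplusE//; set m := Num.max 1 x.
have m1 : 1 <= m by rewrite le_max lexx.
have m0 : 0 < m by lra.
have xm : x <= m by rewrite le_max lexx orbT.
apply: le_trans (_ : ln (2 * m ^+ 2) <= _).
  rewrite ler_ln ?posrE ?mulr_gt0 ?exprn_gt0 ?ltr_wpDr ?sqr_ge0//.
  have h1 : 1 <= m ^+ 2 by rewrite exprn_ege1.
  have h2 : x ^+ 2 <= m ^+ 2 by rewrite lerXn2r ?nnegrE// ltW.
  by move: h1 h2; move: (m ^+ 2) (x ^+ 2) => *; lra.
rewrite lnM ?posrE ?exprn_gt0// lnXn// mulr_natl lerD2r.
by rewrite ln2_le1.
Qed.

Lemma measurable_dS r : 0 <= r < 1 -> measurable_fun setT (fun t => logplus (cmod (derive1 S (r%:C * expi t)))).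
Proof.
move=> r01; apply: measurableT_comp; first exact: measurable_logplus.
by apply: measurable_cmod; apply: cmeas_rpol => // z; exact: cder_dS.
Qed.

Lemma measurable_pd r : 0 <= r < 1 -> measurable_fun setT (fun t => logplus (cmod (pd (r%:C * expi t)))).
Proof.
move=> r01; apply: measurableT_comp; first exact: measurable_logplus.
apply: measurable_cmod; apply: cmeas_rpol => // z z1.
by have [d0 _ _] := pd_chain z1; eexists; exact: d0.
Qed.

Lemma measurable_herg r : 0 <= r < 1 -> measurable_fun setT (fun t => Re (herg (r%:C * expi t))).
Proof.
move=> r01; suff [] : cmeas (fun t => herg (r%:C * expi t)) by [].
by apply: cmeas_rpol => // z z1; eexists; exact: cder_herg.
Qed.

(** The factor exp(-p) of S' costs only the real part of p, whose circular
    means are constant; so p' inherits the Nevanlinna bound of S'. *)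
Lemma nevanlinna_pd : Nevanlinna (derive1 S) -> exists B r0, [/\ 0 <= r0 < 1 , 0 <= B &
  forall r, r0 < r < 1 ->
  (\int[lam]_(t in `[0%R, (2 * pi)%R]) (logplus (cmod (pd (r%:C * expi t))))%:E <= B%:E)%E].
Proof.
move=> [_ [l cvl]].
have l1 : (l%:E < (l + 1)%:E)%E by rewrite lte_fin ltrDl.
have nr : \forall r \near (1 : R)^'-, (circle_logplus (derive1 S) r < (l + 1)%:E)%E.
  suff nb : nbhs l%:E [set y : \bar R | (y < (l + 1)%:E)%E] by exact: cvl _ nb.
  apply: open_nbhs_nbhs; split => //; exact: open_ereal_lt_ereal.
have [e e0' He] := nr; have e0 : 0 < e := e0'.
pose r0 := Num.max (1 / 2) (1 - e / 2).
have r0l : 1 / 2 <= r0 by rewrite le_max lexx.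
have r0e : 1 - e / 2 <= r0 by rewrite le_max lexx orbT.
have r01 : r0 < 1 by rewrite gt_max; apply/andP; split; lra.
exists (2 * (`|l| + 1) + 2 * pi * mass), r0; split.
- by rewrite r01 andbT; lra.
- have h1 := mulr_ge0 (@pi_ge0 R) (mass_ge0 mu); have h2 := normr_ge0 l.
  by rewrite -mulrA; move: (pi * mass) (`|l|) h1 h2 => a b a0 b0; lra.
move=> r /andP[rr r1]; have r0' : 0 <= r < 1 by rewrite r1 andbT; lra.
have c1 : (circle_logplus (derive1 S) r < (l + 1)%:E)%E.
  apply: He; last exact: r1.
  by rewrite /ball_/= gtr0_norm ?subr_gt0//; move: rr r0e e0; clear; lra.
have mI : measurable (`[0, 2 * pi]%classic : set R) by exact: measurable_itv.
have mS : measurable_fun `[0, 2 * pi]%classic (fun t => (logplus (cmod (derive1 S (r%:C * expi t))))%:E).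
  by apply: measurable_funTS; apply/measurable_EFinP; exact: measurable_dS.
have mH : measurable_fun `[0, 2 * pi]%classic (fun t => (Re (herg (r%:C * expi t)))%:E).
  by apply: measurable_funTS; apply/measurable_EFinP; exact: measurable_herg.
have z1 t : cmod (r%:C * expi t) < 1 by rewrite cmod_rpol//; case/andP: r0'.
apply: (@le_trans _ _ (\int[lam]_(t in `[0%R, (2 * pi)%R])
   ((logplus (cmod (derive1 S (r%:C * expi t))))%:E + (Re (herg (r%:C * expi t)))%:E))%E).
  apply: ge0_le_integral => //.
  - by move=> t _; rewrite lee_fin logplus_ge0.
  - by apply: measurable_funTS; apply/measurable_EFinP; exact: measurable_pd.
  - exact: emeasurable_funD.
  - by move=> t _; rewrite -EFinD lee_fin; exact: (logplus_pd (z1 t)).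
rewrite ge0_integralD//; last 2 first.
- by move=> t _; rewrite lee_fin logplus_ge0.
- by move=> t _; rewrite lee_fin Re_herg_ge0.
rewrite EFinD; apply: leeD; last exact: herg_mean.
apply: (@le_trans _ _ (2%:E * circle_logplus (derive1 S) r)%E).
  rewrite /circle_logplus -ge0_integralZl//; last 2 first.
  - apply/measurable_EFinP; apply: measurable_funM => //; apply: measurable_funTS.
    by under eq_fun do rewrite rpolE; exact: measurable_dS.
  - by move=> t _; rewrite lee_fin mulr_ge0 ?logplus_ge0//; lra.
  apply: ge0_le_integral => //.
  - by move=> t _; rewrite lee_fin logplus_ge0.
  - apply/measurable_EFinP; apply: measurable_funM => //; apply: measurable_funM => //; apply: measurable_funTS.
    by under eq_fun do rewrite rpolE; exact: measurable_dS.
  - move=> t _; rewrite -EFinM lee_fin rpolE.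
    have := logplus_ge0 (cmod (derive1 S (r%:C * expi t))); move: (logplus _) => x x0.
    rewrite mulrCA ler_peMr//; lra.
apply: le_trans (lee_wpmul2l _ (ltW c1)) _; first by rewrite lee_fin.
by rewrite -EFinM lee_fin ler_wpM2l// lerD2r ler_norm.
Qed.

(** On circles near the boundary this is nevanlinna_pd, and inside p' is
    bounded. *)
Lemma nevanlinna_wlog : Nevanlinna (derive1 S) -> exists A, forall r, 0 <= r < 1 ->
  (\int[lam]_(t in `[0%R, (2 * pi)%R]) (wlog pd r t)%:E <= A%:E)%E.
Proof.
move=> /nevanlinna_pd[B [r0 [r01 B0 HB]]]; have [B' HB'] := pd_bounded r01.
have mI : measurable (`[0, 2 * pi]%classic : set R) by exact: measurable_itv.
have lI : lam `[0, 2 * pi]%classic = (2 * pi)%:E.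
  by rewrite lebesgue_measure_itv/= lte_fin two_pi_gt0 sube0.
have B'0 : 0 <= B'.
  have [+ _ _] := HB' 0 ltac:(by rewrite cmod0; case/andP: r01); apply: le_trans; exact: cmod_ge0.
have mw r : 0 <= r < 1 -> measurable_fun `[0, 2 * pi]%classic (fun t => (wlog pd r t)%:E).
  move=> rr; apply: measurable_funTS; apply/measurable_EFinP; apply: continuous_measurable_fun.
  exact: (continuous_wlog pd_chain rr).
have L0 : 0 <= ln (1 + B' ^+ 2) by rewrite ln_ge0// lerDl sqr_ge0.
have p0 := @two_pi_gt0 R.
exists (ln (1 + B' ^+ 2) * (2 * pi) + (2 * pi + 2 * B)) => r rr; have /andP[rr0 rr1] := rr.
have [rl|rl] := leP r r0.
  apply: (@le_trans _ _ (\int[lam]_(t in `[0%R, (2 * pi)%R]) (ln (1 + B' ^+ 2))%:E)%E).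
    apply: ge0_le_integral => //.
    - by move=> t _; rewrite lee_fin wlog_ge0.
    - exact: mw.
    - move=> t _; have [h _ _] := HB' (r%:C * expi t) ltac:(by rewrite cmod_rpol).
      rewrite lee_fin /wlog ler_ln ?posrE ?ltr_wpDr ?sqr_ge0//.
      by rewrite lerD2l lerXn2r ?nnegrE ?cmod_ge0.
  rewrite integral_cst// -[X in (_ * X)%E]/(lam _) lI -EFinM lee_fin lerDl.
  by apply: addr_ge0; [exact: ltW|exact: mulr_ge0].
apply: (@le_trans _ _ (\int[lam]_(t in `[0%R, (2 * pi)%R])
   (1%:E + 2%:E * (logplus (cmod (pd (r%:C * expi t))))%:E))%E).
  apply: ge0_le_integral => //.
  - by move=> t _; rewrite lee_fin wlog_ge0.
  - exact: mw.
  - apply: emeasurable_funD => //; apply: emeasurable_funM => //.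
    by apply: measurable_funTS; apply/measurable_EFinP; exact: measurable_pd.
  - by move=> t _; rewrite -EFinM -EFinD lee_fin; exact: wlog_logplus.
have mp : measurable_fun `[0, 2 * pi]%classic (fun t => (logplus (cmod (pd (r%:C * expi t))))%:E).
  by apply: measurable_funTS; apply/measurable_EFinP; exact: measurable_pd.
rewrite ge0_integralD//; last 2 first.
- by move=> t _; rewrite mule_ge0 ?lee_fin// logplus_ge0.
- exact: emeasurable_funM.
rewrite integral_cst// -[X in (1%:E * X + _)%E]/(lam _) lI mul1e ge0_integralZl//; last first.
  by move=> t _; rewrite lee_fin logplus_ge0.
rewrite EFinD; apply: le_trans (_ : (2 * pi + 2 * B)%:E <= _)%E; last first.
  by rewrite lee_fin lerDr mulr_ge0// ltW.
rewrite [leRHS]EFinD; apply: leeD => //; rewrite [leRHS](EFinM 2 B).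
by apply: lee_wpmul2l; [rewrite lee_fin|apply: HB; rewrite rl].
Qed.

End MeanBounds.

(** * Radial behaviour of Poisson integrals of singular measures *)

Section RadialZero.
Context {R : realType} (mu : {finite_measure set (plane R) -> \bar R}).
Implicit Types (s t r c : R) (z : R[i]).
Local Notation lam := (@lebesgue_measure R).
Local Notation herg := (herg mu).

(** One radius for each generation of Whitney boxes; points in between are
    compared with these by Harnack's inequality. *)
Definition rad (n : nat) : R := 1 - 2 ^- n.

Lemma rad01 n : 0 <= rad n < 1.
Proof. by rewrite subr_ge0 pow2N_le1 gtrBl pow2N_gt0. Qed.

Definition xr n t : R := Re (herg ((rad n)%:C * expi t)).

Lemma xr_ge0 n t : 0 <= xr n t.
Proof. by apply: Re_herg_ge0; have /andP[r0 r1] := rad01 n; rewrite cmod_rpol. Qed.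

Lemma measurable_xr n : measurable_fun setT (xr n).
Proof. exact: measurable_herg (rad01 n). Qed.

Lemma chord_lower s t c : 0 < c -> c <= `|t - s| <= 2 * pi - c ->
  c / 2 <= cmod (expi s - expi t).
Proof.
move=> c0 /andP[h1 h2].
have key (u : R) : c <= `|u - s| -> `|u - s| <= pi -> c / 2 <= cmod (expi s - expi u).
  by move=> g1 g2; have := @le_cmod_expiB R u s g2; rewrite cmodBC; move: (cmod _) => d; lra.
have [tp|tp] := leP `|t - s| pi; first exact: key.
have [ts|ts] := leP s t.
  have e : `|t - s| = t - s by rewrite ger0_norm// subr_ge0.
  have -> : expi t = expi (t - 2 * pi).
    by rewrite -[RHS]mulr1 -expi2pi -expiD subrK.
  have n : `|t - 2 * pi - s| = 2 * pi - `|t - s|.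
    by rewrite e ler0_norm; [ring|rewrite e in h2; lra].
  by apply: key; rewrite n; lra.
have e : `|t - s| = s - t by rewrite ltr0_norm ?subr_lt0// opprB.
have -> : expi t = expi (t + 2 * pi) by rewrite expiD expi2pi mulr1.
have n : `|t + 2 * pi - s| = 2 * pi - `|t - s|.
  by rewrite e ger0_norm; [ring|rewrite e in h2; lra].
by apply: key; rewrite n; lra.
Qed.

Lemma pois_far r s t c : 0 < c -> c <= `|t - s| <= 2 * pi - c -> 0 <= r < 1 -> 1 - r <= c / 4 ->
  pois r (pt s, t) <= 32 * (1 - r) / c ^+ 2.
Proof.
move=> c0 h /andP[r0 r1] rc; have h2 := chord_lower c0 h.
have h3 : c / 4 <= cmod (toC (pt s) - r%:C * expi t).
  have := cmod_tri (r%:C * expi t) (expi s) (expi t); rewrite -toC_pt.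
  have -> : cmod (r%:C * expi t - expi t) = 1 - r.
    rewrite (_ : _ - _ = (r - 1)%:C * expi t); last by rewrite rmorphB/=; ring.
    by rewrite cmodM cmod_expi mulr1 cmodR ler0_norm ?opprB// subr_le0 ltW.
  by move: h2; rewrite -toC_pt; move: (cmod (_ - expi t)) (cmod (_ - r%:C * _)) => *; lra.
have c4 : 0 < c / 4 by rewrite divr_gt0.
have h4 : (cmod (toC (pt s) - r%:C * expi t))^-1 ^+ 2 <= (c / 4)^-1 ^+ 2.
  rewrite lerXn2r ?nnegrE ?invr_ge0 ?cmod_ge0 ?(ltW c4)//.
  by rewrite lef_pV2 ?posrE//; exact: lt_le_trans h3.
apply: le_trans (_ : 2 * (1 - r) * (c / 4)^-1 ^+ 2 <= _).
  apply: ler_pM; rewrite ?sqr_ge0// ?subr_ge0 ?expr_le1 ?(ltW r1)//.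
  by move: r0 r1; clear; nra.
by rewrite le_eqVlt; apply/orP; left; apply/eqP; field; rewrite gt_eqF.
Qed.

(** Where the angles of A keep a positive distance to every point of the
    carrier, the Poisson kernels tend to zero. That distance depends on the
    point, so dominated convergence in mu is used, with bound 2 pi. *)
Lemma far_mean_cvg (N : set (plane R)) (A : set R) : measurable N -> N `<=` circle ->
  mu (circle `\` N) = 0%E -> measurable A -> A `<=` `[0, 2 * pi]%classic ->
  (forall p, N p -> exists s c, [/\ p = pt s, 0 < c & forall t, A t -> c <= `|t - s| <= 2 * pi - c]) ->
  (\int[lam]_(t in A) (xr n t)%:E)%E @[n --> \oo] --> 0%E.
Proof.
move=> mN Nc muN mA Asub HN; have mC := @measurable_circle R.
pose Phi n (p : plane R) : \bar R := (\int[lam]_(t in A) (pois (rad n) (p, t))%:E)%E.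
have Phi0 n p : (0 <= Phi n p)%E.
  by apply: integral_ge0 => t _; rewrite lee_fin pois_ge0// rad01.
have mPhi n : measurable_fun setT (Phi n).
  pose f (x : plane R * R) : \bar R := (pois (rad n) x * \1_A x.2)%:E.
  have f0 x : (0 <= f x)%E by rewrite lee_fin mulr_ge0// pois_ge0// rad01.
  have mf : measurable_fun setT f.
    apply/measurable_EFinP; apply: measurable_funM; first exact: measurable_pois.
    by apply: measurableT_comp; [exact: measurable_indic|exact: measurable_snd].
  have -> : Phi n = (fun p => \int[lam]_t f (p, t))%E.
    apply/funext => p; rewrite /Phi integral_mkcond; apply: eq_integral => t _.
    by rewrite /patch /f/= indicE; case: ifP => _; rewrite ?mulr1 ?mulr0.
  exact: measurable_fun_fubini_tonelli_F.
have xE n : (\int[lam]_(t in A) (xr n t)%:E = \int[mu]_(p in N) Phi n p)%E.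
  transitivity (\int[lam]_(t in A) \int[mu]_(p in circle) (pois (rad n) (p, t))%:E)%E.
    by apply: eq_integral => t _; rewrite Re_herg_pois// rad01.
  rewrite (@tonelli_circle _ mu (pois (rad n)))//; last 2 first.
  - exact: measurable_pois.
  - by move=> x; rewrite pois_ge0// rad01.
  rewrite -[LHS]/(\int[mu]_(p in circle) Phi n p)%E.
  transitivity (\int[mu]_(p in circle `\` (circle `\` N)) Phi n p)%E.
    apply: ge0_negligible_integral => //; first exact: measurableD.
    exact: measurable_funTS.
  by congr integral; rewrite setDD; apply/seteqP; split => [p []//|p Np]; split => //; exact: Nc.
rewrite (_ : (fun n => _) = (fun n => \int[mu]_(p in N) Phi n p)%E); last exact/funext.
suff : (\int[mu]_(p in N) Phi n p)%E @[n --> \oo] --> (\int[mu]_(p in N) cst 0%E p)%E.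
  by rewrite integral0.
apply: (@dominated_cvg _ _ _ mu N mN Phi (cst 0%E) (cst (2 * pi)%:E)) => //.
- by move=> n; apply: measurable_funTS.
- move=> p /HN[s [c [pE c0 Hc]]].
  pose C : R := 32 / c ^+ 2 * (2 * pi).
  have up : \forall n \near \oo, (0 <= Phi n p <= (C * (1 / 2) ^+ n)%:E)%E.
    have [n0 Hn0] := @pow2_below R (c / 4) ltac:(by rewrite divr_gt0).
    exists n0 => // n /= n0n; rewrite Phi0/=.
    have rc : 1 - rad n <= c / 4.
      rewrite /rad opprB addrCA subrr addr0; apply: le_trans Hn0.
      by rewrite lef_pV2 ?posrE ?exprn_gt0// ler_weXn2l// ler1n.
    apply: (@le_trans _ _ (\int[lam]_(t in A) (32 * (1 - rad n) / c ^+ 2)%:E)%E).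
      apply: ge0_le_integral => //.
      - by move=> t _; rewrite lee_fin pois_ge0// rad01.
      - apply/measurable_EFinP; apply: measurable_funTS.
        exact: (measurableT_comp (measurable_pois (rad n)) (measurable_pair1 p)).
      - by move=> t At; rewrite lee_fin pE; apply: pois_far => //; [exact: Hc|exact: rad01].
    rewrite integral_cst//.
    have lA : (lam A <= (2 * pi)%:E)%E.
      apply: (@le_trans _ _ (lam `[0, 2 * pi]%classic)).
        by apply: le_measure; rewrite ?inE//; exact: measurable_itv.
      by rewrite lebesgue_measure_itv/= lte_fin two_pi_gt0 sube0.
    apply: le_trans (lee_wpmul2l _ lA) _.
      by rewrite lee_fin divr_ge0 ?sqr_ge0// mulr_ge0// subr_ge0 ltW//; have /andP[] := rad01 n.
    rewrite -EFinM lee_fin /C /rad opprB addrCA subrr addr0 expr_div_n expr1n mul1r.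
    by rewrite le_eqVlt; apply/orP; left; apply/eqP; ring.
  have up' : \forall n \near \oo, (cst 0 n <= Phi n p <= (C * (1 / 2) ^+ n)%:E)%E by [].
  rewrite -[cst _ p]/(0%E : \bar R); apply: (squeeze_cvge up').
    exact: cvg_cst.
  by apply: cvg_EFin; [exact: nearW|apply: (@cvg_geometric R C (1 / 2)); rewrite ger0_norm//; lra].
- apply: (integrableS mC) => //; apply/integrableP; split => //.
  rewrite (eq_integral (cst (2 * pi)%:E)); last by move=> p _; rewrite /= ger0_norm// mulr_ge0// pi_ge0.
  rewrite integral_cst// lte_mul_pinfty ?lee_fin ?mulr_ge0 ?pi_ge0//.
  exact: mu_circle_fin.
- move=> n p Np; rewrite gee0_abs//=.
  have [s [c [pE _ _]]] := HN p Np.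
  apply: (@le_trans _ _ (\int[lam]_(t in `[0%R, (2 * pi)%R]) (pker (rad n) (t - s))%:E)%E); last first.
    by rewrite pker_total// rad01.
  rewrite /Phi pE; under eq_integral do rewrite pois_pker.
  apply: ge0_subset_integral => //.
    apply/measurable_EFinP; apply: measurable_funTS; apply: continuous_measurable_fun.
    move=> t; apply: (@continuous_comp _ _ _ (fun x => x - s) (pker (rad n))); last by apply: continuous_pker; exact: rad01.
    by apply: cvgB; [exact: cvg_id|exact: cvg_cst].
  by move=> t _; rewrite lee_fin ltW// pker_gt0// rad01.
Qed.

(** Chebyshev's inequality: the means tend to zero but are at least e times the
    measure of the set. *)
Lemma persistent_null (A : set R) (e : R) M : 0 < e -> measurable A ->
  (\int[lam]_(t in A) (xr n t)%:E)%E @[n --> \oo] --> 0%E ->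
  lam (A `&` [set t | forall n, (M <= n)%N -> e <= xr n t]) = 0%E.
Proof.
move=> e0 mA cv; set F := [set t | _].
have mF : measurable F.
  have -> : F = \bigcap_(n in [set n | (M <= n)%N]) (xr n @^-1` `[e, +oo[%classic).
    by apply/seteqP; split => t H n Mn /=; [rewrite in_itv/= andbT; exact: H|move: (H n Mn); rewrite /= in_itv/= andbT].
  apply: bigcap_measurable; first by exists M => /=.
  by move=> n _; rewrite -[X in measurable X]setTI; exact: measurable_xr.
have mAF : measurable (A `&` F) by exact: measurableI.
apply/eqP; rewrite eq_le measure_ge0 andbT; apply/lee_addgt0Pr => d d0; rewrite add0e.
have : \forall n \near \oo, (\int[lam]_(t in A) (xr n t)%:E < (d * e)%:E)%E.
  suff nb : nbhs 0%E [set y : \bar R | (y < (d * e)%:E)%E] by exact: cv _ nb.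
  apply: open_nbhs_nbhs; split; first exact: open_ereal_lt_ereal.
  by rewrite /= lte_fin mulr_gt0.
move=> [n0 _ Hn0]; set n := maxn n0 M.
have lt := Hn0 n (leq_maxl _ _).
rewrite -(@lee_pmul2l _ e%:E) ?lte_fin// -integral_cst//= -EFinM mulrC.
apply: le_trans (ltW lt).
apply: (@le_trans _ _ (\int[lam]_(t in A `&` F) (xr n t)%:E)%E).
  apply: ge0_le_integral => //.
  - by move=> t _; rewrite lee_fin ltW.
  - by apply/measurable_EFinP; apply: measurable_funTS; exact: measurable_xr.
  - by move=> t [_ Ft]; rewrite lee_fin; apply: Ft; exact: leq_maxr.
apply: ge0_subset_integral => //.
- by apply/measurable_EFinP; apply: measurable_funTS; exact: measurable_xr.
- by move=> t _; rewrite lee_fin xr_ge0.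
Qed.

(** Off an open neighbourhood of small length of the carrier, the means of Re p
    tend to zero. Thus the angles along which Re p stays above a positive level
    form, up to a null set, a subset of such neighbourhoods. *)
Lemma radial_liminf0 : singular mu ->
  lam.-negligible (turn `&` [set t | exists e M, 0 < e /\ forall n, (M <= n)%N -> e <= xr n t]).
Proof.
move=> [N [mN Nc N0 muN]].
have null e M : 0 < e -> lam (turn `&` [set t | forall n, (M <= n)%N -> e <= xr n t]) = 0%E.
  move=> e0; set F := [set t | _].
  apply/eqP; rewrite eq_le measure_ge0 andbT; apply/lee_addgt0Pr => d d0; rewrite add0e.
  have mNa := measurable_angles mN.
  have l0 : (lam (angles N) < +oo)%E by rewrite -[lam _]/(arc_length N) N0.
  have [U [oU NU lU]] := lebesgue_regularity_outer mNa l0 (divr_gt0 d0 (ltr0n _ 4)).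
  (* The carrier may accumulate at the angle 0 from both sides, so the two ends
     of the period are removed as well. *)
  pose B2 : set R := ball (0 : R) (d / 8) `|` ball (2 * pi : R) (d / 8).
  pose V := U `|` B2.
  have d8 : 0 < d / 8 by rewrite divr_gt0.
  have oV : open V by apply: openU => //; apply: openU; exact: ball_open.
  have mV : measurable V by exact: open_measurable.
  have lV : (lam V <= d%:E)%E.
    have lUe : (lam U <= (d / 4)%:E)%E.
      have -> : U = angles N `|` (U `\` angles N) by rewrite setDUK.
      apply: le_trans (measureU2 _ _ _) _ => //.
        by apply: measurableD => //; exact: open_measurable.
      by rewrite -[X in (X + _)%E]/(arc_length N) N0 add0e; exact: ltW.
    have lB (x : R) : (lam (ball x (d / 8)) <= (d / 4)%:E)%E.
      by rewrite lebesgue_measure_ball ?(ltW d8)// lee_fin -mulr_natl; lra.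
    apply: le_trans (measureU2 _ _ _) _; [exact: open_measurable| |].
      by apply: measurableU; exact: measurable_ball.
    have l2 : (lam B2 <= (d / 4)%:E + (d / 4)%:E)%E.
      apply: le_trans (measureU2 _ _ _) _; try exact: measurable_ball.
      exact: leeD (lB _) (lB _).
    apply: le_trans (leeD lUe l2) _.
    by rewrite -!EFinD lee_fin; lra.
  pose A := turn `\` V.
  have mA : measurable A by apply: measurableD => //; exact: measurable_turn.
  have cv : (\int[lam]_(t in A) (xr n t)%:E)%E @[n --> \oo] --> 0%E.
    apply: (far_mean_cvg mN Nc muN mA).
      by move=> t [+ _]; rewrite /turn/= !in_itv/= => /andP[-> /ltW].
    move=> p Np; have [s /andP[s0 s2] pE] := circle_ptP (Nc _ Np).
    have Vs : V s by left; apply: NU; split; rewrite -?pE// s0.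
    have : nbhs s V by exact: open_nbhs_nbhs.
    move=> [c /= c0 Hc].
    have far t : A t -> c <= `|t - s|.
      move=> [_ nV]; rewrite leNgt; apply/negP => h; apply: nV; apply: Hc.
      by rewrite /ball_/= distrC.
    have tin t : A t -> 0 <= t < 2 * pi by move=> [+ _]; rewrite /turn/= in_itv.
    have [s00|sn] := eqVneq s 0.
      exists s, (d / 8); split => // t At; have /andP[t0 t2] := tin t At.
      rewrite s00 subr0 ger0_norm//; have [_ nV] := At; apply/andP; split.
        rewrite leNgt; apply/negP => h; apply: nV; right; left.
        by rewrite /ball/= sub0r normrN ger0_norm.
      rewrite leNgt; apply/negP => h; apply: nV; right; right.
      by rewrite /ball/= ger0_norm ?subr_ge0 1?ltW//; lra.
    have sp : 0 < s by rewrite lt0r sn.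
    exists s, (Num.min c (Num.min s (2 * pi - s))); split => //.
      by rewrite !lt_min c0 sp subr_gt0.
    move=> t At; have /andP[t0 t2] := tin t At; apply/andP; split.
      by rewrite ge_min far.
    have m1 : Num.min c (Num.min s (2 * pi - s)) <= s by rewrite !ge_min lexx orbT.
    have m2 : Num.min c (Num.min s (2 * pi - s)) <= 2 * pi - s by rewrite !ge_min lexx !orbT.
    by rewrite ler_norml; apply/andP; split; lra.
  have F0 := persistent_null M e0 mA cv.
  have mF : measurable F.
    have -> : F = \bigcap_(n in [set n | (M <= n)%N]) (xr n @^-1` `[e, +oo[%classic).
      by apply/seteqP; split => t H n Mn /=; [rewrite in_itv/= andbT; exact: H|move: (H n Mn); rewrite /= in_itv/= andbT].
    apply: bigcap_measurable; first by exists M => /=.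
    by move=> n _; rewrite -[X in measurable X]setTI; exact: measurable_xr.
  apply: (@le_trans _ _ (lam ((A `&` F) `|` V))).
    apply: le_measure; rewrite ?inE.
    - by apply: measurableI => //; exact: measurable_turn.
    - by apply: measurableU => //; exact: measurableI.
    - by move=> t [tt Ft]; case: (pselect (V t)) => h; [right|left].
  apply: le_trans (measureU2 _ _ _) _ => //; first exact: measurableI.
  by rewrite -[X in (X + _)%E]/(lam (A `&` F)) F0 add0e.
have sub : turn `&` [set t | exists e M, 0 < e /\ forall n, (M <= n)%N -> e <= xr n t] `<=`
    \bigcup_k \bigcup_M (turn `&` [set t | forall n, (M <= n)%N -> k.+1%:R^-1 <= xr n t]).
  move=> t [tt [e [M [e0 H]]]].
  have [k /= _ /(_ k (leqnn _)) Hk] := near_infty_natSinv_lt (PosNum e0).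
  exists k => //; exists M => //; split => // n Mn.
  by apply: le_trans (H n Mn); exact: ltW.
suff [Z [mZ Z0 sZ]] : lam.-negligible
    (\bigcup_k \bigcup_M (turn `&` [set t | forall n, (M <= n)%N -> k.+1%:R^-1 <= xr n t])).
  by exists Z; split => //; exact: subset_trans sub sZ.
apply: negligible_bigcup => k; apply: negligible_bigcup => M.
exists (turn `&` [set t | forall n, (M <= n)%N -> k.+1%:R^-1 <= xr n t]); split => //.
- apply: measurableI; first exact: measurable_turn.
  have -> : [set t | forall n, (M <= n)%N -> k.+1%:R^-1 <= xr n t] =
      \bigcap_(n in [set n | (M <= n)%N]) (xr n @^-1` `[k.+1%:R^-1, +oo[%classic).
    by apply/seteqP; split => t H n Mn /=; [rewrite in_itv/= andbT; exact: H|move: (H n Mn); rewrite /= in_itv/= andbT].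
  apply: bigcap_measurable; first by exists M => /=.
  by move=> n _; rewrite -[X in measurable X]setTI; exact: measurable_xr.
- by apply: null; rewrite invr_gt0.
Qed.

End RadialZero.

(** * Estimates along one radius *)

Section GoodRadius.
Context {R : realType} (mu : {finite_measure set (plane R) -> \bar R}).
Implicit Types (s t r : R) (z : R[i]).
Local Notation lam := (@lebesgue_measure R).
Local Notation herg := (herg mu).
Local Notation qd := (qd mu).
Local Notation K := (K mu).

(** The mean value theorem along the radius. *)
Lemma herg_lipschitz t (M a b : R) : 1 / 2 <= a -> a <= b -> b < 1 ->
  (forall r, 1 / 2 <= r < 1 -> cmod (pd mu (r%:C * expi t)) <= M) ->
  Re (herg (a%:C * expi t)) - Re (herg (b%:C * expi t)) <= M * (b - a).
Proof.
move=> a0 ab b1 HM; move: ab; rewrite le_eqVlt => /orP[/eqP ->|ab].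
  by rewrite !subrr mulr0.
pose f r := Re (herg (r%:C * expi t)).
have df r : 0 <= r < 1 -> is_derive r 1 f (Re (pd mu (r%:C * expi t) * expi t)).
  move=> /andP[r0 r1].
  have dh := cder_herg mu (z := r%:C * expi t) ltac:(by rewrite cmod_rpol).
  by have [] := @vder_comp R herg (fun s => s%:C * expi t) r _ _ dh (vder_rpol1 r t).
have r01 r : a <= r <= b -> 0 <= r < 1 by move=> /andP[h1 h2]; apply/andP; split; lra.
have [c cI E] := @MVT R f (fun r => Re (pd mu (r%:C * expi t) * expi t)) a b ab
  ltac:(by move=> r; rewrite in_itv/= => /andP[/ltW h1 /ltW h2]; apply: df; apply: r01; rewrite h1)
  ltac:(by apply: derivable_within_continuous => r; rewrite in_itv/= => h; have [] := df r (r01 r h)).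
have /andP[ac cb] : a < c < b by move: cI; rewrite in_itv.
rewrite -[Re (herg (a%:C * _))]/(f a) -[Re (herg (b%:C * _))]/(f b) -(opprB (f b) (f a)).
rewrite E -mulNr ler_wpM2r ?subr_ge0 ?(ltW ab)//.
apply: le_trans (ler_norm _) _; rewrite normrN; apply: le_trans (ler_Re_cmod _) _.
rewrite cmodM cmod_expi mulr1; apply: HM; rewrite (lt_trans cb b1) andbT.
by apply: le_trans a0 _; exact: ltW.
Qed.

(** Since Re p comes arbitrarily close to 0 far out and has slope at most M,
    it is at most M (1 - r). Division by 1 - r^2 bounds q. *)
Lemma qd_radial_bound t (M : R) : 0 <= M ->
  (forall r, 1 / 2 <= r < 1 -> cmod (pd mu (r%:C * expi t)) <= M) ->
  (forall e m, 0 < e -> exists2 n, (m <= n)%N & xr mu n t < e) ->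
  forall r, 1 / 2 <= r < 1 -> qd (r%:C * expi t) <= M.
Proof.
move=> M0 HM Hx r /andP[r0 r1].
have d0 : 0 < 1 - r by rewrite subr_gt0.
have xb : Re (herg (r%:C * expi t)) <= M * (1 - r).
  apply/ler_addgt0Pr => e e0; have [m Hm] := @pow2_below R _ d0.
  have [n mn xe] := Hx e m e0.
  have rn : r <= rad n.
    rewrite /rad lerBrDr -lerBrDl; apply: le_trans Hm.
    by rewrite lef_pV2 ?posrE ?exprn_gt0// ler_weXn2l// ler1n.
  have /andP[_ n1] := @rad01 R n.
  have L := herg_lipschitz r0 rn n1 HM.
  have L2 : M * (rad n - r) <= M * (1 - r) by rewrite ler_wpM2l// lerD2r ltW.
  by move: L xe L2; rewrite /xr; move: (Re _) (Re _) => *; lra.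
have r0' : 0 <= r by lra.
move: xb; rewrite Re_herg ?cmod_rpol// => xb.
have q0 := qd_ge0 mu (r%:C * expi t).
rewrite -(ler_pM2l d0); apply: le_trans (_ : (1 - r ^+ 2) * qd (r%:C * expi t) <= _).
  by apply: ler_wpM2r => //; move: r0' r1; clear; nra.
by rewrite (mulrC (1 - r) M).
Qed.

(** Put D = |eta - r z|^2 for unimodular eta and z. Then
    1 / D + Re (z eta / (eta - r z)^2) = (1 - r)^2 (1 + cos (s - t)) / D^2.
    This is small because z eta / (eta - z)^2 is the negative number
    - 1 / |eta - z|^2 on the circle. *)
Lemma kernel_defect r s t : 0 <= r < 1 ->
  (cmod (toC (pt s) - r%:C * expi t))^-1 ^+ 2 - 2 * ((1 - r) ^+ 2 * (cmod (toC (pt s) - r%:C * expi t))^-1 ^+ 4)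
  <= Re (- expi t * kern 2 (r%:C * expi t) (pt s)).
Proof.
move=> r01; have /andP[r0 r1] := r01.
set w := toC (pt s) - r%:C * expi t.
have w0 : 0 < cmod w.
  apply: lt_le_trans (dist_circle _ (circle_pt s)); rewrite cmod_rpol//; by rewrite subr_gt0.
have wn : w != 0 by rewrite -cmod_gt0.
pose e := expi (s - t).
have ee : toC (pt s) = expi t * e by rewrite toC_pt /e -expiD addrCA subrr addr0.
have wE : w = expi t * (e - r%:C) by rewrite /w ee; ring.
have ne : expi t != 0 := expi_neq0 t.
have en : e - r%:C != 0 by move: wn; rewrite wE mulf_eq0 negb_or => /andP[].
have -> : - expi t * kern 2 (r%:C * expi t) (pt s) = - (e * (e - r%:C)^-1 ^+ 2).
  by rewrite /kern -/w wE ee; field; rewrite ne en.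
have cw : cmod w = cmod (e - r%:C) by rewrite wE cmodM cmod_expi mul1r.
set D := cmod (e - r%:C) ^+ 2; have D0 : 0 < D by rewrite exprn_gt0// -cw.
have DE : D = 1 - 2 * r * cos (s - t) + r ^+ 2.
  transitivity (cos (s - t) ^+ 2 + sin (s - t) ^+ 2 - 2 * r * cos (s - t) + r ^+ 2).
    by rewrite /D cmod_sqr /e /expi/=; ring.
  by rewrite cos2Dsin2.
have inv : (e - r%:C)^-1 = D^-1%:C * ((cos (s - t) - r) +i* (- sin (s - t))).
  have -> : (e - r%:C) = (cos (s - t) - r) +i* sin (s - t).
    by rewrite /e /expi; apply/eqP; rewrite eq_complex/= subr0 !eqxx.
  rewrite /D cmod_sqr /e /expi /=; apply/eqP; rewrite eq_complex/=; apply/andP; split; apply/eqP; rewrite ?subr0; ring.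
rewrite cw exprVn -/D (_ : (cmod (e - r%:C))^-1 ^+ 4 = D^-1 ^+ 2); last first.
  by rewrite /D -exprVn -exprM.
have -> : Re (- (e * (e - r%:C)^-1 ^+ 2)) = D^-1 ^+ 2 * (2 * r - (1 + r ^+ 2) * cos (s - t)).
  rewrite inv /e /expi /=; move: (cos2Dsin2 (s - t)); move: (cos _) (sin _) (D^-1) => u v k uv.
  by rewrite !expr2/=; have h : v * v = 1 - u * u; [rewrite -uv; ring|]; transitivity
    (k * k * (- (u * ((u - r) * (u - r)) + 2 * (u - r) * (v * v) - u * (v * v)))); [ring|rewrite h; ring].
rewrite -subr_ge0 (_ : _ - _ = D^-1 ^+ 2 * ((1 - r) ^+ 2 * (1 - cos (s - t)))).
  by rewrite mulr_ge0 ?sqr_ge0// mulr_ge0 ?sqr_ge0// subr_ge0 cos_le1.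
have kD : D^-1 = D^-1 ^+ 2 * D by field; rewrite gt_eqF.
transitivity (D^-1 ^+ 2 * (2 * r - (1 + r ^+ 2) * cos (s - t)) -
    (D^-1 ^+ 2 * D - 2 * ((1 - r) ^+ 2 * D^-1 ^+ 2))); first by rewrite -kD.
by move: (D^-1) => k; rewrite DE; ring.
Qed.

(** The error integral of the comparison between q and |p'|. *)
Definition qd4 z : R := \int[mu]_(p in circle) (cmod (toC p - z))^-1 ^+ 4.

Lemma inv_dist4_integrable z : cmod z < 1 ->
  mu.-integrable circle (EFin \o (fun p => (cmod (toC p - z))^-1 ^+ 4)).
Proof.
move=> z1; apply: (@bounded_circle_integrable _ _ _ ((1 - cmod z)^-1 ^+ 4)).
  exact: measurable_inv_dist.
by move=> p Cp; rewrite ger0_norm ?exprn_ge0 ?invr_ge0 ?cmod_ge0//; exact: inv_dist_bound.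
Qed.

(** The real part of - z p' is compared with 2 q by integrating the defect of
    the kernels. *)
Lemma qd_pd r t : 0 <= r < 1 ->
  2 * qd (r%:C * expi t) - 4 * ((1 - r) ^+ 2 * qd4 (r%:C * expi t)) <= cmod (pd mu (r%:C * expi t)).
Proof.
move=> r01; set z := r%:C * expi t; have z1 : cmod z < 1 by rewrite cmod_rpol; case/andP: r01.
have mC := @measurable_circle R; have i2 := inv_dist_integrable mu z1; have i4 := inv_dist4_integrable z1.
have bk := bfun_kern 2 z1.
have C1 : Re (- expi t * K 2 z) = \int[mu]_(p in circle) Re (- expi t * kern 2 z p).
  by rewrite -(CintZ mu (- expi t) bk).
have i4' : mu.-integrable circle (EFin \o (fun p => 2 * (1 - r) ^+ 2 * (cmod (toC p - z))^-1 ^+ 4)).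
  exact: (integrableZl mC (2 * (1 - r) ^+ 2) i4).
have iB : mu.-integrable circle (EFin \o (fun p => (cmod (toC p - z))^-1 ^+ 2 - 2 * (1 - r) ^+ 2 * (cmod (toC p - z))^-1 ^+ 4)).
  exact: (integrableB mC i2 i4').
have E : qd z - 2 * (1 - r) ^+ 2 * qd4 z =
    \int[mu]_(p in circle) ((cmod (toC p - z))^-1 ^+ 2 - 2 * (1 - r) ^+ 2 * (cmod (toC p - z))^-1 ^+ 4).
  by rewrite RintegralB// RintegralZl.
have le : qd z - 2 * (1 - r) ^+ 2 * qd4 z <= Re (- expi t * K 2 z).
  rewrite E C1; apply: le_Rintegral => //.
    exact: (bfun_integrable_Re mu (bfunM (bfun_cst (- expi t)) bk)).
  move=> p Cp; have [s _ ->] := circle_ptP Cp.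
  by have := @kernel_defect r s t r01; rewrite (mulrA 2).
have : Re (- expi t * K 2 z) <= cmod (K 2 z).
  apply: le_trans (ler_norm _) _; apply: le_trans (ler_Re_cmod _) _.
  by rewrite cmodM cmodN cmod_expi mul1r.
rewrite /pd cmodM (@cmod_nat R 2) => h; have h2 := le_trans le h.
rewrite (_ : 2 * _ - _ = 2 * (qd z - 2 * (1 - r) ^+ 2 * qd4 z)); last by ring.
by rewrite ler_wpM2l.
Qed.

(** The integrals v_n of 1 / (4^-n + |eta - z|^2) increase with n; their
    increments dominate the defect 4^-n qd4, which therefore tends to zero as
    soon as the v_n stay bounded. *)
Definition vn n t : R := \int[mu]_(p in circle) (4 ^- n + cmod (toC p - expi t) ^+ 2)^-1.

Lemma pow4E n : 4 ^- n = (2 ^- n) ^+ 2 :> R.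
Proof. by rewrite -exprVn -[in RHS]exprVn -exprM mulnC exprM; congr (_ ^+ _); field. Qed.

Lemma vn_pos n t (p : plane R) : 0 < 4 ^- n + cmod (toC p - expi t) ^+ 2.
Proof. by rewrite ltr_wpDr ?sqr_ge0// invr_gt0 exprn_gt0. Qed.

Lemma vn_integrable n t :
  mu.-integrable circle (EFin \o (fun p => (4 ^- n + cmod (toC p - expi t) ^+ 2)^-1)).
Proof.
apply: (@bounded_circle_integrable _ _ _ (4 ^+ n)).
  apply: (measurableT_comp measurable_realV); apply: measurable_funD => //.
  apply: measurable_funX; apply: measurable_cmod.
  by apply: cmeasB; [exact: cmeas_toC|exact: cmeas_cst].
move=> p _; rewrite ger0_norm; last by rewrite invr_ge0 ltW// vn_pos.
rewrite -[leRHS]invrK lef_pV2 ?posrE ?vn_pos ?invr_gt0 ?exprn_gt0//.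
by rewrite lerDl sqr_ge0.
Qed.

Lemma rad_dist n t (p : plane R) : circle p ->
  [/\ 2 ^- n <= cmod (toC p - (rad n)%:C * expi t),
   cmod (toC p - (rad n)%:C * expi t) <= cmod (toC p - expi t) + 2 ^- n &
   cmod (toC p - expi t) <= cmod (toC p - (rad n)%:C * expi t) + 2 ^- n].
Proof.
move=> Cp; have /andP[r0 r1] := @rad01 R n.
have e : cmod (expi t - (rad n)%:C * expi t) = 2 ^- n.
  rewrite (_ : _ - _ = (2 ^- n)%:C * expi t); last by rewrite /rad rmorphB/=; ring.
  by rewrite cmod_rpol// ltW// pow2N_gt0.
split.
- have := dist_circle ((rad n)%:C * expi t) Cp.
  by rewrite cmod_rpol// /rad opprB addrCA subrr addr0.
- by have := cmod_tri (expi t) (toC p) ((rad n)%:C * expi t); rewrite e.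
- by have := cmod_tri ((rad n)%:C * expi t) (toC p) (expi t); rewrite (cmodBC (_ * _)) e.
Qed.

Lemma vn_bound n t : vn n t <= 2 * qd ((rad n)%:C * expi t).
Proof.
have /andP[r0 r1] := @rad01 R n; have mC := @measurable_circle R.
have z1 : cmod ((rad n)%:C * expi t) < 1 by rewrite cmod_rpol.
have i2 := inv_dist_integrable mu z1.
rewrite /qd -RintegralZl//; apply: le_Rintegral => //.
- exact: vn_integrable.
- exact: (integrableZl mC 2 i2).
- move=> p Cp; have [h1 h2 _] := rad_dist n t Cp.
  have pw := pow2N_gt0 (R := R) n; have d0 := cmod_ge0 (toC p - expi t).
  move: h1 h2 d0 pw; rewrite pow4E; set a := cmod (_ - _ * _); set d := cmod _; set y := 2 ^- n.
  move=> h1 h2 d0 y0; have a0 : 0 < a by apply: lt_le_trans h1.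
  rewrite exprVn -[2]invrK -invfM lef_pV2 ?posrE ?divr_gt0 ?exprn_gt0//; last first.
  - by rewrite mulr_gt0 ?invr_gt0 ?exprn_gt0.
  - by rewrite ltr_wpDr ?sqr_ge0// exprn_gt0.
  have : a ^+ 2 <= (d + y) ^+ 2 by rewrite lerXn2r ?nnegrE ?(ltW a0)// addr_ge0// ltW.
  have : 0 <= (d - y) ^+ 2 by exact: sqr_ge0.
  by rewrite sqrrB sqrrD; move: (a ^+ 2) (d ^+ 2) (y ^+ 2) (d * y) => *; lra.
Qed.

(** For a single mass point the increment and the left-hand side are both
    comparable to 4^-n / (4^-n + |eta - z|^2)^2. *)
Lemma vn_increment n t :
  4 ^- n * qd4 ((rad n)%:C * expi t) <= 34 * (vn n.+1 t - vn n t).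
Proof.
have /andP[r0 r1] := @rad01 R n; have mC := @measurable_circle R.
have z1 : cmod ((rad n)%:C * expi t) < 1 by rewrite cmod_rpol.
have i4 := inv_dist4_integrable z1.
have iB := integrableB mC (vn_integrable n.+1 t) (vn_integrable n t).
rewrite -RintegralZl// /vn -RintegralB//; try exact: vn_integrable.
rewrite -RintegralZl//; apply: le_Rintegral => //.
- exact: (integrableZl mC (4 ^- n) i4).
- exact: (integrableZl mC 34 iB).
- move=> p Cp; have [h1 _ h2] := rad_dist n t Cp.
  have pw := pow2N_gt0 (R := R) n; have d0 := cmod_ge0 (toC p - expi t).
  have e4 : 4 ^- n.+1 = 4 ^- n / 4 :> R by rewrite exprS invfM mulrC.
  rewrite e4; move: h1 h2 d0 pw; rewrite pow4E; set a := cmod (_ - _ * _); set d := cmod _; set y := 2 ^- n.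
  move=> h1 h2 d0 y0; have a0 : 0 < a by apply: lt_le_trans h1.
  set Y := y ^+ 2; set Q := d ^+ 2; have Y0 : 0 < Y by rewrite exprn_gt0.
  have Q0 : 0 <= Q by exact: sqr_ge0.
  have key : Y + Q <= 5 * a ^+ 2.
    have g1 : Y <= a ^+ 2 by rewrite lerXn2r ?nnegrE ?(ltW y0) ?(ltW a0).
    have g2 : Q <= (2 * a) ^+ 2.
      by rewrite lerXn2r ?nnegrE ?mulr_ge0 ?(ltW a0)//; lra.
    by move: g1 g2; rewrite exprMn; move: (a ^+ 2) => *; lra.
  have a2 : 0 < a ^+ 2 by exact: exprn_gt0.
  have YQ : 0 < Y + Q by lra.
  have YQ4 : 0 < Y / 4 + Q by lra.
  have -> : (Y / 4 + Q)^-1 - (Y + Q)^-1 = 3 / 4 * Y / ((Y / 4 + Q) * (Y + Q)).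
    by field; rewrite !gt_eqF// ; lra.
  have -> : a^-1 ^+ 4 = ((a ^+ 2) * (a ^+ 2))^-1 by rewrite exprVn; congr _^-1; ring.
  have -> : 34 * (3 / 4 * Y / ((Y / 4 + Q) * (Y + Q))) = Y * (102 / 4 / ((Y / 4 + Q) * (Y + Q))).
    by field; rewrite !gt_eqF// ; lra.
  apply: ler_wpM2l; first exact: ltW.
  rewrite ler_pdivlMr ?mulr_gt0// ler_pdivrMl ?mulr_gt0//.
  apply: le_trans (_ : (Y + Q) * (Y + Q) <= _).
    by apply: ler_wpM2r; lra.
  apply: le_trans (_ : (5 * a ^+ 2) * (5 * a ^+ 2) <= _); first by apply: ler_pM => //; exact: ltW.
  by have : 0 <= a ^+ 2 * a ^+ 2; [exact: mulr_ge0 (ltW a2) (ltW a2)|]; move: (a ^+ 2) => A; nra.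
Qed.

End GoodRadius.

(** * Counting the scales where Re p is large *)

Section CountingScales.
Context {R : realType} (mu : {finite_measure set (plane R) -> \bar R}).
Implicit Types (s t r : R) (z : R[i]).
Local Notation lam := (@lebesgue_measure R).
Local Notation herg := (herg mu).
Local Notation qd := (qd mu).
Local Notation S := (singular_inner mu).

Definition prad n t : R := cmod (pd mu ((rad n)%:C * expi t)).

Lemma rad_half n : (0 < n)%N -> 1 / 2 <= (rad n : R) < 1.
Proof.
case: n => // n _; have /andP[_ ->] := @rad01 R n.+1; rewrite andbT /rad.
have : 2 ^- n.+1 <= 1 / 2 :> R by rewrite exprS invfM mul1r ler_piMr// pow2N_le1.
lra.
Qed.

(** The sequence v_n increases and is bounded by 2 M, so its increments tend
    to zero. *)
Lemma defect_cvg t (M : R) : (forall r, 1 / 2 <= r < 1 -> qd (r%:C * expi t) <= M) ->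
  exists n0, forall n, (n0 <= n)%N -> 4 ^- n * qd4 mu ((rad n)%:C * expi t) <= 1 / 8.
Proof.
move=> HM; pose v n := vn mu n.+1 t.
have q4 n : 0 <= 4 ^- n * qd4 mu ((rad n)%:C * expi t).
  rewrite mulr_ge0 ?invr_ge0 ?exprn_ge0//; apply: Rintegral_ge0 => p _.
  by rewrite exprn_ge0// invr_ge0 cmod_ge0.
have nd : nondecreasing_seq v.
  apply/nondecreasing_seqP => n; rewrite -subr_ge0 -(pmulr_rge0 _ (ltr0n R 34)).
  exact: le_trans (q4 n.+1) (vn_increment mu n.+1 t).
have ub n : v n <= 2 * M.
  apply: le_trans (vn_bound mu n.+1 t) _; rewrite ler_wpM2l//; apply: HM.
  exact: rad_half.
have cv : cvgn v.
  by apply: nondecreasing_is_cvgn => //; exists (2 * M) => _ [n _ <-].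
have e0 : 0 < 1 / 8 / 8 / 9 :> R by rewrite !divr_gt0.
have /cvgrPdist_lt/(_ _ e0)[n0 _ Hn0] := cv.
exists n0.+1 => n n0n; case: n n0n => // n n0n.
apply: le_trans (vn_increment mu n.+1 t) _; rewrite -/(v n.+1) -/(v n).
have := Hn0 n n0n; have := Hn0 n.+1 (leqW n0n).
rewrite /= !ltr_norml => /andP[a1 a2] /andP[b1 b2]; move: a1 a2 b1 b2.
by move: (limn v) (v n) (v n.+1) => *; lra.
Qed.

(** Going inwards, |eta - r z| cannot decrease by more than a factor 2. *)
Lemma qd_rad_le j n t : (j <= n)%N -> qd ((rad j)%:C * expi t) <= 4 * qd ((rad n)%:C * expi t).
Proof.
move=> jn; have /andP[j0 j1] := @rad01 R j; have /andP[n0 n1] := @rad01 R n.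
rewrite (_ : 4 = (1 + 1) ^+ 2 :> R); last by ring.
apply: qd_harnack; rewrite ?cmod_rpol// mul1r.
have rjn : rad j <= rad n :> R.
  by rewrite /rad lerD2l lerN2 lef_pV2 ?posrE ?exprn_gt0// ler_weXn2l// ler1n.
rewrite cmodBC -mulrBl -rmorphB.
by rewrite cmod_rpol ?subr_ge0// lerD2r ltW.
Qed.

(** Far out 2 q <= |p'| + 1 / 2; this value of q also dominates q at all
    previous scales. *)
Lemma xr_bound t (M : R) : (forall r, 1 / 2 <= r < 1 -> qd (r%:C * expi t) <= M) ->
  exists n0, forall n j, (n0 <= n)%N -> (j <= n)%N ->
    xr mu j t <= 2 * 2 ^- j * (2 * prad n t + 1).
Proof.
move=> HM; have [n0 Hn0] := defect_cvg HM; exists n0 => n j n0n jn.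
have /andP[j0 j1] := @rad01 R j.
have z1 : cmod ((rad j)%:C * expi t) < 1 by rewrite cmod_rpol.
rewrite /xr Re_herg// cmod_rpol//.
have q0 := qd_ge0 mu ((rad j)%:C * expi t).
apply: ler_pM => //; first by rewrite subr_ge0 expr_le1// ltW.
  rewrite (_ : 2 ^- j = 1 - rad j); last by rewrite /rad opprB addrCA subrr addr0.
  by move: j0 j1; clear; move: (rad j) => x *; nra.
apply: le_trans (qd_rad_le t jn) _.
have h1 := qd_pd mu t (@rad01 R n); have h2 := Hn0 n n0n.
move: h1; rewrite (_ : (1 - rad n) ^+ 2 = 4 ^- n); last first.
  by rewrite /rad opprB addrCA subrr addr0 pow4E.
rewrite -/(prad n t); move: h2; move: (4 ^- n * _) (qd _) (prad n t) => *; lra.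
Qed.

Definition scount (kappa : R) N t : R := \sum_(j < N) (kappa <= xr mu j t)%R%:R.

Lemma count_le (N : nat) (X : R) : 0 <= X -> \sum_(j < N) (j%:R <= X)%R%:R <= X + 1.
Proof.
move=> X0; have /andP[t1 t2] := truncn_itv X0; set n := Num.truncn X in t1 t2.
apply: (@le_trans _ _ (\sum_(j < N) (j < n.+1)%N%:R)).
  apply: ler_sum => j _; rewrite ler_nat; case: (boolP (j%:R <= X)) => // jX.
  by rewrite -(ltr_nat R) (le_lt_trans jX).
rewrite -natr_sum; apply: (@le_trans _ _ n.+1%:R); last by rewrite -natr1 lerD2r.
rewrite ler_nat -(big_mkord xpredT (fun j => nat_of_bool (j < n.+1)%N)).
suff -> : (\sum_(0 <= k < N) (k < n.+1) = minn N n.+1)%N by rewrite geq_minr.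
elim: N => [|N IH]; first by rewrite big_geq// min0n.
by rewrite big_nat_recr//= IH /minn; case: (ltnP N n.+1); case: (ltnP N.+1 n.+1); lia.
Qed.

(** At a counted scale 2^j is at most a multiple of 1 + P, so j is at most a
    multiple of log^+ P plus a constant. *)
Lemma scount_bound (kappa : R) N t (P : R) : 0 < kappa -> 0 <= P ->
  (forall j, (j < N)%N -> xr mu j t <= 2 * 2 ^- j * (2 * P + 1)) ->
  scount kappa N t <= 1 + 2 * logplus (6 / kappa) + 2 * logplus P.
Proof.
move=> k0 P0 H; pose X := 2 * (logplus (6 / kappa) + logplus P).
have X0 : 0 <= X by rewrite mulr_ge0// addr_ge0// logplus_ge0.
rewrite (_ : 1 + _ + _ = X + 1); last by rewrite /X; ring.
apply: le_trans (count_le N X0); apply: ler_sum => j _; rewrite ler_nat.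
case: (boolP (kappa <= _)) => // kx; suff -> : (nat_of_ord j)%:R <= X by [].
have h := le_trans kx (H j (ltn_ord j)).
have six : 0 <= 6 / kappa by rewrite divr_ge0// ltW.
have e2 : 2 ^+ j <= Num.max 1 (6 / kappa) * Num.max 1 P.
  apply: le_trans (_ : 6 / kappa * Num.max 1 P <= _); last first.
    by rewrite ler_wpM2r ?le_max ?lexx ?ler01 ?orbT.
  rewrite mulrAC ler_pdivlMr// mulrC -ler_pdivlMr ?exprn_gt0//.
  apply: le_trans h _; rewrite mulrAC ler_wpM2r ?(ltW (pow2N_gt0 _))//.
  have m1 : 1 <= Num.max 1 P by rewrite le_max lexx.
  have mP : P <= Num.max 1 P by rewrite le_max lexx orbT.
  by move: m1 mP; move: (Num.max 1 P) => *; lra.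
have : ln (2 ^+ j) <= logplus (6 / kappa) + logplus P.
  rewrite !logplusE// -lnM ?posrE ?max1_gt0// ler_ln ?posrE ?exprn_gt0 ?mulr_gt0 ?max1_gt0//.
have lnE : ln (2 ^+ j) = ln 2 *+ j :> R by exact: lnXn.
rewrite lnE -(mulr_natr (ln 2) j) => h2.
have h3 : 1 / 2 * j%:R <= ln 2 * j%:R :> R by rewrite ler_wpM2r// ln2_ge_half.
by have := le_trans h3 h2; rewrite /X; move: (logplus _ + _) => *; lra.
Qed.

Lemma indic_super (f : R -> R) (k t : R) :
  \1_(f @^-1` `[k, +oo[%classic) t = (k <= f t)%R%:R :> R.
Proof.
rewrite indicE; suff -> : (t \in f @^-1` `[k, +oo[%classic) = (k <= f t) by [].
by apply/idP/idP; rewrite inE /= in_itv/= andbT.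
Qed.

Lemma measurable_scount kappa N : measurable_fun setT (scount kappa N).
Proof.
apply: measurable_sum => j.
rewrite (_ : (fun t => _) = \1_(xr mu j @^-1` `[kappa, +oo[%classic)).
  apply: measurable_indic; rewrite -[X in measurable X]setTI; exact: measurable_xr.
by apply/funext => t; rewrite indic_super.
Qed.

Lemma limn_einf_lb (u : (\bar R)^nat) (a : \bar R) m : (forall n, (m <= n)%N -> (a <= u n)%E) ->
  (a <= limn_einf u)%E.
Proof.
move=> H; rewrite limn_einf_lim; apply: lime_ge; first exact: is_cvg_einfs.
exists m => // n /= mn; apply: le_ereal_inf_tmp => _ [k /= nk <-]; apply: H.
exact: leq_trans nk.
Qed.

Lemma limn_einf_ub (u : (\bar R)^nat) (a : \bar R) m : (forall n, (m <= n)%N -> (u n <= a)%E) ->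
  (limn_einf u <= a)%E.
Proof.
move=> H; rewrite limn_einf_lim; apply: lime_le; first exact: is_cvg_einfs.
exists m => // n /= mn; apply: le_trans (H n mn); apply: ereal_inf_lbound.
by exists n => /=.
Qed.

(** Along almost every radius the scales at which Re p is large are counted,
    up to constants, by the logarithm of |p'| further out; Fatou's lemma then
    integrates this count. *)
Lemma scount_integral (kappa : R) : singular mu -> Nevanlinna (derive1 S) -> 0 < kappa ->
  exists B : R, forall N, (\int[lam]_(t in turn) (scount kappa N t)%:E <= B%:E)%E.
Proof.
move=> sing nev k0; have [A HA] := nevanlinna_wlog nev.
have [Z1 [mZ1 Z10 sZ1]] := radial_bounded (pd_chain mu) (pd_bounded mu) HA.
have [Z2 [mZ2 Z20 sZ2]] := radial_liminf0 sing.
have [B [r0 [r01 B0 HB]]] := nevanlinna_pd nev.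
pose C : R := 1 + 2 * logplus (6 / kappa).
have C0 : 0 <= C by rewrite addr_ge0// mulr_ge0// logplus_ge0.
exists (C * (2 * pi) + 2 * B) => N.
have mt : measurable (turn : set R) := measurable_turn.
pose Z := Z1 `|` Z2; have mZ : measurable Z by exact: measurableU.
have Z0 : lam Z = 0%E by rewrite -[LHS]/(lam (Z1 `|` Z2)) measureU0.
pose D : set R := turn `\` Z; have mD : measurable D by exact: measurableD.
have sc0 t : 0 <= scount kappa N t by apply: sumr_ge0.
have msc E : measurable_fun E (fun t => (scount kappa N t)%:E).
  by apply: measurable_funTS; apply/measurable_EFinP; exact: measurable_scount.
have -> : (\int[lam]_(t in turn) (scount kappa N t)%:E = \int[lam]_(t in D) (scount kappa N t)%:E)%E.
  by apply: ge0_negligible_integral => //; try exact: msc; move=> t _; rewrite lee_fin.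
pose f n t : \bar R := (C + 2 * logplus (prad n t))%:E.
have f0 n t : (0 <= f n t)%E by rewrite lee_fin addr_ge0// mulr_ge0// logplus_ge0.
have mf n E : measurable_fun E (f n).
  apply: measurable_funTS; apply/measurable_EFinP; apply: measurable_funD => //.
  by apply: measurable_funM => //; apply: measurable_pd; exact: rad01.
have pw t : D t -> ((scount kappa N t)%:E <= limn_einf (f^~ t))%E.
  move=> [tt nZ].
  have n1 : ~ (forall Lam, exists r, 1 / 2 <= r < 1 /\ Lam < wlog (pd mu) r t).
    by move=> h; apply: nZ; left; apply: sZ1.
  have n2 : ~ (exists e M, 0 < e /\ forall n, (M <= n)%N -> e <= xr mu n t).
    by move=> h; apply: nZ; right; apply: sZ2.
  (* A bound for log (1 + |p'|^2) on this radius, hence one for |p'|. *)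
  have [Lam HL] : exists Lam, forall r, 1 / 2 <= r < 1 -> wlog (pd mu) r t <= Lam.
    apply: contrapT => h; apply: n1 => Lam; apply: contrapT => h2; apply: h.
    exists Lam => r rr; rewrite leNgt; apply/negP => lt; apply: h2; by exists r.
  have HM r : 1 / 2 <= r < 1 -> cmod (pd mu (r%:C * expi t)) <= expR Lam.
    move=> rr; have w := HL r rr; have L0 : 0 <= Lam := le_trans (wlog_ge0 (pd mu) r t) w.
    have e1 : 1 <= expR Lam by rewrite -expR0 ler_expR.
    have : 1 + cmod (pd mu (r%:C * expi t)) ^+ 2 <= expR Lam.
      by rewrite -[leLHS]lnK ?posrE ?ltr_wpDr ?sqr_ge0// ler_expR.
    move=> h; rewrite -(ler_pXn2r (n:=2)) ?nnegrE ?cmod_ge0 ?expR_ge0//.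
    by move: h e1; move: (cmod _ ^+ 2) (expR Lam) => a b *; nra.
  have Hx (e : R) m : 0 < e -> exists2 n, (m <= n)%N & xr mu n t < e.
    move=> e0; apply: contrapT => h; apply: n2; exists e, m; split => // n mn.
    by rewrite leNgt; apply/negP => lt; apply: h; exists n.
  have Hq := qd_radial_bound (expR_ge0 Lam) HM Hx.
  have [n0 Hn0] := xr_bound Hq.
  apply: (@limn_einf_lb _ _ (maxn n0 N)) => n; rewrite geq_max => /andP[n0n Nn].
  rewrite lee_fin /C; apply: scount_bound => //; first exact: cmod_ge0.
  by move=> j jN; apply: Hn0 => //; apply: leq_trans Nn; exact: ltnW.
apply: (@le_trans _ _ (\int[lam]_(t in D) limn_einf (f^~ t))%E).
  apply: ge0_le_integral => //.
  - by move=> t _; rewrite lee_fin.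
  - exact: msc.
  - have -> : (fun t => limn_einf (f^~ t)) = (fun t => - limn_esup ((fun n => (- f n t)%E)))%E.
      apply/funext => t; have := limn_einfN (fun n => (- f n t)%E).
      have -> : -%E \o (fun n => (- f n t)%E) = f^~ t by apply/funext => n; exact: oppeK.
      exact.
    apply: measurableT_comp => //; apply: measurable_fun_limn_esup => n.
    by apply: measurableT_comp => //; exact: mf.
apply: le_trans (fatou lam mD _ _) _ => //; first by move=> n; exact: mf.
have [m Hm] := @pow2_below R (1 - r0) ltac:(by rewrite subr_gt0; case/andP: r01).
apply: (@limn_einf_ub _ _ m.+1) => n mn.
have rn : r0 < (rad n : R) < 1.
  have /andP[_ ->] := @rad01 R n; rewrite andbT /rad ltrBrDr -ltrBrDl.
  by apply: lt_le_trans Hm; rewrite ltf_pV2 ?posrE ?exprn_gt0// ltr_eXn2l// ltr1n.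
have r01n := @rad01 R n.
apply: (@le_trans _ _ (\int[lam]_(t in `[0%R, (2 * pi)%R]) f n t)%E).
  apply: ge0_subset_integral => //; first exact: mf.
  by move=> t [+ _]; rewrite /turn/= !in_itv/= => /andP[-> /ltW].
have mp : measurable_fun `[0, 2 * pi]%classic (fun t => (logplus (prad n t))%:E).
  by apply: measurable_funTS; apply/measurable_EFinP; exact: measurable_pd.
have -> : (\int[lam]_(t in `[0%R, (2 * pi)%R]) f n t =
    \int[lam]_(t in `[0%R, (2 * pi)%R]) (C%:E + 2%:E * (logplus (prad n t))%:E))%E.
  by apply: eq_integral => t _; rewrite -EFinM -EFinD.
rewrite ge0_integralD//; last 2 first.
- by move=> t _; rewrite mule_ge0 ?lee_fin// logplus_ge0.
- exact: emeasurable_funM.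
rewrite integral_cst// ge0_integralZl//; last by move=> t _; rewrite lee_fin logplus_ge0.
rewrite [leRHS]EFinD; apply: leeD.
  rewrite [leRHS](EFinM C (2 * pi)); apply: lee_wpmul2l; first by rewrite lee_fin.
  have lI : lam `[0, 2 * pi]%classic = (2 * pi)%:E.
    by rewrite lebesgue_measure_itv/= lte_fin two_pi_gt0 sube0.
  by rewrite -[leLHS]/(lam `[0, 2 * pi]%classic) lI.
by rewrite [leRHS](EFinM 2 B); apply: lee_wpmul2l; [rewrite lee_fin|exact: HB].
Qed.

(** Harnack's inequality between the centre of the box and the point of the
    radius at the same height; 162 is 2 (1 + 8)^2. *)
Lemma bad_scount (kappa : R) j i t : bad mu kappa j i -> cell j i t -> kappa / 162 <= xr mu j t.
Proof.
move=> b tc; have /andP[j0 j1] := @rad01 R j; have z1 : cmod ((rad j)%:C * expi t) < 1 by rewrite cmod_rpol.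
have := herg_harnack mu (z := (rad j)%:C * expi t) (z' := zc j i) (A := 8) (B := 1) z1 (cmod_zc_lt1 _ _).
rewrite cmod_zc cmod_rpol// mul1r => H.
have d : cmod (zc j i - (rad j)%:C * expi t) <= 8 * (1 - (1 - 2 ^- j)).
  rewrite (_ : 1 - (1 - 2 ^- j) = 2 ^- j); last by ring.
  rewrite /zc -/(rad j) -mulrBr cmodM cmodR ger0_norm//.
  apply: le_trans (_ : 1 * wid j <= _); last by rewrite mul1r ltW// wid_lt8.
  apply: ler_pM; rewrite ?cmod_ge0 ?(ltW j1)//; apply: le_trans (cmod_expiB_le _ _) _.
  move: tc; rewrite /cell/= in_itv/= cell_len => /andP[t1 t2].
  by rewrite distrC ger0_norm ?subr_ge0// lerBlDl ltW.
have := H ltac:(by []) ltac:(by []) d ltac:(by []).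
move: b; rewrite /bad -/(xr mu j t) => b h; have := le_trans b h.
by move: (xr mu j t) => *; lra.
Qed.

(** A bad box makes its scale count for all angles in its arc, whose length is at
    least 2^-j. *)
Lemma badsum_scount (kappa : R) N :
  ((badsum mu kappa N)%:E <= \int[lam]_(t in turn) (scount (kappa / 162) N t)%:E)%E.
Proof.
have mt : measurable (turn : set R) := measurable_turn.
pose X (j : nat) : set R := xr mu j @^-1` `[kappa / 162, +oo[%classic.
have mX j : measurable (X j) by rewrite -[X in measurable X]setTI; exact: measurable_xr.
have -> : (\int[lam]_(t in turn) (scount (kappa / 162) N t)%:E =
    \int[lam]_(t in turn) \sum_(j < N) (\1_(X j) t)%:E)%E.
  apply: eq_integral => t _; rewrite /scount sumEFin; congr EFin; apply: eq_bigr => j _.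
  by rewrite /X indic_super.
rewrite ge0_integral_sum//; last first.
  by move=> j; apply: measurable_funTS; apply/measurable_EFinP; apply: measurable_indic; exact: mX.
rewrite /badsum -sumEFin; apply: lee_sum => j _.
apply: (@le_trans _ _ (lam (X j `&` turn))); last by rewrite integral_indic//; exact: mX.
apply: (@le_trans _ _ (lam (\big[setU/set0]_(i < 2 ^ j | bad mu kappa j i) cell j i))).
  rewrite measure_bigsetU_ord_cond; last 2 first.
  - by move=> i _; exact: measurable_cell.
  - apply/trivIsetP => i i' _ _ ii'; apply/seteqP; split => // t [ti ti'].
    by move/eqP: ii'; apply; apply: val_inj; exact: cell_inj ti ti'.
  rewrite -sumEFin [leRHS]big_mkcond/=; apply: lee_sum => i _.
  case: ifP => _; last by rewrite mul0r.
  rewrite mul1r -[leRHS]/(lam (cell j i)) lam_cell lee_fin.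
  have := wid_ge4 (R := R) j; have := pow2N_gt0 (R := R) j.
  by move: (wid j) (2 ^- j) => *; lra.
apply: le_measure; rewrite ?inE.
- by apply: bigsetU_measurable => i _; exact: measurable_cell.
- by apply: measurableI => //; exact: mX.
- move=> t /in_ord_union[i [ij bi ti]]; split.
    by rewrite /X/= in_itv/= andbT; exact: bad_scount bi ti.
  by rewrite /turn/= in_itv/=; exact: cell_turn ij ti.
Qed.

Lemma badsum_of_nevanlinna (kappa : R) : singular mu -> Nevanlinna (derive1 S) -> 0 < kappa ->
  exists B : R, forall N, badsum mu kappa N <= B.
Proof.
move=> sing nev k0; have k1 : 0 < kappa / 162 by rewrite divr_gt0.
have [B HB] := scount_integral sing nev k1; exists B => N.
by rewrite -lee_fin; exact: le_trans (badsum_scount kappa N) (HB N).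
Qed.

End CountingScales.

(** * Bad sums bound the area integral *)

Section SumToArea.
Context {R : realType} (mu : {finite_measure set (plane R) -> \bar R}).
Implicit Types (t : R) (j i : nat) (z : R[i]).
Local Notation S := (singular_inner mu).
Local Notation herg := (herg mu).
Local Notation leb2 := ((@lebesgue_measure R) \x (@lebesgue_measure R))%E.

Lemma polar_form z : exists2 t, 0 <= t < 2 * pi & z = (cmod z)%:C * expi t.
Proof.
have [->|zn] := eqVneq z 0.
  by exists 0; [rewrite lexx two_pi_gt0|rewrite cmod0 mul0r].
have z0 : 0 < cmod z by rewrite cmod_gt0.
pose w : R[i] := (cmod z)^-1%:C * z.
have w1 : cmod w = 1 by rewrite cmodM cmodR ger0_norm ?invr_ge0 ?cmod_ge0// mulVf// gt_eqF.
have [t t2 wE] := @circle_ptP R (Re w, Im w) ltac:(by rewrite /circle/= /toC/=; case: w w1).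
exists t => //; have -> : expi t = w.
  by rewrite -toC_pt -wE /toC/=; case: (w).
by rewrite /w mulrA -rmorphM/= divff ?gt_eqF// mul1r.
Qed.

Lemma dyadic_shell (d : R) : 0 < d -> d <= 1 -> exists j : nat, 2 ^- j.+1 < d <= 2 ^- j.
Proof.
move=> d0 d1; have ex : exists n, (2 ^- n < d).
  have [n Hn] := @pow2_below R (d / 2) ltac:(by rewrite divr_gt0).
  by exists n; apply: le_lt_trans Hn _; lra.
have [n nd nmin] := ex_minnP ex; case: n nd nmin => [|n] nd nmin.
  by move: nd; rewrite expr0 invr1 ltNge d1.
exists n; rewrite nd/= leNgt; apply/negP => h.
by have := nmin n h; rewrite ltnn.
Qed.

(** A point of the sublevel set lies within 9 2^-j of the centre of the box
    below it, at comparable height; Harnack's inequality with A = 18 makes the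
    box bad, and 722 is 2 (1 + 18)^2. *)
Lemma sublevel_bad (c : R) p : 0 < c -> sublevel mu c p ->
  exists j i, [/\ (i < 2 ^ j)%N, bad mu (- ln c / 722) j i, square (zc j i) (10 * 2 ^- j) p &
    (1 - cmod (toC p))^-1 <= 2 * 2 ^+ j].
Proof.
move=> c0 [dp Sp]; have z1 : cmod (toC p) < 1 by [].
have x0 : - ln c < Re (herg (toC p)).
  have : expR (- Re (herg (toC p))) < c by rewrite -cmod_S.
  by rewrite -[X in _ < X]lnK ?posrE// ltr_expR ltrNl.
have [j /andP[j1 j2]] := @dyadic_shell (1 - cmod (toC p)) ltac:(by rewrite subr_gt0) ltac:(by rewrite gerBl cmod_ge0).
have [t t2 zE] := polar_form (toC p).
have [i ij ti] := cell_exists j t2.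
have pw := pow2N_gt0 (R := R) j.
have hj : 2 ^- j.+1 = 2 ^- j / 2 :> R by rewrite exprS invfM mulrC.
have dz : cmod (toC p - zc j i) <= 9 * 2 ^- j.
  rewrite zE /zc; set r := cmod (toC p).
  apply: le_trans (cmod_tri ((1 - 2 ^- j)%:C * expi t) _ _) _.
  rewrite -mulrBl -mulrBr -rmorphB (cmodM _ (expi t)) (cmodM _ (_ - _)) cmod_expi mulr1 !cmodR.
  have h1 : `|r - (1 - 2 ^- j)| <= 2 ^- j.
    by rewrite ler_norml; move: j1 j2 pw; rewrite hj -/r; move: (2 ^- j) => y *; apply/andP; split; lra.
  have h2 : `|1 - 2 ^- j| * cmod (expi t - expi (wid j * i%:R)) <= 1 * wid j.
    apply: ler_pM; rewrite ?cmod_ge0//.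
      by rewrite ger0_norm ?gerBl ?subr_ge0 ?pow2N_le1// ltW.
    apply: le_trans (cmod_expiB_le _ _) _.
    move: ti; rewrite /cell/= in_itv/= cell_len => /andP[t3 t4].
    by rewrite ger0_norm ?subr_ge0// lerBlDl ltW.
  have w8 := wid_lt8 (R := R) j.
  apply: le_trans (lerD h1 h2) _; rewrite mul1r; move: w8.
  by set w := wid j; set y := 2 ^- j; clearbody w y => w8; lra.
exists j, i; split => //.
- have := herg_harnack mu (z := zc j i) (z' := toC p) (A := 18) (B := 1) (cmod_zc_lt1 _ _) z1.
  rewrite cmod_zc mul1r (_ : 1 - (1 - 2 ^- j) = 2 ^- j); last by ring.
  move=> H; have d2 : cmod (toC p - zc j i) <= 18 * (1 - cmod (toC p)).
    by apply: le_trans dz _; move: j1; rewrite hj; move: (cmod (toC p)) (2 ^- j) => *; lra.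
  have := H ltac:(by []) ltac:(by []) d2 j2.
  rewrite /bad; move: x0; move: (Re (herg (toC p))) (Re (herg (zc j i))) (ln c) => *; lra.
- have rl := le_trans (ler_Re_cmod (toC p - zc j i)) dz.
  have il := le_trans (ler_Im_cmod (toC p - zc j i)) dz.
  have lt : 9 * 2 ^- j < 10 * 2 ^- j :> R by rewrite ltr_pM2r// ltr_nat.
  move: (le_lt_trans rl lt) (le_lt_trans il lt); rewrite ReB ImB.
  by rewrite !ltr_distl => /andP[a1 a2] /andP[b1 b2]; split; rewrite /= in_itv/= ?a1 ?b1.
- rewrite -[leRHS]invrK lef_pV2 ?posrE ?subr_gt0 ?invr_gt0 ?mulr_gt0 ?exprn_gt0//.
  by rewrite invfM mulrC -hj ltW.
Qed.

(** The squares of the bad boxes cover the sublevel set, and each has area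
    comparable to 4^-j while 1 / (1 - |z|) is at most a multiple of 2^j on the
    part of the set assigned to it. *)
Lemma area_of_badsum : (forall kappa : R, 0 < kappa -> exists B : R, forall N, badsum mu kappa N <= B) ->
  area_condition S.
Proof.
move=> HB c /andP[c0 c1]; rewrite -/(sublevel mu c).
have l0 : 0 < - ln c by rewrite oppr_gt0 ln_lt0// c0.
have k0 : 0 < - ln c / 722 by apply: (divr_gt0 l0); rewrite ltr0n.
have [B {}HB] := HB _ k0; set kappa := - ln c / 722 in k0 HB.
have mS := measurable_sublevel mu c.
pose Q j i := square (zc j i) (10 * 2 ^- j) : set (plane R).
have mQ j i : measurable (Q j i) by exact: measurable_square.
pose g j (p : plane R) : \bar R := (\sum_(i < 2 ^ j) ((bad mu kappa j i)%:R * (2 * 2 ^+ j))%:E * (\1_(Q j i) p)%:E)%E.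
have t0 j i : 0 <= (bad mu kappa j i)%:R * (2 * 2 ^+ j) :> R by rewrite !mulr_ge0// exprn_ge0.
have g0 j p : (0 <= g j p)%E by apply: sume_ge0 => i _; rewrite mule_ge0// lee_fin.
have mg j : measurable_fun setT (g j).
  apply: emeasurable_sum => i; apply: emeasurable_funM => //.
  by apply/measurable_EFinP; exact: measurable_indic.
apply: (@le_lt_trans _ _ (\int[leb2]_p \sum_(0 <= j <oo) g j p)%E); last first.
  rewrite integral_nneseries//.
  apply: (@le_lt_trans _ _ (800 * B)%:E); last by rewrite ltry.
  apply: lime_le; first by apply: is_cvg_nneseries => j _ _; exact: integral_ge0.
  apply: nearW => N; apply: (@le_trans _ _ (800 * badsum mu kappa N)%:E); last first.
    by rewrite lee_fin; exact: (ler_wpM2l (ler0n R 800) (HB N)).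
  rewrite /badsum mulr_sumr -sumEFin big_mkord; apply: lee_sum => j _.
  rewrite /g ge0_integral_sum//; last first.
    move=> i; apply: emeasurable_funM => //.
    by apply/measurable_EFinP; apply: measurable_indic; exact: mQ.
  rewrite mulr_sumr -sumEFin; apply: lee_sum => i _.
  rewrite ge0_integralZl//; try (by rewrite lee_fin);
    try (by apply/measurable_EFinP; apply: measurable_indic; exact: mQ).
  have -> : (\int[leb2]_p (\1_(Q j i) p)%:E = leb2 (Q j i))%E.
    by rewrite integral_indic ?setIT//; exact: mQ.
  rewrite /Q square_measure; last by rewrite mulr_ge0// ltW// pow2N_gt0.
  rewrite -EFinM lee_fin le_eqVlt; apply/orP; left; apply/eqP.
  by field; rewrite expf_neq0.
rewrite [leLHS]integral_mkcond; apply: ge0_le_integral => //.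
- move=> p _; rewrite /patch; case: ifP => // ps.
  by rewrite lee_fin invr_ge0 subr_ge0 ltW//; move: ps; rewrite inE => -[].
- by apply/(measurable_restrictT _ _).1 => //; exact: measurable_invdist.
- by apply: ge0_emeasurable_sum => [k p _ _|k _]; [exact: g0|exact: mg].
- move=> p _; rewrite /patch; case: ifPn => [|_]; last by apply: nneseries_ge0.
  rewrite inE => /(sublevel_bad c0)[j [i [ij bi qi le]]].
  apply: (@le_trans _ _ (g j p)).
    rewrite /g (bigD1 (Ordinal ij))//= bi mul1r indicE mem_set// mule1.
    apply: le_trans (_ : (2 * 2 ^+ j)%:E <= _)%E; first by rewrite lee_fin.
    by rewrite leeDl// sume_ge0// => k _; rewrite mule_ge0// lee_fin.
  apply: le_trans (_ : (\sum_(0 <= k < j.+1) g k p <= _)%E).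
    by rewrite big_nat_recr//= leeDr// sume_ge0.
  exact: nneseries_lim_ge.
Qed.

Lemma area_of_nevanlinna : singular mu -> Nevanlinna (derive1 S) -> area_condition S.
Proof.
by move=> sing nev; apply: area_of_badsum => kappa; exact: badsum_of_nevanlinna.
Qed.

End SumToArea.

Theorem theorem1p1 (R : realType)
    (mu : {finite_measure set (plane R) -> \bar R})
    (mu_circle : on_circle mu) (mu_singular : singular mu) :
  ((exists E : set (plane R), Beurling_Carleson E /\ supported_on mu E) ->
     Nevanlinna (derive1 (singular_inner mu))) /\
  (Nevanlinna (derive1 (singular_inner mu)) ->
     area_condition (singular_inner mu)) /\
  (area_condition (singular_inner mu) ->
     exists E : nat -> set (plane R),
       (forall n, Beurling_Carleson (E n)) /\
       supported_on mu (\bigcup_n E n)).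
Proof.
split; [|split].
- by move=> [E [BC sE]]; exact: supported_on_BC_nevanlinna BC sE.
- exact: area_of_nevanlinna.
- exact: area_condition_carried.
Qed.
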